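(* Let $n\ge0$, $M=\{z\in\mathbb C^{n+1}: |z^0|^2>\sum_{i=1}^n|z^i|^2\}$ and $\mathfrak F=\frac i2\big((z^0)^2-\sum_{i=1}^n(z^i)^2\big)$, so that the associated projective special Kähler manifold $(\overline M,g_{\overline M})$ is the complex hyperbolic space $\mathbb CH^n$. Let $m\in\mathbb Z\setminus\{0\}$, let $\Omega$ be given by $\mathrm{Supp}(\Omega)=\{\pm\partial_{y_0}\}$, $\Omega(\pm\partial_{y_0})=m$, let $M_K=\{z\in M:|z^0|>K\}$ with $K>0$ sufficiently large that $\Omega$ is compatible over $M_K$, and let $(\overline N,g_{\overline N})$ be the resulting quaternionic-Kähler metric (with $M_\infty=M_K$; see context). Then there is a neighborhood $\overline N_\infty\subset\overline N_+$ of $\rho=\infty$ on which both quaternionic-Kähler metrics $g^c_{\mathrm{FS}}$ and $g_{\overline N}$ associated to $(\mathbb CH^n,g_{\overline M})$ are defined and positive definite. In particular, $g_{\overline N}$ gives a deformation of $g^c_{\mathrm{FS}}$ on $\overline N_\infty$ ($g^c_{\mathrm{FS}}$ being the metric obtained by putting $\Omega=0$ in the construction of $g_{\overline N}$).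
   Context: **Geometry of $M$.** With $\tau_{ij}=\partial^2\mathfrak F/\partial z^i\partial z^j=\mathrm{diag}(i,-i,\dots,-i)$, $N_{ij}=\mathrm{Im}\,\tau_{ij}=\mathrm{diag}(1,-1,\dots,-1)$, $w_i=\tau_{ij}z^j$, $x^i=\mathrm{Re}\,z^i$, $y_i=-\mathrm{Re}\,w_i$: $g_M=N_{ij}dz^id\overline z^j$, $\omega_M=\frac i2N_{ij}dz^i\wedge d\overline z^j=dx^i\wedge dy_i$, $\nabla=d$ the flat connection with $dx^i,dy_i$ parallel, $\xi=z^i\partial_{z^i}+\overline z^i\partial_{\overline z^i}$, $J$ the complex structure, $\Lambda=\mathrm{span}_{\mathbb Z}\{\partial_{x^i},\partial_{y_i}\}$ with pairing $\langle\cdot,\cdot\rangle=\omega_M|_{\Lambda\times\Lambda}$ and Darboux frame $(\widetilde\gamma_i,\gamma^i)=(\partial_{x^i},\partial_{y_i})$; central charge $Z$ (section of $\Lambda^*\otimes\mathbb C$): $Z_{\partial_{y_i}}=z^i$, $Z_{\partial_{x^i}}=w_i$. $r^2=N_{ij}z^i\overline z^j$, $\widetilde\eta=r^{-2}g_M(J\xi,\cdot)$, $d^c=i(\overline\partial-\partial)$. $\overline M=M/\mathbb C^\times$ (a point if $n=0$), coordinates $X^i=z^i/z^0$, $X^0:=1$, $\mathcal K=-\log(1-\sum_{i=1}^n|X^i|^2)$, $g_{\overline M}=\frac{\partial^2\mathcal K}{\partial X^i\partial\overline X^j}dX^id\overline X^j$. **Hyperkähler structure.** $N:=T^*M_K/\Lambda^*$,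 projection $\pi_M$; $\theta_\gamma([\alpha])=2\pi\alpha(\gamma)$ mod $2\pi$; pullbacks omitted; $\langle dA\wedge dB\rangle:=dA_{\widetilde\gamma_i}\wedge dB_{\gamma^i}-dA_{\gamma^i}\wedge dB_{\widetilde\gamma_i}$. With $K_0,K_1$ modified Bessel functions of the second kind, $$V_\gamma^{\mathrm{inst}}=\frac1{2\pi}\sum_{k>0}e^{ik\theta_\gamma}K_0(2\pi k|Z_\gamma|),\quad A_\gamma^{\mathrm{inst}}=-\frac1{4\pi}\sum_{k>0}e^{ik\theta_\gamma}|Z_\gamma|K_1(2\pi k|Z_\gamma|)\Big(\frac{dZ_\gamma}{Z_\gamma}-\frac{d\overline Z_\gamma}{\overline Z_\gamma}\Big),$$ $$\omega_1+i\omega_2=-\frac1{2\pi}\langle dZ\wedge d\theta\rangle+\sum_\gamma\Big(\Omega(\gamma)dZ_\gamma\wedge A_\gamma^{\mathrm{inst}}+\frac{i\Omega(\gamma)}{2\pi}V_\gamma^{\mathrm{inst}}d\theta_\gamma\wedge dZ_\gamma\Big),$$ $$\omega_3=\frac14\langle dZ\wedge d\overline Z\rangle-\frac1{8\pi^2}\langle d\theta\wedge d\theta\rangle+\sum_\gamma\Big(\frac{i\Omega(\gamma)}2V_\gamma^{\mathrm{inst}}dZ_\gamma\wedge d\overline Z_\gamma+\frac{\Omega(\gamma)}{2\pi}d\theta_\gamma\wedge A_\gamma^{\mathrm{inst}}\Big),$$ sums over $\gamma\in\{\pm\partial_{y_0}\}$. Compatible means $T=\pi_M^*g_M+\sum_\gamma\Omega(\gamma)V_\gamma^{\mathrm{inst}}|dZ_\gamma|^2$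 is non-degenerate on $TN/\ker d\pi_M$ (true for $K$ large); then $\omega_\alpha=g_N(I_\alpha\cdot,\cdot)$ for a pseudo-hyperkähler structure $(g_N,I_1,I_2,I_3)$, $I_\alpha=-\omega_\beta^{-1}\circ\omega_\gamma$ (cyclic). $V$ is the horizontal lift of $J\xi$ to $N$ ($d\theta_\gamma(V)=0$), $X:=2V$. **Circle bundle and QK metric.** Identify $T^*M_K\cong\Lambda^*\otimes\mathbb R$ by $\alpha\mapsto\theta=2\pi\alpha|_\Lambda$. $P$ is the quotient of $T^*M_K\times\mathbb R_\sigma$ by $(2\pi\delta,\pi k)\cdot(\theta,\sigma)=(\theta+2\pi\delta,\sigma+\pi k+\frac12\langle\delta,\theta\rangle)$, $\delta\in\Lambda^*,k\in\mathbb Z$, where $\langle\delta,\theta\rangle=\delta_{\widetilde\gamma_i}\theta_{\gamma^i}-\delta_{\gamma^i}\theta_{\widetilde\gamma_i}$; $\pi_N:P\to N$ is a principal circle bundle. Put $$\eta_\gamma^{\mathrm{inst}}=\frac i{8\pi^2}\sum_{k>0}\frac{e^{ik\theta_\gamma}}k|Z_\gamma|K_1(2\pi k|Z_\gamma|)\Big(\frac{dZ_\gamma}{Z_\gamma}-\frac{d\overline Z_\gamma}{\overline Z_\gamma}\Big),\quad\eta^{\mathrm{inst}}=\sum_\gamma\Omega(\gamma)\eta_\gamma^{\mathrm{inst}}-\iota_V(g_N-\pi_M^*g_M),$$ $\eta=d\sigma-\frac1{4\pi}\langle\theta,d\theta\rangle+2\pi(-\frac12r^2\widetilde\eta+\eta^{\mathrm{inst}})$.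 For a fixed $c\in\mathbb R$: $f=2\pi r^2-c+4\pi\sum_\gamma\Omega(\gamma)\iota_V\eta_\gamma^{\mathrm{inst}}$, $f_1=-2\pi r^2-c+4\pi\iota_V\eta^{\mathrm{inst}}$, $N'=\{f\ne0,f_1\ne0,g_N(X,X)\ne0\}\subset N$. On $P|_{N'}$: $g_P=\frac2{f_1}\eta^2+2\pi g_N$, $\theta_0^P=-\frac12df$, $\theta_1^P=\eta+\frac12\iota_X(2\pi g_N)$, $\theta_2^P=\frac12\iota_X(2\pi\omega_2)$, $\theta_3^P=-\frac12\iota_X(2\pi\omega_1)$; $\overline N=\{\mathrm{Arg}(z^0)=0\}\subset P|_{N'}$, $g_{\overline N}:=-\frac1f\big(g_P-\frac2f\sum_{i=0}^3(\theta_i^P)^2\big)\big|_{\overline N}$, and $\overline N_+=\{f>0,f_1<0\}\subset\overline N$. **Coordinates and $g^c_{\mathrm{FS}}$.** Coordinates on $\overline N$: $\rho=2\pi r^2-c$, $X^i$ $(1\le i\le n)$, $\widetilde\theta_i=\theta_{\partial_{x^i}}$, $\theta^i=\theta_{\partial_{y_i}}$, $\sigma$. In them the 1-loop corrected Ferrara–Sabharwal metric is $$g_{\mathrm{FS}}^c=\frac{\rho+c}\rho g_{\overline M}+\frac{\rho+2c}{4(\rho+c)\rho^2}d\rho^2+\frac{4(\rho+c)}{\rho^2(\rho+2c)}\Big(d\sigma-\frac1{4\pi}\langle\theta,d\theta\rangle-\frac c4d^c\mathcal K\Big)^2-\frac1{2\pi\rho}W_i\Big(N^{ij}-\frac{2(\rho+c)e^{\mathcal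 K}}\rho X^i\overline X^j\Big)\overline W_j,$$ with $W_i=d\widetilde\theta_i-\tau_{ij}d\theta^j$, $(N^{ij})=(N_{ij})^{-1}$. A neighborhood of $\rho=\infty$ is an open set which, for fixed values of the remaining coordinates $(X^i,\theta^i,\widetilde\theta_i,\sigma)$, contains all points with $\rho$ sufficiently large. *)

(* Defs.v *)
From HB Require Import structures.
From mathcomp Require Import all_boot all_order all_algebra.
From mathcomp Require Import all_classical all_reals all_analysis.
From mathcomp Require Import complex.

Set Implicit Arguments.
Unset Strict Implicit.
Unset Printing Implicit Defensive.

Import Order.TTheory GRing.Theory Num.Theory.
Import numFieldNormedType.Exports.

Local Open Scope classical_set_scope.
Local Open Scope ring_scope.
Local Open Scope complex_scope.

Notation cRe := (@complex.Re _).
Notation cIm := (@complex.Im _).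
Notation cabs := (@ComplexField.Normc.normc _).

Section SpecialFunctions.
Context {R : realType}.

Definition cosh (t : R) : R := (expR t + expR (- t)) / 2.

(* K_nu(x) = int_0^oo exp(-x cosh t) cosh(nu t) dt, for x > 0. *)
Definition besselK (nu : nat) (x : R) : R :=
  \int[lebesgue_measure]_(t in `[0%R, +oo[)
     (expR (- (x * cosh t)) * cosh (nu%:R * t)).

Definition cexpi (t : R) : R[i] := cos t +i* sin t.

(* sum_{k > 0} u k, real and imaginary parts separately *)
Definition csum (u : nat -> R[i]) : R[i] :=
  limn (fun m : nat => \sum_(1 <= k < m) cRe (u k)) +i*
  limn (fun m : nat => \sum_(1 <= k < m) cIm (u k)).

End SpecialFunctions.

(* (a, b) stands for a^i d/dx^i + b_i d/dy_i in Lambda; the same type also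
   serves for Lambda^*, (a, b) then being the values of the functional on
   the frame (d/dx^i, d/dy_i). *)
Notation latvec n := ('rV[int]_n.+1 * 'rV[int]_n.+1)%type.

Section Lattice.
Context {n : nat}.

Definition ddx (i : 'I_n.+1) : latvec n := (delta_mx ord0 i, 0).
Definition ddy (i : 'I_n.+1) : latvec n := (0, delta_mx ord0 i).

Definition support_charges : seq (latvec n) := [:: ddy ord0; - ddy ord0].

End Lattice.

(* Points and tangent vectors of T^*M, which is an open subset of this
   vector space: the rows are Re z^i, Im z^i, thetatilde_i, theta^i. *)
Notation cotM R n := 'M[R]_(4, n.+1).

(* Points and tangent vectors of T^*M x R_sigma, of which P is a quotient. *)
Notation coverP R n := (cotM R n * R)%type.

Section Construction.
Context {R : realType} {n : nat}.
Local Notation C := R[i].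
Local Notation T := (cotM R n).

Definition blk (a : nat) (p : T) (i : 'I_n.+1) : R := p (inord a) i.

Definition zc (p : T) (i : 'I_n.+1) : C := blk 0 p i +i* blk 1 p i.
Definition thetat (p : T) (i : 'I_n.+1) : R := blk 2 p i.
Definition thetau (p : T) (i : 'I_n.+1) : R := blk 3 p i.

(* Hessian of the prepotential (i/2) ((z^0)^2 - sum_{i>0} (z^i)^2) *)
Definition tau : 'M[C]_n.+1 :=
  diag_mx (\row_i (if i == ord0 then 'i%C else - 'i%C)).

Definition Nmx : 'M[R]_n.+1 := map_mx cIm tau.

Definition wc (p : T) (i : 'I_n.+1) : C := \sum_j tau i j * zc p j.

Definition inM (p : T) : Prop :=
  \sum_(i | i != ord0) cabs (zc p i) ^+ 2 < cabs (zc p ord0) ^+ 2.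
Definition inMK (K : R) (p : T) : Prop := inM p /\ K < cabs (zc p ord0).

(* pi_M^* g_M, where N_ij dz^i dzbar^j is read as a real symmetric tensor *)
Definition gM (u v : T) : R :=
  cRe (\sum_i \sum_j (Nmx i j)%:C * zc u i * (zc v j)^*%C).

Definition r2 (p : T) : R :=
  cRe (\sum_i \sum_j (Nmx i j)%:C * zc p i * (zc p j)^*%C).

(* Z_gamma and theta_gamma are linear, so the same functions applied to
   tangent vectors are dZ_gamma and dtheta_gamma. *)
Definition Zg (g : latvec n) (p : T) : C :=
  \sum_i ((g.1 ord0 i)%:~R * wc p i + (g.2 ord0 i)%:~R * zc p i).
Definition thg (g : latvec n) (p : T) : R :=
  \sum_i ((g.1 ord0 i)%:~R * thetat p i + (g.2 ord0 i)%:~R * thetau p i).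

Definition dZ (g : latvec n) : T -> C := Zg g.
Definition dZbar (g : latvec n) (u : T) : C := (Zg g u)^*%C.
Definition dth (g : latvec n) (u : T) : C := (thg g u)%:C.

Definition wedge (a b : T -> C) (u v : T) : C := a u * b v - a v * b u.
Definition pair_wedge (A B : latvec n -> T -> C) (u v : T) : C :=
  \sum_i (wedge (A (ddx i)) (B (ddy i)) u v - wedge (A (ddy i)) (B (ddx i)) u v).

Definition Vinst (g : latvec n) (p : T) : C :=
  (2 * pi)^-1%:C *
  csum (fun k => cexpi (k%:R * thg g p) *
                 (besselK 0 (2 * pi * k%:R * cabs (Zg g p)))%:C).

Definition dlogZ (g : latvec n) (p u : T) : C :=
  dZ g u / Zg g p - dZbar g u / (Zg g p)^*%C.

Definition Ainst (g : latvec n) (p u : T) : C :=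
  - (4 * pi)^-1%:C *
  csum (fun k => cexpi (k%:R * thg g p) *
                 (cabs (Zg g p) * besselK 1 (2 * pi * k%:R * cabs (Zg g p)))%:C)
  * dlogZ g p u.

Definition eta_inst_g (g : latvec n) (p u : T) : C :=
  'i%C * (8 * pi ^+ 2)^-1%:C *
  csum (fun k => cexpi (k%:R * thg g p) / k%:R *
                 (cabs (Zg g p) * besselK 1 (2 * pi * k%:R * cabs (Zg g p)))%:C)
  * dlogZ g p u.

Section BPS.
Variable Om : latvec n -> int.

Definition omega12 (p u v : T) : C :=
  - (2 * pi)^-1%:C * pair_wedge dZ dth u v
  + \sum_(g <- support_charges)
      ((Om g)%:~R * wedge (dZ g) (Ainst g p) u v
       + 'i%C * (Om g)%:~R * (2 * pi)^-1%:C * Vinst g p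
         * wedge (dth g) (dZ g) u v).

Definition omega1 (p u v : T) : R := cRe (omega12 p u v).
Definition omega2 (p u v : T) : R := cIm (omega12 p u v).

(* The expression under cRe is real: the contributions of gamma and -gamma
   are complex conjugate.  So are the other sums over charges below. *)
Definition omega3 (p u v : T) : R := cRe (
  4^-1 * pair_wedge dZ dZbar u v
  - (8 * pi ^+ 2)^-1%:C * pair_wedge dth dth u v
  + \sum_(g <- support_charges)
      ('i%C * (Om g)%:~R / 2 * Vinst g p * wedge (dZ g) (dZbar g) u v
       + (Om g)%:~R * (2 * pi)^-1%:C * wedge (dth g) (Ainst g p) u v)).

Definition Tform (p u v : T) : R :=
  gM u v + cRe (\sum_(g <- support_charges)
                  (Om g)%:~R * Vinst g p * (cRe (dZ g u * dZbar g v))%:C).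

(* An element of ker d(pi_M) is a vector with vanishing z-component. *)
Definition compatible (K : R) : Prop :=
  forall p : T, inMK K p ->
  forall u : T, (forall v : T, Tform p u v = 0) -> forall i, zc u i = 0.

Definition gram (w : T -> T -> R) : 'M[R]_(4 * n.+1) :=
  \matrix_(a, b) w (vec_mx (delta_mx ord0 a)) (vec_mx (delta_mx ord0 b)).

(* Endomorphisms act on row vectors from the right, and w is the map
   u |-> w(u, .), so that (I_3 u) is determined by
   omega1(I_3 u, .) = - omega2(u, .), that is I_3 = - omega1^-1 o omega2. *)
Definition I3mx (p : T) : 'M[R]_(4 * n.+1) :=
  - gram (omega2 p) *m invmx (gram (omega1 p)).

(* The metric determined by omega3 = g_N(I_3 ., .); the indices 1 and 2 give
   the same metric. *)
Definition gN (p u v : T) : R :=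
  (mxvec u *m (invmx (I3mx p) *m gram (omega3 p)) *m (mxvec v)^T) ord0 ord0.

(* horizontal lift of J xi; in coordinates dz^i(J xi) = i z^i *)
Definition Vfield (p : T) : T :=
  \matrix_(a, i) (if a == inord 0 then - blk 1 p i
                  else if a == inord 1 then blk 0 p i else 0).
Definition Xfield (p : T) : T := 2 *: Vfield p.

Definition etatilde (p u : T) : R := (r2 p)^-1 * gM (Vfield p) u.

Definition eta_inst (p u : T) : R :=
  cRe (\sum_(g <- support_charges) (Om g)%:~R * eta_inst_g g p u)
  - (gN p (Vfield p) u - gM (Vfield p) u).

Definition fham (c : R) (p : T) : R :=
  2 * pi * r2 p - c
  + 4 * pi * cRe (\sum_(g <- support_charges)
                    (Om g)%:~R * eta_inst_g g p (Vfield p)).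

Definition fham1 (c : R) (p : T) : R :=
  - (2 * pi * r2 p) - c + 4 * pi * eta_inst p (Vfield p).

Definition inN' (c : R) (p : T) : Prop :=
  [/\ fham c p != 0, fham1 c p != 0 & gN p (Xfield p) (Xfield p) != 0].

Local Notation P := (coverP R n).

(* <theta, dtheta> *)
Definition theta_dtheta (p u : T) : R :=
  \sum_i (thetat p i * thetau u i - thetau p i * thetat u i).

Definition etaP (p u : P) : R :=
  u.2 - (4 * pi)^-1 * theta_dtheta p.1 u.1
  + 2 * pi * (- (2^-1 * r2 p.1 * etatilde p.1 u.1) + eta_inst p.1 u.1).

Definition gP (c : R) (p u v : P) : R :=
  2 / fham1 c p.1 * (etaP p u * etaP p v) + 2 * pi * gN p.1 u.1 v.1.

Definition thetaP (c : R) (a : 'I_4) (p u : P) : R :=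
  match val a with
  | 0%N => - 2^-1 * 'D_(u.1) (fham c) p.1
  | 1%N => etaP p u + 2^-1 * (2 * pi * gN p.1 (Xfield p.1) u.1)
  | 2%N => 2^-1 * (2 * pi * omega2 p.1 (Xfield p.1) u.1)
  | _ => - 2^-1 * (2 * pi * omega1 p.1 (Xfield p.1) u.1)
  end.

Definition gtotP (c : R) (p u v : P) : R :=
  - (fham c p.1)^-1 *
  (gP c p u v - 2 / fham c p.1 * \sum_a thetaP c a p u * thetaP c a p v).

End BPS.
End Construction.

(* Coordinates (rho, (Re X^i, Im X^i), (thetatilde_i, theta^i), sigma) on the
   preimage of Nbar in T^*M x R_sigma. *)
Notation coordX R n := ('rV[R]_n * 'rV[R]_n)%type.
Notation coordN R n :=
  (R * ('rV[R]_n * 'rV[R]_n) * ('rV[R]_n.+1 * 'rV[R]_n.+1) * R)%type.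

Section HyperbolicSpace.
Context {R : realType} {n : nat}.
Local Notation C := R[i].
Local Notation CX := (coordX R n).

Definition Xcoord (x : CX) (i : 'I_n) : C := x.1 ord0 i +i* x.2 ord0 i.
Definition normX2 (x : CX) : R := \sum_i cabs (Xcoord x i) ^+ 2.

(* X^0 := 1 *)
Definition Xhom (x : CX) (i : 'I_n.+1) : C :=
  if unlift ord0 i is Some j then Xcoord x j else 1.

Definition kahler (x : CX) : R := - ln (1 - normX2 x).

Definition cderive (F : CX -> C) (v x : CX) : C :=
  'D_v (fun y => cRe (F y)) x +i* 'D_v (fun y => cIm (F y)) x.

(* d/dX^i and d/dXbar^i *)
Definition dX (i : 'I_n) (F : CX -> C) (x : CX) : C :=
  2^-1 * (cderive F (delta_mx ord0 i, 0) x - 'i%C * cderive F (0, delta_mx ord0 i) x).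
Definition dXbar (i : 'I_n) (F : CX -> C) (x : CX) : C :=
  2^-1 * (cderive F (delta_mx ord0 i, 0) x + 'i%C * cderive F (0, delta_mx ord0 i) x).

Definition kahlerC (x : CX) : C := (kahler x)%:C.

Definition gMbar (x u v : CX) : R :=
  cRe (\sum_i \sum_j dX i (dXbar j kahlerC) x * Xcoord u i * (Xcoord v j)^*%C).

Definition dcK (x u : CX) : R :=
  cRe ('i%C * (\sum_i dXbar i kahlerC x * (Xcoord u i)^*%C
             - \sum_i dX i kahlerC x * Xcoord u i)).

End HyperbolicSpace.

Section Metrics.
Context {R : realType} {n : nat}.
Local Notation C := R[i].
Local Notation Q := (coordN R n).

Definition rhoC (q : Q) : R := q.1.1.1.
Definition XC (q : Q) : coordX R n := q.1.1.2.
Definition thC (q : Q) : 'rV[R]_n.+1 * 'rV[R]_n.+1 := q.1.2.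
Definition sigC (q : Q) : R := q.2.

Definition pair_theta (a b : 'rV[R]_n.+1 * 'rV[R]_n.+1) : R :=
  \sum_i (a.1 ord0 i * b.2 ord0 i - a.2 ord0 i * b.1 ord0 i).

(* The point of {Arg z^0 = 0} with the given coordinates: rho = 2 pi r^2 - c,
   r^2 = |z^0|^2 (1 - sum_i |X^i|^2), z^i = z^0 X^i. *)
Definition z0C (c : R) (q : Q) : R :=
  Num.sqrt ((rhoC q + c) / (2 * pi * (1 - normX2 (XC q)))).

Definition embN (c : R) (q : Q) : coverP R n :=
  (\matrix_(a, i) match val a with
                  | 0%N => z0C c q * cRe (Xhom (XC q) i)
                  | 1%N => z0C c q * cIm (Xhom (XC q) i)
                  | 2%N => (thC q).1 ord0 i
                  | _ => (thC q).2 ord0 i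
                  end, sigC q).

Definition inNbar (Om : latvec n -> int) (K c : R) (q : Q) : Prop :=
  [/\ normX2 (XC q) < 1, 0 < rhoC q + c, inMK K (embN c q).1
    & inN' Om c (embN c q).1].

Definition inNbar_plus (Om : latvec n -> int) (K c : R) (q : Q) : Prop :=
  [/\ inNbar Om K c q, 0 < fham Om c (embN c q).1
    & fham1 Om c (embN c q).1 < 0].

Definition gNbar (Om : latvec n -> int) (c : R) (q u v : Q) : R :=
  gtotP Om c (embN c q) ('D_u (embN c) q) ('D_v (embN c) q).

Definition Wc (u : Q) (i : 'I_n.+1) : C :=
  ((thC u).1 ord0 i)%:C - \sum_j tau i j * ((thC u).2 ord0 j)%:C.

Definition etaFS (c : R) (q u : Q) : R :=
  sigC u - (4 * pi)^-1 * pair_theta (thC q) (thC u)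
  - c / 4 * dcK (XC q) (XC u).

Definition gFS_defined (c : R) (q : Q) : Prop :=
  [/\ normX2 (XC q) < 1, rhoC q != 0, rhoC q + c != 0 & rhoC q + 2 * c != 0].

Definition gFS (c : R) (q u v : Q) : R :=
  let rho := rhoC q in
  (rho + c) / rho * gMbar (XC q) (XC u) (XC v)
  + (rho + 2 * c) / (4 * (rho + c) * rho ^+ 2) * (rhoC u * rhoC v)
  + 4 * (rho + c) / (rho ^+ 2 * (rho + 2 * c)) * (etaFS c q u * etaFS c q v)
  - (2 * pi * rho)^-1 *
    cRe (\sum_i \sum_j
           Wc u i *
           ((invmx (@Nmx R n) i j)%:C
            - (2 * (rho + c) * expR (kahler (XC q)) / rho)%:C
              * Xhom (XC q) i * (Xhom (XC q) j)^*%C)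
           * (Wc v j)^*%C).

(* The action of (2 pi delta, pi k), and its differential. *)
Definition dualR (d : latvec n) : 'rV[R]_n.+1 * 'rV[R]_n.+1 :=
  (map_mx intr d.1, map_mx intr d.2).
Definition deck (d : latvec n) (k : int) (q : Q) : Q :=
  (rhoC q, XC q, thC q + (2 * pi) *: dualR d,
   sigC q + pi * k%:~R + 2^-1 * pair_theta (dualR d) (thC q)).
Definition ddeck (d : latvec n) (u : Q) : Q :=
  (rhoC u, XC u, thC u, sigC u + 2^-1 * pair_theta (dualR d) (thC u)).

(* Open subsets of Nbar are open invariant sets of coordinates. *)
Definition deck_invariant (U : set Q) : Prop :=
  forall d k q, U q -> U (deck d k q).

Definition nbhd_rho_infty (U : set Q) : Prop :=
  [/\ open U, deck_invariant U
    & forall (x : coordX R n) th (s : R), normX2 x < 1 ->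
      exists rho0 : R, forall rho : R, rho0 < rho -> U (rho, x, th, s)].

Definition pos_def_form (b : Q -> Q -> R) : Prop :=
  [/\ forall (a : R) u v w, b (a *: u + v) w = a * b u w + b v w,
      forall u v, b u v = b v u
    & forall u, u != 0 -> 0 < b u u].

(* g descends to a field of positive definite symmetric bilinear forms on the
   quotient of U by the deck group *)
Definition pos_def_metric_on (U : set Q) (g : Q -> Q -> Q -> R) : Prop :=
  (forall q, U q -> pos_def_form (g q)) /\
  (forall d k q u v, U q -> g (deck d k q) (ddeck d u) (ddeck d v) = g q u v).

End Metrics.

(* Main.v *)
Require Import Defs.
From mathcomp Require Import all_boot all_order all_algebra.
From mathcomp Require Import all_classical all_reals all_analysis.
From mathcomp Require Import measurable_realfun complex.
From mathcomp Require Import ring lra.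

Set Implicit Arguments.
Unset Strict Implicit.
Unset Printing Implicit Defensive.

Import Order.TTheory GRing.Theory Num.Theory.
Import numFieldNormedType.Exports.
Local Open Scope classical_set_scope.
Local Open Scope ring_scope.

(** Only the charges [gamma = +-d/dy_0] occur, with [Z_gamma = +-z^0] and
    [theta_gamma = +-theta^0]; every instanton correction is therefore built
    from four real series in [s = |z^0|] and [t = theta^0] ([instV], [instS],
    [instB], [instBs]), and passing from one charge to the other conjugates
    the series.  Since [K_0] and [K_1] are moments of [exp (- x cosh t)], the
    terms decay exponentially in [k s]: the series may be differentiated term
    by term, and their sums are [O (exp (- s))] ([inst_decay]).

    Let [v] be the sum of [Omega V^inst].  In the frame [(dz^i, Y_i)], where
    [Y_i = W_i] for [i > 0] and [Y_0] is [W_0] with one correction by [v] and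
    one by a multiple of [d arg z^0], the holomorphic symplectic form is
    [1/(2 pi) \sum dz^i /\ Y_i] and [omega_3] is diagonal ([omega12E],
    [omega3E]).  Hence (lemma [gNE])
    [g_N = \sum T_i |dz^i|^2 + 1/(4 pi^2) \sum T_i^-1 |Y_i|^2]
    with [T_0 = 1 + v] and [T_i = -1] for [i > 0].

    On the slice [Arg z^0 = 0] the form [d arg z^0] vanishes, and the metric of
    the quaternionic-Kaehler manifold becomes an explicit quadratic expression
    in finitely many linear forms ([gNbarE], [slice_metric]).  For charge
    multiplicity zero this expression is the one-loop corrected
    Ferrara-Sabharwal metric: once the Kaehler potential of the hyperbolic
    space has been differentiated twice, this is a rational identity based on
    [s^2 = (rho + c) / (2 pi (1 - |X|^2))] ([slice_metric0_gFS]).  So both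
    metrics are treated at once, and the last part of the statement comes
    with it.

    For positivity write [y = 1 - |X|^2].  If [f > 0] and [f_1 < 0], the squares
    of [eta] and [theta_1] enter with positive coefficients.  In what remains,
    completing squares ([qkform_diag]) leaves a Fubini-Study-like term in [dX],
    the combination [(df)^2 / (2 f) - (d rho)^2 / (4 (rho + c))], where [df] is
    close to [d rho] and [f] is close to [rho + c], and a form in the fibre
    directions, which is positive by the Cauchy-Schwarz inequality and a
    weighted Young inequality, with a margin proportional to [y]
    ([fibre_bound]).  Instanton terms bounded by [y / (100 s^2)] are absorbed by
    these margins ([rest_bound]).  As [s^2 y] is [(rho + c) / (2 pi)] and the
    instanton terms decay exponentially in [s], this bound holds at all points
    with [rho] larger than one constant ([far_threshold]), so that the
    neighborhood of infinity is a half space [rho > A].  It is invariant under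
    the deck transformations, and so are the metrics, because [theta^0] enters
    only through sines and cosines of its integral multiples. *)

(** * Bessel functions as moments *)

Section BesselMoments.
Context {R : realType}.
Implicit Types (x t : R) (j : nat).
Local Notation mu := lebesgue_measure.
Local Notation Rp := (`[0%R, +oo[%classic : set (measurableTypeR R)).

(** The moments of order 0 and 1 are [K_0] and [K_1]; differentiation in [x]
    merely raises the order of a moment, which keeps derivatives of the series
    in the same family. *)
Definition coshmoment j x : R :=
  \int[mu]_(t in Rp) (expR (- (x * cosh t)) * cosh t ^+ j).

Lemma besselK0E x : besselK 0 x = coshmoment 0 x.
Proof.
apply: eq_Rintegral => t _; rewrite mul0r expr0; congr (_ * _).
by rewrite /cosh oppr0 expR0 -[1 + 1]/(2%:R) divff// pnatr_eq0.
Qed.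

Lemma besselK1E x : besselK 1 x = coshmoment 1 x.
Proof. by apply: eq_Rintegral => t _; rewrite mul1r expr1. Qed.

Lemma cosh_ge t : (1 + t) / 2 <= cosh t.
Proof.
rewrite ler_pM2r ?invr_gt0//.
by rewrite (le_trans (expR_ge1Dx t))// lerDl expR_ge0.
Qed.

Lemma cosh_ge0 t : 0 <= cosh t.
Proof. by rewrite divr_ge0// addr_ge0// expR_ge0. Qed.

Lemma exprn_le_expR j x : 0 <= x -> x ^+ j <= j`!%:R * expR x.
Proof.
case: j => [|j] x0; first by rewrite expr0 mul1r -expR0 ler_expR.
have := expR_ge1Dxn j x0; rewrite -ler_pdivrMl ?ltr0n ?fact_gt0// mulrC.
by apply: le_trans; rewrite lerDr.
Qed.

(** One unit of [x] pays for the power, by [cosh^j <= j! exp cosh].  As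
    [cosh t >= (1 + t) / 2], the rest of the exponent gives decay in [x], and
    decay in [t] if [x >= 3]. *)
Lemma coshmoment_integrand_le j x t : 3 <= x -> 0 <= t ->
  expR (- (x * cosh t)) * cosh t ^+ j
    <= j`!%:R * expR (- ((x - 1) / 2)) * expR (- t).
Proof.
move=> x3 t0.
rewrite (@le_trans _ _ (expR (- (x * cosh t)) * (j`!%:R * expR (cosh t))))//.
  by rewrite ler_pM2l ?expR_gt0// exprn_le_expR// cosh_ge0.
rewrite mulrCA -!mulrA ler_pM2l ?ltr0n ?fact_gt0// -!expRD ler_expR.
have := cosh_ge t; nra.
Qed.

Lemma integrable_expRN : mu.-integrable Rp (EFin \o (fun t => expR (- t))).
Proof.
have mRp : measurable Rp by exact: measurable_itv.
have i1 := @integrable_exponential_pdf R 1 ltr01.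
have i2 := integrableS measurableT mRp (@subsetT _ _) i1.
apply: eq_integrable i2 => // t; rewrite inE/= in_itv/= andbT => t0.
by rewrite exponential_pdfE// mul1r mulN1r.
Qed.

Lemma integrableM_expRN (c : R) :
  mu.-integrable Rp (EFin \o (fun t : R => c * expR (- t))).
Proof.
rewrite (_ : _ \o _ = (fun t => c%:E * (EFin \o (fun t => expR (- t))) t)%E)//.
by apply: integrableZl; [exact: measurable_itv|exact: integrable_expRN].
Qed.

Lemma integral_expRN : \int[mu]_(t in Rp) expR (- t) = 1.
Proof.
rewrite /Rintegral integral_mkcond.
have := @integral_exponential_pdf R 1 ltr01.
rewrite (_ : (fun x => (exponential_pdf 1 x)%:E) =
  ((fun t => (expR (- t))%:E) \_ Rp)) => [->//|].
apply/funext => t /=.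
rewrite /exponential_pdf !patchE; case: ifP => //=.
by rewrite mul1r mulN1r.
Qed.

#[local] Instance is_derive_cosh t :
  is_derive t 1 (@cosh R) ((expR t - expR (- t)) / 2).
Proof. rewrite /cosh; by apply: is_derive_eq; rewrite /GRing.scale/=; field. Qed.

Lemma integrable_coshmoment j x : 3 <= x ->
  mu.-integrable Rp
    (EFin \o (fun t => expR (- (x * cosh t)) * cosh t ^+ j)).
Proof.
move=> x3; pose c : R := j`!%:R * expR (- ((x - 1) / 2)).
have c0 : 0 <= c by rewrite mulr_ge0// expR_ge0.
have mRp : measurable Rp by exact: measurable_itv.
apply: (le_integrable mRp (g := EFin \o (fun t : R => c * expR (- t)))).
- pose f t : R := expR (- (x * cosh t)) * cosh t ^+ j.
  have cf : continuous f.
    have ccosh : continuous (@cosh R).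
      move=> t; apply: differentiable_continuous; apply/derivable1_diffP.
      exact: ex_derive.
    move=> t; apply: (@continuousM R R (fun t => expR (- (x * cosh t))) (fun t => cosh t ^+ j)).
      apply: continuous_comp; last exact: continuous_expR.
      apply: (@continuousN R R^o); apply: (@continuousM R R (fun=> x)); first exact: cst_continuous.
      exact: ccosh.
    by apply: (@continuous_comp _ _ _ cosh (fun y => y ^+ j)); [exact: ccosh|exact: exprn_continuous].
  have mT : measurable_fun [set: R] f := continuous_measurable_fun cf.
  have mf : measurable_fun (`[0%R, +oo[%classic : set R) (EFin \o f).
    by apply/measurable_EFinP; exact: measurable_funTS.
  exact: mf.
- move=> t; rewrite /= in_itv/= andbT => t0; rewrite lee_fin.
  rewrite !ger0_norm ?mulr_ge0 ?expR_ge0 ?exprn_ge0 ?cosh_ge0//.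
  exact: coshmoment_integrand_le.
- rewrite (_ : _ \o _ = (fun t : R => c%:E * (EFin \o (fun t => expR (- t))) t)%E)//.
  by apply: integrableZl => //; exact: integrable_expRN.
Qed.

Lemma coshmoment_ge0 j x : 0 <= coshmoment j x.
Proof.
by apply: Rintegral_ge0 => t _; rewrite mulr_ge0 ?expR_ge0 ?exprn_ge0 ?cosh_ge0.
Qed.

Lemma coshmoment_le j x : 3 <= x ->
  coshmoment j x <= j`!%:R * expR (- ((x - 1) / 2)).
Proof.
move=> x3; set c := leRHS.
have -> : c = \int[mu]_(t in Rp) (c * expR (- t)).
  rewrite RintegralZl ?integral_expRN ?mulr1//; exact: integrable_expRN.
apply: le_Rintegral => //; first exact: integrable_coshmoment.
- exact: integrableM_expRN.
- move=> t; rewrite /= in_itv/= andbT => t0.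
  exact: coshmoment_integrand_le.
Qed.

(** Differentiation under the integral sign: on [x > 3] the derivatives of the
    integrand are dominated by one multiple of [exp (- t)]. *)
Lemma is_derive_coshmoment j x : 3 < x ->
  is_derive x 1 (coshmoment j) (- coshmoment j.+1 x).
Proof.
move=> x3.
pose f (x t : R) := expR (- (x * cosh t)) * cosh t ^+ j.
have df (y t : R) : is_derive y 1 (f ^~ t) (- (expR (- (y * cosh t)) * cosh t ^+ j.+1)).
  rewrite /f; apply: is_derive_eq; rewrite exprS /GRing.scale/=; ring.
have d1f (y t : R) : partial1of2 f y t = - (expR (- (y * cosh t)) * cosh t ^+ j.+1).
  by rewrite partial1of2E derive_val.
pose G (t : R) : R := j.+1`!%:R * expR (- t).
have h1 : x \in `]3, (x + 1)[ by rewrite in_itv/= x3 ltrDl/=.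
have h2 (y : R) : `]3, (x + 1)[%classic y ->
    mu.-integrable Rp (EFin \o f y).
  by rewrite /= in_itv/= => /andP[/ltW y3 _]; exact: integrable_coshmoment.
have h3 (y t : R) : `]3, (x + 1)[%classic y -> Rp t -> derivable (f ^~ t) y 1.
  by move=> _ _; exact: ex_derive.
have h4 (t : R) : 0 <= G t by rewrite mulr_ge0// expR_ge0.
have h5 : mu.-integrable Rp (EFin \o G).
  exact: integrableM_expRN.
have h6 (y t : R) : `]3, (x + 1)[%classic y -> Rp t -> `|partial1of2 f y t| <= G t.
  rewrite /= !in_itv/= andbT => /andP[/ltW y3 _] t0.
  rewrite d1f normrN ger0_norm ?mulr_ge0 ?expR_ge0 ?exprn_ge0 ?cosh_ge0//.
  apply: le_trans (coshmoment_integrand_le _ _ _) _ => //.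
  rewrite /G -mulrA ler_pM2l ?ltr0n ?fact_gt0// -expRD ler_expR; lra.
have mRp : measurable Rp by exact: measurable_itv.
have dF := derivable_under_integral mRp h1 h2 h3 h4 h5 h6.
have eF := differentiation_under_integral mRp h1 h2 h3 h4 h5 h6.
apply: DeriveDef => //; rewrite -derive1E eF -mulN1r -RintegralZl//; last first.
  by apply: integrable_coshmoment; exact: ltW.
by apply: eq_Rintegral => t _; rewrite d1f mulN1r.
Qed.

End BesselMoments.

(** * Series dominated by a geometric series *)

Section DominatedSeries.
Context {R : realType}.
Implicit Types (u v : nat -> R) (C : R).

Definition psum u (n : nat) : R := \sum_(1 <= k < n) u k.
Definition rsum u : R := limn (psum u).

(** Comparison with the powers of [1/2], whose sum from 1 on is 1: the same
    constant bounds the sum of the series. *)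
Definition dominated C u := forall k, (0 < k)%N -> `|u k| <= C * 2^-1 ^+ k.

Lemma psum_geometric_le n : psum (fun k => 2^-1 ^+ k) n <= 1.
Proof.
suff h j : psum (fun k => 2^-1 ^+ k : R) j.+1 = 1 - 2^-1 ^+ j.
  case: n => [|n]; first by rewrite /psum big_geq.
  by rewrite h lerBlDr lerDl exprn_ge0// invr_ge0.
elim: j => [|j IH]; first by rewrite /psum big_geq// expr0 subrr.
rewrite /psum big_nat_recr//= -/(psum _ _) IH exprS; lra.
Qed.

Lemma dominated_psum_le C u n : dominated C u -> `|psum u n| <= C.
Proof.
move=> du; have C0 : 0 <= C.
  by have := le_trans (normr_ge0 _) (du 1%N isT); rewrite expr1 pmulr_lge0.
rewrite (@le_trans _ _ (C * psum (fun k => 2^-1 ^+ k) n))//.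
  rewrite /psum (le_trans (ler_norm_sum _ _ _))// mulr_sumr.
  by rewrite ler_sum_nat// => k /andP[k0 _]; exact: du.
by rewrite ler_piMr// psum_geometric_le.
Qed.

Lemma dominated_cvg C u : dominated C u -> cvgn (psum u).
Proof.
move=> du; pose u' k := if k == 0%N then 0 else u k.
have -> : psum u = series u'.
  apply/funext => -[|n]; rewrite /psum /series/=; first by rewrite !big_geq.
  rewrite big_add1/= [RHS]big_nat_recl//= {1}/u' /= add0r.
  by apply: eq_bigr.
have C0 : 0 <= C.
  by have := le_trans (normr_ge0 _) (du 1%N isT); rewrite expr1 pmulr_lge0.
apply: normed_cvg.
apply: (@series_le_cvg R _ (geometric C 2^-1)) => //.
- by move=> n /=.
- by move=> n; rewrite /geometric/= mulr_ge0// exprn_ge0// invr_ge0.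
- move=> [|n] /=; last exact: du.
  by rewrite /u' /= normr0 /geometric/= mulr_ge0.
- apply: is_cvg_geometric_series; rewrite ger0_norm//; lra.
Qed.

Lemma rsum_le C u : dominated C u -> `|rsum u| <= C.
Proof.
move=> du; have cu := dominated_cvg du; rewrite ler_norml; apply/andP; split.
  apply: limr_ge => //; near=> n.
  by have := dominated_psum_le n du; rewrite ler_norml => /andP[].
apply: limr_le => //; near=> n.
by have := dominated_psum_le n du; rewrite ler_norml => /andP[].
Unshelve. all: by end_near. Qed.

Lemma eq_rsum u v : (forall k, (0 < k)%N -> u k = v k) -> rsum u = rsum v.
Proof.
move=> uv; rewrite /rsum; suff -> : psum u = psum v by [].
by apply/funext => n; apply: eq_big_nat => k /andP[/uv].
Qed.

Lemma rsumD C D u v : dominated C u -> dominated D v ->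
  rsum (fun k => u k + v k) = rsum u + rsum v.
Proof.
move=> /dominated_cvg cu /dominated_cvg cv; rewrite /rsum -limD//.
suff -> : psum (fun k => u k + v k) = psum u + psum v by [].
by apply/funext => n; rewrite /psum big_split.
Qed.

Lemma rsumZ C a u : dominated C u -> rsum (fun k => a * u k) = a * rsum u.
Proof.
move=> /dominated_cvg cu; apply: cvg_lim => //.
rewrite (_ : psum _ = (cst a \* psum u)); first exact: cvgM (cvg_cst a) cu.
by apply/funext => n; rewrite /psum /= mulr_sumr.
Qed.

Lemma rsumN C u : dominated C u -> rsum (fun k => - u k) = - rsum u.
Proof.
by move=> /(rsumZ (-1)); rewrite mulN1r => <-; apply: eq_rsum => k _; rewrite mulN1r.
Qed.

Lemma dominatedD C D u v : dominated C u -> dominated D v ->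
  dominated (C + D) (fun k => u k + v k).
Proof.
move=> du dv k k0; rewrite mulrDl (le_trans (ler_normD _ _))// lerD ?du ?dv//.
Qed.

Lemma dominatedZ C a u : dominated C u -> dominated (`|a| * C) (fun k => a * u k).
Proof. by move=> du k k0; rewrite normrM -mulrA ler_wpM2l// du. Qed.

End DominatedSeries.

(** * Differentiation term by term *)

Section TermwiseDerivative.
Context {R : realType}.

(** The mean value theorem, applied to [u] and then to [u1]. *)
Lemma taylor2 (u u1 u2 : R -> R) (C h : R) : `|h| <= 1 ->
  (forall y : R, `|y| <= 1 -> is_derive y 1 u (u1 y)) ->
  (forall y : R, `|y| <= 1 -> is_derive y 1 u1 (u2 y)) ->
  (forall y, `|y| <= 1 -> `|u2 y| <= C) ->
  `|u h - u 0 - h * u1 0| <= C * h ^+ 2.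
Proof.
have mvt (f f' : R -> R) (b : R) : `|b| <= 1 ->
    (forall y : R, `|y| <= 1 -> is_derive y 1 f (f' y)) ->
    exists2 c, `|c| <= `|b| & f b - f 0 = f' c * b.
  move=> b1 df.
  have cont (a c : R) : -1 <= a -> c <= 1 -> {within `[a, c], continuous f}.
    move=> a1 c1; apply: derivable_within_continuous => y.
    rewrite in_itv/= => /andP[ay yc]; have [] := df y _ => //.
    by rewrite ler_norml (le_trans a1 ay) (le_trans yc c1).
  move: (b1); rewrite ler_norml => /andP[bl bu].
  have [b0|b0] := leP 0 b.
    have [||c] := @MVT_segment R f f' 0 b b0.
    - move=> y; rewrite in_itv/= => /andP[y0 yb]; apply: df.
      by rewrite ler_norml; apply/andP; split; lra.
    - by apply: cont => //; lra.
    rewrite in_itv/= => /andP[c0 cb]; rewrite subr0 => e.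
    by exists c => //; rewrite !ger0_norm.
  have [||c] := @MVT_segment R f f' b 0 (ltW b0).
  - move=> y; rewrite in_itv/= => /andP[y0 yb]; apply: df.
    by rewrite ler_norml; apply/andP; split; lra.
  - by apply: cont => //; lra.
  rewrite in_itv/= => /andP[c0 cb]; rewrite sub0r => e.
  exists c; first by rewrite ler0_norm// ler0_norm ?lerN2// ltW.
  by rewrite -opprB e mulrN opprK.
move=> h1 du du1 du2.
have [c ch eu] := mvt u u1 h h1 du.
have c1 : `|c| <= 1 by exact: le_trans h1.
have [d dc eu1] := mvt u1 u2 c c1 du1.
have -> : u h - u 0 - h * u1 0 = u2 d * (c * h)
  by rewrite eu (mulrC h) -mulrBl eu1 mulrA.
have d1 : `|d| <= 1 by exact: le_trans dc c1.
rewrite normrM ler_pM ?du2//.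
by rewrite normrM -(normr_id h) -[_ ^+ 2]ger0_norm ?sqr_ge0// normrX expr2 normr_id ler_pM.
Qed.

(** Second-order control of the terms turns the termwise difference quotient
    into an honest limit: the error after dividing by [h] is a dominated
    series times [h]. *)
Lemma is_derive_rsum (u : nat -> R -> R) (u1 u2 : nat -> R -> R) (A B C : R) :
  dominated A (u ^~ 0) ->
  dominated B (u1 ^~ 0) ->
  (forall k (y : R), (0 < k)%N -> `|y| <= 1 -> is_derive y 1 (u k) (u1 k y)) ->
  (forall k (y : R), (0 < k)%N -> `|y| <= 1 -> is_derive y 1 (u1 k) (u2 k y)) ->
  (forall y, `|y| <= 1 -> dominated C (u2 ^~ y)) ->
  is_derive (0 : R) 1 (fun h => rsum (u ^~ h)) (rsum (u1 ^~ 0)).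
Proof.
move=> du0 du1 du du' du2.
have C0 : 0 <= C.
  have := du2 0; rewrite normr0 => /(_ ler01 1%N isT).
  by move=> /(le_trans (normr_ge0 _)); rewrite expr1 pmulr_lge0.
have rem (h : R) : `|h| <= 1 ->
    dominated (C * h ^+ 2) (fun k => u k h - u k 0 - h * u1 k 0).
  move=> h1 k k0; rewrite mulrAC.
  apply: taylor2 => // y y1; [exact: du|exact: du'|exact: du2].
have main (h : R) : `|h| <= 1 ->
    `|rsum (u ^~ h) - rsum (u ^~ 0) - h * rsum (u1 ^~ 0)| <= C * h ^+ 2.
  move=> h1; have := rsum_le (rem h h1).
  have -> : rsum (u ^~ h) = rsum (fun k => (u k h - u k 0 - h * u1 k 0)
      + (u k 0 + h * u1 k 0)) by apply: eq_rsum => k _; lra.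
  rewrite (rsumD (rem h h1) (dominatedD du0 (dominatedZ h du1))).
  rewrite (rsumD du0 (dominatedZ h du1)) (rsumZ h du1).
  set X := rsum _; set Y := rsum _; set Z := rsum _.
  by rewrite (_ : X + (Y + h * Z) - Y - h * Z = X)//; lra.
have cvgu : h^-1 *: (rsum (u ^~ (h + 0)) - rsum (u ^~ 0)) @[h --> 0^'] -->
    rsum (u1 ^~ 0).
  apply/cvgrPdist_le => e e0; near=> h.
  have h0 : h != 0 by near: h; exact: nbhs_dnbhs_neq.
  have h1 : `|h| <= 1 by near: h; apply: dnbhs0_le.
  have he : `|h| <= e / (C + 1).
    by near: h; apply: dnbhs0_le; rewrite divr_gt0// ltr_wpDl.
  rewrite addr0 distrC.
  have -> : h^-1 *: (rsum (u ^~ h) - rsum (u ^~ 0)) - rsum (u1 ^~ 0) =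
      h^-1 * (rsum (u ^~ h) - rsum (u ^~ 0) - h * rsum (u1 ^~ 0)).
    by rewrite /GRing.scale/= [RHS]mulrBr mulKf.
  rewrite normrM normfV ler_pdivrMl ?normr_gt0//.
  rewrite (le_trans (main h h1))// -[_ ^+ 2]ger0_norm ?sqr_ge0// normrX expr2.
  rewrite mulrCA ler_wpM2l//.
  move: he; rewrite ler_pdivlMr ?ltr_wpDl// => he.
  by rewrite (le_trans _ he)// mulrC ler_wpM2l// lerDl.
have cvgu' : h^-1 *: (rsum (u ^~ (h *: (1 : R) + 0)) - rsum (u ^~ 0)) @[h --> 0^']
    --> rsum (u1 ^~ 0).
  by move: cvgu; under eq_fun do rewrite -{1}[X in X + 0](mulr1).
apply: DeriveDef; last exact: cvg_lim cvgu'.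
by apply/cvg_ex; exists (rsum (u1 ^~ 0)).
Unshelve. all: by end_near. Qed.

End TermwiseDerivative.

(** * The four instanton series *)

Section InstantonSeries.
Context {R : realType}.
Implicit Types (s t : R) (k : nat) (a : nat -> R).

(** As [2 pi k s >= 4 k s], the bound on the moment contains two factors
    [exp (- k s)].  One absorbs the power of [k s]; the other is split by
    [k s >= k + s - 1]. *)
Lemma coshmoment_decay (N j : nat) : exists2 C : R, 0 <= C &
  forall s k, 1 <= s -> (0 < k)%N ->
  (k%:R * s) ^+ N * coshmoment j (2 * pi * k%:R * s) <= C * expR (- s) * 2^-1 ^+ k.
Proof.
exists (N`!%:R * j`!%:R * expR 2); first by rewrite !mulr_ge0// expR_ge0.
move=> s k s1 k0; have k1 : 1 <= k%:R :> R by rewrite ler1n.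
have ks1 : 1 <= k%:R * s by nra.
have x4 : 4 * (k%:R * s) <= 2 * pi * k%:R * s.
  have := @pi_ge2 R; nra.
have expk : expR (- k%:R) <= 2^-1 ^+ k :> R.
  rewrite -mulrN1 expRM_natl lerXn2r ?nnegrE ?expR_ge0 ?invr_ge0//.
  by rewrite expRN lef_pV2 ?posrE ?expR_gt0//; have := expR_ge1Dx (1 : R); lra.
have hM : coshmoment j (2 * pi * k%:R * s) <=
    j`!%:R * (expR 2 * (expR (- (k%:R * s)) * (expR (- s) * expR (- k%:R)))).
  apply: le_trans (coshmoment_le _ _) _; first lra.
  rewrite ler_pM2l ?ltr0n ?fact_gt0// -!expRD ler_expR; nra.
have hP : (k%:R * s) ^+ N <= N`!%:R * expR (k%:R * s).
  by apply: exprn_le_expR; lra.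
apply: (@le_trans _ _ ((N`!%:R * expR (k%:R * s)) *
  (j`!%:R * (expR 2 * (expR (- (k%:R * s)) * (expR (- s) * expR (- k%:R))))))).
  by rewrite ler_pM// ?coshmoment_ge0// exprn_ge0//; lra.
have e1 : expR (k%:R * s) * expR (- (k%:R * s)) = 1 by rewrite -expRD subrr expR0.
have -> : (N`!%:R * expR (k%:R * s)) *
  (j`!%:R * (expR 2 * (expR (- (k%:R * s)) * (expR (- s) * expR (- k%:R))))) =
  N`!%:R * j`!%:R * expR 2 * expR (- s) * expR (- k%:R) *
  (expR (k%:R * s) * expR (- (k%:R * s))) by ring.
rewrite e1 mulr1 ler_wpM2l// !mulr_ge0// ?expR_ge0//.
Qed.

Lemma dominated_bessel : exists2 C : R, 0 <= C &
  forall s a, 1 <= s -> (forall k, `|a k| <= 1) ->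
  dominated (C * expR (- s)) (fun k => a k * besselK 0 (2 * pi * k%:R * s)) /\
  dominated (C * expR (- s)) (fun k => a k * (s * besselK 1 (2 * pi * k%:R * s))).
Proof.
have [C C0 hC] := coshmoment_decay 0 0; have [D D0 hD] := coshmoment_decay 1 1.
exists (C + D); first exact: addr_ge0.
move=> s a s1 a1; have e0 := expR_ge0 (- s).
split=> k k0; have hk : 0 <= 2^-1 ^+ k :> R by rewrite exprn_ge0// invr_ge0.
- rewrite besselK0E normrM (ger0_norm (coshmoment_ge0 _ _)).
  have := hC s k s1 k0; rewrite expr0 mul1r => h.
  have h0 := coshmoment_ge0 0 (2 * pi * k%:R * s).
  have h1 : 0 <= D * expR (- s) * 2^-1 ^+ k by rewrite !mulr_ge0.
  have := a1 k; have := normr_ge0 (a k); nra.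
- rewrite besselK1E !normrM (ger0_norm (coshmoment_ge0 _ _)).
  have := hD s k s1 k0; rewrite expr1 => h.
  have h0 := coshmoment_ge0 1 (2 * pi * k%:R * s).
  have h1 : 0 <= C * expR (- s) * 2^-1 ^+ k by rewrite !mulr_ge0.
  have k1 : 1 <= k%:R :> R by rewrite ler1n.
  have h2 : s * coshmoment 1 (2 * pi * k%:R * s) <=
    k%:R * s * coshmoment 1 (2 * pi * k%:R * s).
    by rewrite ler_wpM2r//; nra.
  have h3 : 0 <= s * coshmoment 1 (2 * pi * k%:R * s) by rewrite mulr_ge0//; lra.
  rewrite (ger0_norm (_ : 0 <= s)); last lra.
  have := a1 k; have := normr_ge0 (a k); nra.
Qed.

(** For [Z_gamma = s] and [theta_gamma = t], these are up to constants the
    cosine part of [V^inst], the sine part of [A^inst], the cosine part of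
    [eta^inst], and the [s]-derivative of the latter, whose [t]-derivative is
    [- instS]. *)
Definition instV s t :=
  rsum (fun k => cos (k%:R * t) * besselK 0 (2 * pi * k%:R * s)).
Definition instS s t :=
  rsum (fun k => sin (k%:R * t) * (s * besselK 1 (2 * pi * k%:R * s))).
Definition instB s t :=
  rsum (fun k => cos (k%:R * t) / k%:R * (s * besselK 1 (2 * pi * k%:R * s))).
Definition instBs s t := rsum (fun k => cos (k%:R * t) *
  (k%:R^-1 * coshmoment 1 (2 * pi * k%:R * s)
   - 2 * pi * s * coshmoment 2 (2 * pi * k%:R * s))).

Lemma normr_divk_le1 (x : R) k : `|x| <= 1 -> `|x / k%:R| <= 1.
Proof.
case: k => [|k] x1; first by rewrite invr0 mulr0 normr0.
rewrite normrM normfV (ger0_norm (ler0n _ _)) ler_pdivrMr ?ltr0n// mul1r (le_trans x1)//.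
by rewrite ler1n.
Qed.

Lemma normr_cos_le1 t : `|cos t| <= 1.
Proof. by rewrite ler_norml cos_geN1 cos_le1. Qed.

Lemma normr_sin_le1 t : `|sin t| <= 1.
Proof. by rewrite ler_norml sin_geN1 sin_le1. Qed.

Lemma dominated_instBs : exists2 C : R, 0 <= C & forall s t, 1 <= s ->
  dominated (C * expR (- s)) (fun k => cos (k%:R * t) *
  (k%:R^-1 * coshmoment 1 (2 * pi * k%:R * s)
   - 2 * pi * s * coshmoment 2 (2 * pi * k%:R * s))).
Proof.
have [C C0 hC] := coshmoment_decay 0 1; have [D D0 hD] := coshmoment_decay 1 2.
have p0 := @pi_ge0 R.
exists (C + 2 * pi * D); first by rewrite addr_ge0// !mulr_ge0.
move=> s t s1 k k0; have e0 := expR_ge0 (- s).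
have hk : 0 <= 2^-1 ^+ k :> R by rewrite exprn_ge0// invr_ge0.
have := hC s k s1 k0; rewrite expr0 mul1r; have := hD s k s1 k0; rewrite expr1.
have := coshmoment_ge0 1 (2 * pi * k%:R * s).
have := coshmoment_ge0 2 (2 * pi * k%:R * s).
set M1 := coshmoment 1 _; set M2 := coshmoment 2 _ => M20 M10 h2 h1.
have k1 : 1 <= k%:R :> R by rewrite ler1n.
have iv0 : 0 <= k%:R^-1 :> R by rewrite invr_ge0.
have iv1 : k%:R^-1 <= 1 :> R by rewrite invf_le1// ltr0n.
have sM : s * M2 <= k%:R * s * M2 by rewrite ler_wpM2r//; nra.
rewrite normrM (@le_trans _ _ (M1 + 2 * pi * (s * M2)))//.
  rewrite -[leRHS]mul1r ler_pM ?normr_cos_le1//.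
  rewrite (le_trans (ler_normB _ _))// lerD//.
    by rewrite ger0_norm ?mulr_ge0// ler_piMl.
  by rewrite ger0_norm ?mulrA// !mulr_ge0//; lra.
have -> : (C + 2 * pi * D) * expR (- s) * 2^-1 ^+ k =
  C * expR (- s) * 2^-1 ^+ k + 2 * pi * (D * expR (- s) * 2^-1 ^+ k) by ring.
by rewrite lerD// ler_wpM2l ?mulr_ge0// (le_trans sM).
Qed.

Lemma inst_decay : exists2 C : R, 0 <= C & forall s t, 1 <= s ->
  [/\ `|instV s t| <= C * expR (- s), `|instS s t| <= C * expR (- s),
      `|instB s t| <= C * expR (- s) & `|instBs s t| <= C * expR (- s)].
Proof.
have [C C0 hC] := dominated_bessel; have [D D0 hD] := dominated_instBs.
exists (C + D); first exact: addr_ge0.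
move=> s t s1; have e0 := expR_ge0 (- s).
have le1 : C * expR (- s) <= (C + D) * expR (- s) by nra.
have le2 : D * expR (- s) <= (C + D) * expR (- s) by nra.
split.
- apply: le_trans (rsum_le _) le1.
  by apply: (hC s _ s1 _).1 => k; exact: normr_cos_le1.
- apply: le_trans (rsum_le _) le1.
  by apply: (hC s _ s1 _).2 => k; exact: normr_sin_le1.
- apply: le_trans (rsum_le _) le1.
  by apply: (hC s _ s1 _).2 => k; apply: normr_divk_le1; exact: normr_cos_le1.
- by apply: le_trans (rsum_le _) le2; exact: hD.
Qed.

(** The bounds on the series hold for [s >= 1]; with [|sg| <= 1] the line stays
    in this region for [|h| <= 1]. *)
Lemma is_derive_instB_small s t (sg tg : R) : 2 <= s -> `|sg| <= 1 ->
  is_derive (0 : R) 1 (fun h => instB (s + h * sg) (t + h * tg))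
    (sg * instBs s t - tg * instS s t).
Proof.
move=> s2 sg1.
pose M (j k : nat) (y : R) : R := coshmoment j (2 * pi * k%:R * (s + y * sg)).
pose u (k : nat) (y : R) : R := cos (k%:R * (t + y * tg)) / k%:R * ((s + y * sg) * M 1%N k y).
pose b (k : nat) (y : R) : R := sg * M 1%N k y - 2 * pi * k%:R * sg * ((s + y * sg) * M 2%N k y).
pose u1 (k : nat) (y : R) : R := - tg * sin (k%:R * (t + y * tg)) * ((s + y * sg) * M 1%N k y)
  + cos (k%:R * (t + y * tg)) / k%:R * b k y.
pose u2 (k : nat) (y : R) : R := - tg ^+ 2 * cos (k%:R * (t + y * tg)) * (k%:R * (s + y * sg) * M 1%N k y)
  - 2 * tg * sin (k%:R * (t + y * tg)) * (sg * M 1%N k y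
      - 2 * pi * sg * (k%:R * (s + y * sg) * M 2%N k y))
  + cos (k%:R * (t + y * tg)) * sg ^+ 2 * (- 4 * pi * M 2%N k y
     + 4 * pi ^+ 2 * (k%:R * (s + y * sg) * M 3%N k y)).
have S1 (y : R) : `|y| <= 1 -> 1 <= s + y * sg.
  move=> y1; have : `|y * sg| <= 1 by rewrite normrM mulr_ile1.
  by rewrite ler_norml => /andP[]; lra.
have x3 (k : nat) (y : R) : (0 < k)%N -> `|y| <= 1 -> 3 < 2 * pi * k%:R * (s + y * sg).
  move=> k0 /S1 y1; have k1 : 1 <= k%:R :> R by rewrite ler1n.
  have := @pi_ge2 R => p2; have : 1 <= k%:R * (s + y * sg) by nra.
  nra.
have dM (j k : nat) (y : R) : (0 < k)%N -> `|y| <= 1 ->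
    is_derive y 1 (M j k) (- (2 * pi * k%:R * sg) * M j.+1 k y).
  move=> k0 y1; have ? := is_derive_coshmoment j (x3 k y k0 y1).
  rewrite /M; apply: is_derive_eq; rewrite /GRing.scale/=; ring.
have -> : sg * instBs s t - tg * instS s t = rsum (u1 ^~ 0).
  have [C C0 hC] := dominated_bessel; have [D D0 hD] := dominated_instBs.
  have s1 : 1 <= s by lra.
  have [_ h1] := hC s (fun k => sin (k%:R * t)) s1 (fun k => normr_sin_le1 _).
  have h2 := hD s t s1.
  rewrite -mulNr -(rsumZ sg h2) -(rsumZ (- tg) h1).
  rewrite -(rsumD (dominatedZ _ h2) (dominatedZ _ h1)).
  apply: eq_rsum => k k0; rewrite /u1 /b /M besselK1E !mul0r !addr0.
  have kn0 : k%:R != 0 :> R by rewrite pnatr_eq0 -lt0n.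
  by field.
have [C1 C10 hC1] := coshmoment_decay 1 1.
have [C2 C20 hC2] := coshmoment_decay 1 2.
have [C3 C30 hC3] := coshmoment_decay 1 3.
have [C C0 hC] := dominated_bessel; have [D D0 hD] := dominated_instBs.
have s1 : 1 <= s by lra.
have -> : (fun h => instB (s + h * sg) (t + h * tg)) = (fun h => rsum (u ^~ h)).
  by apply/funext => h; apply: eq_rsum => k k0; rewrite besselK1E.
have p0 := @pi_ge0 R.
pose K : R := (tg ^+ 2 + 2 * `|tg|) * C1 + (4 * pi * `|tg| + 4 * pi) * C2
  + 4 * pi ^+ 2 * C3.
apply: (@is_derive_rsum R u u1 u2 (C * expR (- s))
  (`|sg| * (D * expR (- s)) + `|- tg| * (C * expR (- s))) K).
- have [_ h1] := hC s (fun k => cos (k%:R * t) / k%:R) s1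
    (fun k => normr_divk_le1 k (normr_cos_le1 _)).
  move=> k k0; have := h1 k k0.
  by rewrite /u /M besselK1E !mul0r !addr0.
- have [_ h1] := hC s (fun k => sin (k%:R * t)) s1 (fun k => normr_sin_le1 _).
  move=> k k0; have := dominatedD (dominatedZ sg (hD s t s1)) (dominatedZ (- tg) h1) k0.
  congr (`|_| <= _); rewrite /u1 /b /M besselK1E !mul0r !addr0.
  have kn0 : k%:R != 0 :> R by rewrite pnatr_eq0 -lt0n.
  by field.
- move=> k y k0 y1; have ? := dM 1%N k y k0 y1.
  rewrite /u1 /b; apply: is_derive_eq; rewrite /GRing.scale/=.
  have kn0 : k%:R != 0 :> R by rewrite pnatr_eq0 -lt0n.
  by field.
- move=> k y k0 y1; have ? := dM 1%N k y k0 y1; have ? := dM 2%N k y k0 y1.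
  rewrite /u2; apply: is_derive_eq; rewrite /b /GRing.scale/=.
  have kn0 : k%:R != 0 :> R by rewrite pnatr_eq0 -lt0n.
  by field.
- move=> y y1 k k0.
  have S1y := S1 y y1; have e1 : expR (- (s + y * sg)) <= 1 by rewrite expR_le1; lra.
  have k1 : 1 <= k%:R :> R by rewrite ler1n.
  have q0 : 0 <= 2^-1 ^+ k :> R by rewrite exprn_ge0// invr_ge0.
  have P1 : 1 <= k%:R * (s + y * sg) by nra.
  have bd (E : R) : 0 <= E -> E * expR (- (s + y * sg)) * 2^-1 ^+ k <= E * 2^-1 ^+ k.
    by move=> E0; rewrite ler_wpM2r// ler_piMr.
  have := le_trans (hC1 _ k S1y k0) (bd _ C10).
  have := le_trans (hC2 _ k S1y k0) (bd _ C20).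
  have := le_trans (hC3 _ k S1y k0) (bd _ C30).
  rewrite !expr1 /u2 /M.
  have := coshmoment_ge0 1 (2 * pi * k%:R * (s + y * sg)).
  have := coshmoment_ge0 2 (2 * pi * k%:R * (s + y * sg)).
  have := coshmoment_ge0 3 (2 * pi * k%:R * (s + y * sg)).
  move: (coshmoment 1 _) (coshmoment 2 _) (coshmoment 3 _) => m1 m2 m3 m30 m20 m10.
  move: (k%:R * (s + y * sg)) P1 => P P1 b3 b2 b1.
  have := normr_cos_le1 (k%:R * (t + y * tg)).
  have := normr_sin_le1 (k%:R * (t + y * tg)).
  move: (cos _) (sin _) => co si si1 co1.
  have le3 (x1 x2 x3' y1' y2 y3 : R) : `|x1| <= y1' -> `|x2| <= y2 -> `|x3'| <= y3 ->
      `|x1 - x2 + x3'| <= y1' + y2 + y3.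
    move=> ha hb hc; rewrite (le_trans (ler_normD _ _))// lerD//.
    by rewrite (le_trans (ler_normB _ _))// lerD.
  have b1' : m1 <= P * m1 by rewrite ler_peMl.
  have b2' : m2 <= P * m2 by rewrite ler_peMl.
  have sg2 : `|sg ^+ 2| <= 1 by rewrite normrX exprn_ile1.
  have n1 : 0 <= P * m1 by rewrite mulr_ge0//; lra.
  have n2 : 0 <= P * m2 by rewrite mulr_ge0//; lra.
  have n3 : 0 <= P * m3 by rewrite mulr_ge0//; lra.
  rewrite (@le_trans _ _ (tg ^+ 2 * (P * m1)
    + 2 * `|tg| * (P * m1 + 2 * pi * (P * m2))
    + (4 * pi * (P * m2) + 4 * pi ^+ 2 * (P * m3))))//.
    apply: le3.
    + rewrite normrM (ger0_norm n1) ler_wpM2r// normrM normrN.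
      by rewrite (ger0_norm (sqr_ge0 _)) ler_piMr ?sqr_ge0.
    + rewrite normrM ler_pM// ?normr_ge0//.
        by rewrite !normrM (ger0_norm (ler0n _ 2)) ler_piMr// mulr_ge0.
      rewrite (le_trans (ler_normB _ _))// lerD//.
        by rewrite normrM (ger0_norm m10) (le_trans _ b1')// ler_piMl.
      rewrite normrM (ger0_norm n2) ler_wpM2r// !normrM (ger0_norm (ler0n _ 2)).
      by rewrite (ger0_norm p0) ler_piMr// mulr_ge0.
    + rewrite normrM -[leRHS]mul1r ler_pM//.
        by rewrite normrM mulr_ile1.
      rewrite (le_trans (ler_normD _ _))// lerD//.
        rewrite !normrM normrN (ger0_norm (ler0n _ 4)) (ger0_norm p0) (ger0_norm m20).
        by rewrite ler_wpM2l// mulr_ge0.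
      by rewrite ger0_norm// mulr_ge0// mulr_ge0// exprn_ge0.
  have -> : K * 2^-1 ^+ k = tg ^+ 2 * (C1 * 2^-1 ^+ k)
    + 2 * `|tg| * (C1 * 2^-1 ^+ k + 2 * pi * (C2 * 2^-1 ^+ k))
    + (4 * pi * (C2 * 2^-1 ^+ k) + 4 * pi ^+ 2 * (C3 * 2^-1 ^+ k)) by rewrite /K; ring.
  apply: lerD; first apply: lerD.
  - by rewrite ler_wpM2l ?sqr_ge0.
  - by rewrite ler_wpM2l ?mulr_ge0// lerD// ler_wpM2l// mulr_ge0.
  - by rewrite lerD// ler_wpM2l// ?mulr_ge0// ?sqr_ge0.
Qed.

Lemma is_derive_instB s t (sg tg : R) : 2 <= s ->
  is_derive (0 : R) 1 (fun h => instB (s + h * sg) (t + h * tg))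
    (sg * instBs s t - tg * instS s t).
Proof.
move=> s2; pose r := `|sg| + 1.
have r0 : 0 < r by rewrite ltr_wpDl.
have sg1 : `|sg / r| <= 1.
  by rewrite normrM normfV (gtr0_norm r0) ler_pdivrMr// mul1r lerDl.
have dG := is_derive_instB_small t (tg / r) s2 sg1.
pose G h := instB (s + h * (sg / r)) (t + h * (tg / r)).
have -> : (fun h => instB (s + h * sg) (t + h * tg)) = G \o (fun h => h * r).
  apply/funext => h /=; rewrite /G.
  by rewrite !mulrA ![h * r * _]mulrAC !mulfK// lt0r_neq0.
have rn0 : r != 0 by exact: lt0r_neq0.
have dG' : is_derive (0 * r) 1 G (sg / r * instBs s t - tg / r * instS s t).
  by rewrite mul0r.
have dr : is_derive (0 : R) 1 (fun h => h * r) r.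
  by apply: is_derive_eq; rewrite scaler0 add0r /GRing.scale/= mulr1.
apply: (is_derive_eq (is_derive1_comp (f := G) (g := fun h => h * r) dG' dr)).
by rewrite mulrBl (mulrAC _ (instBs s t)) (mulrAC _ (instS s t)) !divfK.
Qed.

End InstantonSeries.

(** * The forms of the hyperkaehler triple *)

Section ChargeSums.
Local Open Scope complex_scope.
Context {R : realType} {n : nat}.
Local Notation C := R[i].
Local Notation T := (cotM R n).

Definition zabs (p : T) : R := cabs (zc p ord0).
Definition dargz (p u : T) : R := cIm (zc u ord0 / zc p ord0).

Lemma Zg_ddy (p : T) i : Zg (ddy i) p = zc p i.
Proof.
rewrite /Zg (bigD1 i)//= big1 ?addr0; last first.
  by move=> j /negPf ji; rewrite !mxE ji !mul0r addr0.
by rewrite !mxE !eqxx mul0r add0r mul1r.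
Qed.

Lemma Zg_ddx (p : T) i : Zg (ddx i) p = wc p i.
Proof.
rewrite /Zg (bigD1 i)//= big1 ?addr0; last first.
  by move=> j /negPf ji; rewrite !mxE ji !mul0r addr0.
by rewrite !mxE !eqxx mul0r addr0 mul1r.
Qed.

Lemma thg_ddy (p : T) i : thg (ddy i) p = thetau p i.
Proof.
rewrite /thg (bigD1 i)//= big1 ?addr0; last first.
  by move=> j /negPf ji; rewrite !mxE ji !mul0r addr0.
by rewrite !mxE !eqxx mul0r add0r mul1r.
Qed.

Lemma thg_ddx (p : T) i : thg (ddx i) p = thetat p i.
Proof.
rewrite /thg (bigD1 i)//= big1 ?addr0; last first.
  by move=> j /negPf ji; rewrite !mxE ji !mul0r addr0.
by rewrite !mxE !eqxx mul0r addr0 mul1r.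
Qed.

Lemma ZgN g (p : T) : Zg (- g) p = - Zg g p.
Proof.
rewrite /Zg -sumrN; apply: eq_bigr => i _.
by rewrite !mxE !rmorphN/= !mulNr opprD.
Qed.

Lemma thgN g (p : T) : thg (- g) p = - thg g p.
Proof.
rewrite /thg -sumrN; apply: eq_bigr => i _.
by rewrite !mxE !rmorphN/= !mulNr opprD.
Qed.

Lemma dlogZ_ddy0 (p u : T) : dlogZ (ddy ord0) p u = 'i%C * (2 * dargz p u)%:C.
Proof.
rewrite /dlogZ /dZ /dZbar /dargz !Zg_ddy.
have -> : (zc u ord0)^*%C / (zc p ord0)^*%C = (zc u ord0 / zc p ord0)^*%C.
  by rewrite rmorphM fmorphV.
case: (_ / _) => a b; apply/eqP; rewrite eq_complex /=.
by apply/andP; split; apply/eqP => /=; ring.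
Qed.

Lemma dlogZN g (p u : T) : dlogZ (- g) p u = dlogZ g p u.
Proof.
by rewrite /dlogZ /dZ /dZbar !ZgN !rmorphN !invrN !mulrNN.
Qed.

Lemma csum_cexpi (t : R) (a : nat -> R) :
  csum (fun k => cexpi (k%:R * t) * (a k)%:C) =
  rsum (fun k => cos (k%:R * t) * a k) +i* rsum (fun k => sin (k%:R * t) * a k).
Proof.
by congr (_ +i* _); apply: eq_rsum => k _ /=; ring.
Qed.

Lemma csum_cexpi_div (t : R) (a : nat -> R) :
  csum (fun k => cexpi (k%:R * t) / k%:R * (a k)%:C) =
  rsum (fun k => cos (k%:R * t) / k%:R * a k)
  +i* rsum (fun k => sin (k%:R * t) / k%:R * a k).
Proof.
have h k : cexpi (k%:R * t) / k%:R * (a k)%:C =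
    (cos (k%:R * t) / k%:R * a k) +i* (sin (k%:R * t) / k%:R * a k).
  have -> : (k%:R : C)^-1 = (k%:R^-1 : R)%:C by rewrite fmorphV rmorph_nat.
  by apply/eqP; rewrite eq_complex /=; apply/andP; split; apply/eqP => /=; ring.
by congr (_ +i* _); apply: eq_rsum => k _; rewrite h.
Qed.

Section AtPoint.
Variables (Om : latvec n -> int) (m : int) (p : T).
Hypothesis OmP : Om (ddy ord0) = m.
Hypothesis OmN : Om (- ddy ord0) = m.
Hypothesis s1 : 1 <= zabs p.

Let s := zabs p.
Let t := thetau p ord0.

(** The three instanton quantities that survive the sum over both charges: the
    sum of [Omega V^inst], the coefficient of [d arg z^0] in the corrected
    [W_0], and [4 pi] times the sum of [Omega iota_V eta^inst]. *)
Definition vinst : R := m%:~R / pi * instV s t.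
Definition ainst : R := 2 * m%:~R * instS s t.
Definition binst : R := - (2 * m%:~R / pi) * instB s t.

Lemma cabsN (z : C) : cabs (- z) = cabs z.
Proof. by case: z => a b; rewrite /= !sqrrN. Qed.

Let sinV := rsum (fun k => sin (k%:R * t) * besselK 0 (2 * pi * k%:R * s)).
Let cosA := rsum (fun k => cos (k%:R * t) * (s * besselK 1 (2 * pi * k%:R * s))).
Let sinB := rsum (fun k => sin (k%:R * t) / k%:R * (s * besselK 1 (2 * pi * k%:R * s))).

Lemma Vinst_pos : Vinst (ddy ord0) p = (2 * pi)^-1%:C * (instV s t +i* sinV).
Proof. by rewrite /Vinst Zg_ddy thg_ddy csum_cexpi. Qed.

Lemma Vinst_neg : Vinst (- ddy ord0) p = (2 * pi)^-1%:C * (instV s t +i* - sinV).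
Proof.
rewrite /Vinst ZgN thgN Zg_ddy thg_ddy cabsN csum_cexpi; congr (_ * (_ +i* _)).
  by apply: eq_rsum => k _; rewrite mulrN cosN.
have [C C0 hC] := @dominated_bessel R.
have [h _] := hC s (fun k => sin (k%:R * t)) s1 (fun k => normr_sin_le1 _).
by rewrite -(rsumN h); apply: eq_rsum => k _; rewrite mulrN sinN mulNr.
Qed.

Lemma Ainst_pos u : Ainst (ddy ord0) p u =
  - (4 * pi)^-1%:C * (cosA +i* instS s t) * ('i%C * (2 * dargz p u)%:C).
Proof. by rewrite /Ainst Zg_ddy thg_ddy csum_cexpi dlogZ_ddy0. Qed.

Lemma Ainst_neg u : Ainst (- ddy ord0) p u =
  - (4 * pi)^-1%:C * (cosA +i* - instS s t) * ('i%C * (2 * dargz p u)%:C).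
Proof.
rewrite /Ainst ZgN thgN Zg_ddy thg_ddy cabsN csum_cexpi dlogZN dlogZ_ddy0.
congr (_ * (_ +i* _) * _).
  by apply: eq_rsum => k _; rewrite mulrN cosN.
have [C C0 hC] := @dominated_bessel R.
have [_ h] := hC s (fun k => sin (k%:R * t)) s1 (fun k => normr_sin_le1 _).
by rewrite -(rsumN h); apply: eq_rsum => k _; rewrite mulrN sinN mulNr.
Qed.

Lemma eta_inst_pos u : eta_inst_g (ddy ord0) p u =
  'i%C * (8 * pi ^+ 2)^-1%:C * (instB s t +i* sinB) * ('i%C * (2 * dargz p u)%:C).
Proof. by rewrite /eta_inst_g Zg_ddy thg_ddy csum_cexpi_div dlogZ_ddy0. Qed.

Lemma eta_inst_neg u : eta_inst_g (- ddy ord0) p u =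
  'i%C * (8 * pi ^+ 2)^-1%:C * (instB s t +i* - sinB) * ('i%C * (2 * dargz p u)%:C).
Proof.
rewrite /eta_inst_g ZgN thgN Zg_ddy thg_ddy cabsN csum_cexpi_div dlogZN dlogZ_ddy0.
congr (_ * (_ +i* _) * _).
  by apply: eq_rsum => k _; rewrite mulrN cosN.
have [C C0 hC] := @dominated_bessel R.
have [_ h] := hC s (fun k => sin (k%:R * t) / k%:R) s1
  (fun k => normr_divk_le1 _ (normr_sin_le1 _)).
by rewrite -(rsumN h); apply: eq_rsum => k _; rewrite mulrN sinN !mulNr.
Qed.

Lemma intrC (k : int) : (k%:~R : C) = (k%:~R : R)%:C.
Proof. by rewrite rmorph_int. Qed.

(** The forms [W_i = d thetat_i - tau_ij d theta^j], corrected by the two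
    instanton terms in the only direction that charges see.  With the [dz^i]
    they are the (1,0)-forms of [I_3], and a frame when [1 + v] is not zero. *)
Definition Ycoord (u : T) (i : 'I_n.+1) : C :=
  if i == ord0
  then (thetat u i + ainst * dargz p u) +i* (- ((1 + vinst) * thetau u i))
  else thetat u i +i* thetau u i.

Lemma tau_row (F : 'I_n.+1 -> C) i :
  \sum_j tau i j * F j = (if i == ord0 then 'i%C else - 'i%C) * F i.
Proof.
rewrite (bigD1 i)//= big1 ?addr0; last first.
  by move=> j /negPf ji; rewrite !mxE (eq_sym i j) ji mulr0n mul0r.
by rewrite !mxE eqxx mulr1n.
Qed.

Lemma lift0F (i : 'I_n) : (lift ord0 i == ord0) = false.
Proof. by rewrite eq_sym (negPf (neq_lift _ _)). Qed.

(** Passing from [gamma] to [- gamma] changes the signs of [dZ] and [d theta]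
    and conjugates the series.  Hence the sines cancel in the terms with
    [V^inst] and the cosines in those with [A^inst], and what survives only
    changes the partner of [dz^0]. *)
Lemma omega12E u w : omega12 Om p u w =
  (2 * pi)^-1%:C * \sum_i (zc u i * Ycoord w i - zc w i * Ycoord u i).
Proof.
rewrite /omega12 /support_charges big_cons big_seq1 OmP OmN.
rewrite Vinst_pos Vinst_neg /pair_wedge big_ord_recl [in RHS]big_ord_recl.
rewrite /wedge /dZ /dth !ZgN !thgN !Ainst_pos !Ainst_neg !intrC.
rewrite (eq_bigr (fun i : 'I_n => - (zc u (lift ord0 i) * Ycoord w (lift ord0 i)
   - zc w (lift ord0 i) * Ycoord u (lift ord0 i)))); last first.
  move=> i _; rewrite !Zg_ddx !Zg_ddy !thg_ddx !thg_ddy /wc !tau_row /Ycoord !lift0F.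
  case: (zc u _) (zc w _) => a b [c d].
  by apply/eqP; rewrite eq_complex /=; apply/andP; split; apply/eqP => /=; ring.
rewrite sumrN !Zg_ddx !Zg_ddy !thg_ddx !thg_ddy /wc !tau_row /Ycoord !eqxx /vinst /ainst.
set X := \sum_(i < n) _.
have : pi != 0 :> R by rewrite lt0r_neq0// pi_gt0.
move: (@pi R) => q p0; case: X => X1 X2.
case: (zc u _) (zc w _) => a b [c d].
apply/eqP; rewrite eq_complex /=; apply/andP; split; apply/eqP => /=.
  by field.
by field.
Qed.

Definition Tw (i : 'I_n.+1) : R := if i == ord0 then 1 + vinst else -1.

(** The terms with [V^inst] turn [|dz^0|^2] into [(1 + v) |dz^0|^2]; those with
    [A^inst] complete [d thetat_0 /\ d theta^0] to the imaginary part of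
    [Y_0] times its conjugate, divided by [1 + v]. *)
Lemma omega3E u w : 1 + vinst != 0 -> omega3 Om p u w =
  - \sum_i (Tw i * cIm (zc u i * (zc w i)^*%C) +
      (4 * pi ^+ 2)^-1 * (Tw i)^-1 * cIm (Ycoord u i * (Ycoord w i)^*%C)).
Proof.
move=> T0.
rewrite /omega3 /support_charges big_cons big_seq1 OmP OmN.
rewrite Vinst_pos Vinst_neg /pair_wedge !mulr_sumr -sumrB.
rewrite big_ord_recl [in RHS]big_ord_recl.
rewrite /wedge /dZ /dZbar /dth !ZgN !thgN !Ainst_pos !Ainst_neg !intrC.
have i4 : (4^-1 : C) = (4^-1 : R)%:C by rewrite fmorphV rmorph_nat.
have i2 : (2^-1 : C) = (2^-1 : R)%:C by rewrite fmorphV rmorph_nat.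
have p0 : pi != 0 :> R by rewrite lt0r_neq0// pi_gt0.
rewrite (eq_bigr (fun i : 'I_n => (- (Tw (lift ord0 i) *
   cIm (zc u (lift ord0 i) * (zc w (lift ord0 i))^*%C) +
      (4 * pi ^+ 2)^-1 * (Tw (lift ord0 i))^-1 *
      cIm (Ycoord u (lift ord0 i) * (Ycoord w (lift ord0 i))^*%C)))%:C)); last first.
  move=> i _; rewrite !Zg_ddx !Zg_ddy !thg_ddx !thg_ddy /wc !tau_row /Ycoord /Tw !lift0F.
  move: (@pi R) p0 => q p0; rewrite i4; case: (zc u _) (zc w _) => a b [c d].
  by apply/eqP; rewrite eq_complex /=; apply/andP; split; apply/eqP => /=; field.
rewrite -rmorph_sum sumrN opprD.
rewrite !Zg_ddx !Zg_ddy !thg_ddx !thg_ddy /wc !tau_row.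
move: (\sum_(i < n) _) => X.
rewrite /Ycoord /Tw !eqxx i4 i2; case: (zc u _) (zc w _) => a b [c d] /=.
move: T0; rewrite /vinst /ainst => T0.
have T0' : pi + m%:~R * instV s t != 0.
  move: T0; apply: contra_neq => e; apply: (mulfI p0).
  by rewrite mulr0 mulrDr mulr1 mulrA (mulrCA pi) divff// mulr1.
by move: (@pi R) p0 T0' {T0} => q p0 T0'; field; rewrite T0' p0.
Qed.

End AtPoint.
End ChargeSums.

(** * The hyperkaehler metric *)

Section HyperkahlerMetric.
Local Open Scope complex_scope.
Context {R : realType} {n : nat}.
Local Notation C := R[i].
Local Notation T := (cotM R n).

Definition bilinear_form (w : T -> T -> R) : Prop :=
  (forall a u v x, w (a *: u + v) x = a * w u x + w v x) /\
  (forall a u v x, w x (a *: u + v) = a * w x u + w x v).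

Lemma linear_sum_form (V : lmodType R) (f : V -> R) (I : Type) (r : seq I)
    (c : I -> R) (e : I -> V) :
  (forall a u v, f (a *: u + v) = a * f u + f v) ->
  f (\sum_(i <- r) c i *: e i) = \sum_(i <- r) c i * f (e i).
Proof.
move=> lf; have f0 : f 0 = 0.
  by have := lf 1 0 0; rewrite scale1r addr0 mul1r => h; apply/esym/(addrI (f 0)); rewrite addr0.
elim: r => [|i r IH]; first by rewrite !big_nil.
by rewrite !big_cons lf IH.
Qed.

Lemma gramE (w : T -> T -> R) u v : bilinear_form w ->
  (mxvec u *m gram w *m (mxvec v)^T) ord0 ord0 = w u v.
Proof.
move=> [wl wr].
have dec (x : T) : x = \sum_a mxvec x ord0 a *: vec_mx (delta_mx ord0 a).
  rewrite -[LHS]mxvecK {1}[mxvec x]row_sum_delta linear_sum/=.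
  by apply: eq_bigr => a _; rewrite linearZ.
rewrite {2}[u]dec {2}[v]dec mxE.
rewrite (linear_sum_form (f := w^~ _)); last by move=> a x y; exact: wl.
rewrite [RHS](eq_bigr (fun i => \sum_j mxvec u ord0 i *
    (mxvec v ord0 j * w (vec_mx (delta_mx ord0 i)) (vec_mx (delta_mx ord0 j)))));
  last first.
  move=> i _; rewrite -mulr_sumr; congr (_ * _).
  by rewrite (linear_sum_form (f := w _))// => a x y; exact: wr.
rewrite exchange_big/=; apply: eq_bigr => b _; rewrite !mxE mulr_suml.
by apply: eq_bigr => a _; rewrite !mxE -mulrA [in RHS]mulrCA mulrA mulrC.
Qed.

Lemma gram_unit (w : T -> T -> R) : bilinear_form w ->
  (forall u, (forall x, w u x = 0) -> u = 0) -> gram w \in unitmx.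
Proof.
move=> bw nd; rewrite -row_free_unit -kermx_eq0; apply/eqP/row_matrixP => i.
rewrite row0; set r := row i _.
have r0 : r *m gram w = 0 by rewrite -row_mul mulmx_ker row0.
rewrite -[r]vec_mxK (nd (vec_mx r)) ?linear0// => x.
by rewrite -(gramE _ _ bw) vec_mxK r0 mul0mx mxE.
Qed.

Lemma zcP (a : R) (u v : T) i : zc (a *: u + v) i = a%:C * zc u i + zc v i.
Proof.
rewrite /zc /blk !mxE; apply/eqP; rewrite eq_complex /=.
by apply/andP; split; apply/eqP => /=; ring.
Qed.

Lemma thetatP (a : R) (u v : T) i :
  thetat (a *: u + v) i = a * thetat u i + thetat v i.
Proof. by rewrite /thetat /blk !mxE. Qed.

Lemma thetauP (a : R) (u v : T) i :
  thetau (a *: u + v) i = a * thetau u i + thetau v i.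
Proof. by rewrite /thetau /blk !mxE. Qed.

Lemma cReZ (a : R) (z : C) : cRe (a%:C * z) = a * cRe z.
Proof. by case: z => x y /=; rewrite mul0r subr0. Qed.

Lemma cImZ (a : R) (z : C) : cIm (a%:C * z) = a * cIm z.
Proof. by case: z => x y /=; rewrite mul0r addr0. Qed.

Lemma cReD (z w : C) : cRe (z + w) = cRe z + cRe w.
Proof. by case: z w => ? ? [? ?]. Qed.

Lemma cImD (z w : C) : cIm (z + w) = cIm z + cIm w.
Proof. by case: z w => ? ? [? ?]. Qed.

Lemma dargzP (p u v : T) (a : R) :
  dargz p (a *: u + v) = a * dargz p u + dargz p v.
Proof. by rewrite /dargz zcP mulrDl -mulrA cImD cImZ. Qed.

Lemma YcoordP m (p : T) (a : R) (u v : T) i :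
  Ycoord m p (a *: u + v) i = a%:C * Ycoord m p u i + Ycoord m p v i.
Proof.
rewrite /Ycoord; case: ifP => _; rewrite !thetatP !thetauP ?dargzP;
  by apply/eqP; rewrite eq_complex /=; apply/andP; split; apply/eqP => /=; ring.
Qed.

Lemma cotM_eq0 (u : T) : (forall i, zc u i = 0) -> (forall i, thetat u i = 0) ->
  (forall i, thetau u i = 0) -> u = 0.
Proof.
move=> z0 t0 u0; apply/matrixP => a i; rewrite mxE.
have /eqP := z0 i; rewrite eq_complex /= => /andP[/eqP b0 /eqP b1].
have b2 := t0 i; have b3 := u0 i.
rewrite -[a]inord_val; case: a => -[|[|[|[|]]]] //= _.
Qed.

Lemma val_inord4 k : (k < 4)%N -> val (inord k : 'I_4) = k.
Proof. exact: inordK. Qed.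

Section AtPoint.
Variables (Om : latvec n -> int) (m : int) (p : T).
Hypothesis OmP : Om (ddy ord0) = m.
Hypothesis OmN : Om (- ddy ord0) = m.
Hypothesis s1 : 1 <= zabs p.
Hypothesis T0 : 1 + vinst m p != 0.

Local Notation Y := (Ycoord m p).

(** Vectors with prescribed frame coordinates, which serve as test vectors:
    the inverse of the frame [(dz, Y)] when [1 + v] is not zero. *)
Definition frame_inv (z y : 'I_n.+1 -> C) : T :=
  \matrix_(a, i) match val a with
    | 0%N => cRe (z i)
    | 1%N => cIm (z i)
    | 2%N => cRe (y i) - (if i == ord0 then ainst m p * cIm (z ord0 / zc p ord0) else 0)
    | _ => if i == ord0 then - (1 + vinst m p)^-1 * cIm (y i) else cIm (y i)
    end.

Lemma zc_frame_inv z y i : zc (frame_inv z y) i = z i.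
Proof. by rewrite /zc /blk !mxE !val_inord4//=; case: (z i). Qed.

Lemma Y_frame_inv z y i : Y (frame_inv z y) i = y i.
Proof.
rewrite /Ycoord /dargz zc_frame_inv /thetat /thetau /blk !mxE !val_inord4//=.
case: eqVneq => [->|_]; last by case: (y i) => ? ?; rewrite subr0.
by rewrite subrK mulrA mulrN mulNr opprK divff// mul1r; case: (y _).
Qed.

Lemma frame_inj u : (forall i, zc u i = 0) -> (forall i, Y u i = 0) -> u = 0.
Proof.
move=> z0 y0; apply: cotM_eq0 => // i; have /eqP := y0 i;
  rewrite /Ycoord /dargz z0 mul0r mulr0 addr0;
  case: ifP => _; rewrite eq_complex /= => /andP[/eqP h1 /eqP h2] //.
by move: h2 => /eqP; rewrite oppr_eq0 mulf_eq0 (negPf T0) => /eqP.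
Qed.

Definition frame_wedge u w : C := \sum_i (zc u i * Y w i - zc w i * Y u i).

Lemma frame_wedgePl a u v w :
  frame_wedge (a *: u + v) w = a%:C * frame_wedge u w + frame_wedge v w.
Proof.
rewrite /frame_wedge mulr_sumr -big_split; apply: eq_bigr => i _ /=.
by rewrite zcP YcoordP; ring.
Qed.

Lemma frame_wedgePr a u v w :
  frame_wedge w (a *: u + v) = a%:C * frame_wedge w u + frame_wedge w v.
Proof.
rewrite /frame_wedge mulr_sumr -big_split; apply: eq_bigr => i _ /=.
by rewrite zcP YcoordP; ring.
Qed.

Lemma omega1E u w : omega1 Om p u w = (2 * pi)^-1 * cRe (frame_wedge u w).
Proof. by rewrite /omega1 (omega12E OmP OmN s1) cReZ. Qed.

Lemma omega2E u w : omega2 Om p u w = (2 * pi)^-1 * cIm (frame_wedge u w).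
Proof. by rewrite /omega2 (omega12E OmP OmN s1) cImZ. Qed.

Lemma bilinear_omega1 : bilinear_form (omega1 Om p).
Proof.
by split=> a u v w; rewrite !omega1E ?frame_wedgePl ?frame_wedgePr cReD cReZ; ring.
Qed.

Lemma bilinear_omega2 : bilinear_form (omega2 Om p).
Proof.
by split=> a u v w; rewrite !omega2E ?frame_wedgePl ?frame_wedgePr cImD cImZ; ring.
Qed.

Definition frame_herm u w : C := \sum_i ((Tw m p i)%:C * (zc u i * (zc w i)^*%C)
  + ((4 * pi ^+ 2)^-1 * (Tw m p i)^-1)%:C * (Y u i * (Y w i)^*%C)).

Lemma conjcP (a : R) (z w : C) : (a%:C * z + w)^*%C = a%:C * z^*%C + w^*%C.
Proof.
case: z w => x y [x' y']; apply/eqP; rewrite eq_complex /=.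
by apply/andP; split; apply/eqP => /=; ring.
Qed.

Lemma frame_hermPl a u v w :
  frame_herm (a *: u + v) w = a%:C * frame_herm u w + frame_herm v w.
Proof.
rewrite /frame_herm mulr_sumr -big_split; apply: eq_bigr => i _ /=.
by rewrite zcP YcoordP; ring.
Qed.

Lemma frame_hermPr a u v w :
  frame_herm w (a *: u + v) = a%:C * frame_herm w u + frame_herm w v.
Proof.
rewrite /frame_herm mulr_sumr -big_split; apply: eq_bigr => i _.
rewrite zcP YcoordP !conjcP.
have alg (A B b z y x1 x2 x3 x4 : C) : A * (z * (b * x4 + x3)) +
  B * (y * (b * x2 + x1)) = b * (A * (z * x4) + B * (y * x2)) +
  (A * (z * x3) + B * (y * x1)) by ring.
exact: alg.
Qed.

Lemma frame_herm_sum (f : C -> R) u w :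
  (forall a z, f (a%:C * z) = a * f z) -> (forall z z', f (z + z') = f z + f z') ->
  f (frame_herm u w) = \sum_i (Tw m p i * f (zc u i * (zc w i)^*%C)
  + (4 * pi ^+ 2)^-1 * (Tw m p i)^-1 * f (Y u i * (Y w i)^*%C)).
Proof.
move=> fZ fD; have f0 : f 0 = 0 by have := fZ 0 0; rewrite mulr0 mul0r.
rewrite /frame_herm (big_morph f fD f0); apply: eq_bigr => i _.
by rewrite fD !fZ.
Qed.

Lemma omega3_herm u w : omega3 Om p u w = - cIm (frame_herm u w).
Proof. by rewrite (omega3E OmP OmN s1)// (frame_herm_sum _ _ cImZ cImD). Qed.

Lemma bilinear_omega3 : bilinear_form (omega3 Om p).
Proof.
by split=> a u v w; rewrite !omega3_herm ?frame_hermPl ?frame_hermPr cImD cImZ; ring.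
Qed.

Lemma mulc_conj_ge0 (z : C) : 0 <= cRe (z * z^*%C).
Proof. by case: z => x y /=; nra. Qed.

Lemma mulc_conj_eq0 (z : C) : cRe (z * z^*%C) = 0 -> z = 0.
Proof.
case: z => x y /= /eqP; rewrite (_ : x * x - y * - y = x ^+ 2 + y ^+ 2); last by ring.
by rewrite paddr_eq0 ?sqr_ge0// !sqrf_eq0 => /andP[/eqP -> /eqP ->].
Qed.

Lemma sum_norm_eq0 u :
  \sum_i (cRe (zc u i * (zc u i)^*%C) + cRe (Y u i * (Y u i)^*%C)) = 0 -> u = 0.
Proof.
move=> /eqP; rewrite psumr_eq0; last by move=> i _; rewrite addr_ge0 ?mulc_conj_ge0.
move=> /allP h; apply: frame_inj => i; have := h i (mem_index_enum _);
  by rewrite paddr_eq0 ?mulc_conj_ge0// => /andP[/eqP h1 /eqP h2]; apply: mulc_conj_eq0.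
Qed.

Lemma pi2_neq0 : (2 * pi)^-1 != 0 :> R.
Proof. by rewrite invr_neq0// mulf_neq0// lt0r_neq0// pi_gt0. Qed.

(** Pairing [u] with the vector of frame coordinates [(- conj Y, conj z)] gives
    the sum of the [|dz^i|^2] and [|Y_i|^2]. *)
Lemma unit_omega1 : gram (omega1 Om p) \in unitmx.
Proof.
apply: gram_unit bilinear_omega1 _ => u /(_ (frame_inv (fun i => - (Y u i)^*%C)
  (fun i => (zc u i)^*%C))).
rewrite omega1E => /eqP; rewrite mulf_eq0 (negPf pi2_neq0)/= => /eqP h.
apply: sum_norm_eq0; apply: etrans h; rewrite /frame_wedge (big_morph _ cReD (erefl (cRe 0))).
apply: eq_bigr => i _; rewrite zc_frame_inv Y_frame_inv -cReD.
have alg (x y x' y' : C) : x * x' - - y' * y = x * x' + y * y' by ring.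
by rewrite alg.
Qed.

Lemma unit_omega2 : gram (omega2 Om p) \in unitmx.
Proof.
apply: gram_unit bilinear_omega2 _ => u /(_ (frame_inv
  (fun i => - 'i%C * (Y u i)^*%C) (fun i => 'i%C * (zc u i)^*%C))).
rewrite omega2E => /eqP; rewrite mulf_eq0 (negPf pi2_neq0)/= => /eqP h.
apply: sum_norm_eq0; apply: etrans h; rewrite /frame_wedge (big_morph _ cImD (erefl (cIm 0))).
apply: eq_bigr => i _; rewrite zc_frame_inv Y_frame_inv -cReD.
have alg (x y x' y' : C) :
  x * ('i%C * x') - - 'i%C * y' * y = 'i%C * (x * x' + y * y') by ring.
by rewrite alg; case: (_ + _) => x y /=; ring.
Qed.

(** In the frame [omega1 + i omega2] is of type (2,0) and [omega3] of type
    (1,1).  So the complex structure determined by [omega1] and [omega2]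
    multiplies the frame by ['i], and the metric is the real part of the
    Hermitian form of which [omega3] is minus the imaginary part. *)
Lemma gNE u w : gN Om p u w = cRe (frame_herm u w).
Proof.
pose v := frame_inv (fun i => - 'i%C * zc u i) (fun i => - 'i%C * Y u i).
have wv x : frame_wedge v x = - 'i%C * frame_wedge u x.
  rewrite /frame_wedge mulr_sumr; apply: eq_bigr => i _.
  rewrite zc_frame_inv Y_frame_inv.
  have alg (a b c d : C) : - 'i%C * a * b - c * (- 'i%C * d) = - 'i%C * (a * b - c * d)
    by ring.
  exact: alg.
have hv : frame_herm v w = - 'i%C * frame_herm u w.
  rewrite /frame_herm mulr_sumr; apply: eq_bigr => i _.
  rewrite zc_frame_inv Y_frame_inv.
  have alg (A B a b c d : C) : A * (- 'i%C * a * b) + B * (- 'i%C * c * d) =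
    - 'i%C * (A * (a * b) + B * (c * d)) by ring.
  exact: alg.
have o12 x : omega1 Om p u x = - omega2 Om p v x.
  rewrite omega1E omega2E wv; case: (frame_wedge u x) => a b /=; ring.
have vI : mxvec v *m I3mx Om p = mxvec u.
  suff e : mxvec v *m - gram (omega2 Om p) = mxvec u *m gram (omega1 Om p).
    by rewrite /I3mx mulmxA e mulmxK ?unit_omega1.
  rewrite mulmxN; apply/rowP => b; apply/esym.
  have := o12 (vec_mx (delta_mx ord0 b)).
  rewrite -(gramE _ _ bilinear_omega1) -(gramE _ _ bilinear_omega2) vec_mxK trmx_delta.
  by rewrite -!colE !mxE => ->.
have uI : I3mx Om p \in unitmx.
  by rewrite unitmx_mul unitmx_inv unit_omega1 andbT -scaleN1r unitmxZ ?unitrN1 ?unit_omega2.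
have -> : gN Om p u w = omega3 Om p v w.
  rewrite /gN -(gramE _ _ bilinear_omega3); congr ((_ *m _) _ _).
  by rewrite -vI mulmxA (mulmxK uI).
by rewrite omega3_herm hv; case: (frame_herm u w) => a b /=; ring.
Qed.

End AtPoint.
End HyperkahlerMetric.

(** * Contractions with the rotating vector field *)

Section SliceFormulas.
Local Open Scope complex_scope.
Context {R : realType} {n : nat}.
Local Notation C := R[i].
Local Notation T := (cotM R n).
Local Notation X := (coordX R n).

Definition Nsign (i : 'I_n.+1) : R := if i == ord0 then 1 else -1.

Lemma NmxE i j : @Nmx R n i j = if i == j then Nsign i else 0.
Proof.
by rewrite /Nmx !mxE /Nsign; case: (i == j) => //=; case: ifP.
Qed.

Lemma gME (u v : T) : gM u v = \sum_i Nsign i * cRe (zc u i * (zc v i)^*%C).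
Proof.
rewrite /gM (big_morph _ (@cReD R) (erefl (cRe 0))); apply: eq_bigr => i _.
rewrite (bigD1 i)//= big1 ?addr0; last first.
  by move=> j /negPf ji; rewrite NmxE eq_sym ji !mul0r.
by rewrite NmxE eqxx -mulrA cReZ.
Qed.

Lemma gM_recl (u v : T) : gM u v = cRe (zc u ord0 * (zc v ord0)^*%C)
  - \sum_(i < n) cRe (zc u (lift ord0 i) * (zc v (lift ord0 i))^*%C).
Proof.
rewrite gME big_ord_recl /Nsign eqxx mul1r -sumrN; congr (_ + _).
by apply: eq_bigr => i _; rewrite lift0F mulN1r.
Qed.

Lemma r2E (p : T) : r2 p = gM p p.
Proof. by []. Qed.

Lemma zc_Vfield (p : T) i : zc (Vfield p) i = 'i%C * zc p i.
Proof.
rewrite /zc /blk !mxE !eqxx.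
have -> : (inord 1 == inord 0 :> 'I_4) = false.
  by apply/negbTE; rewrite -val_eqE !val_inord4.
by rewrite /blk; apply/eqP; rewrite eq_complex /= !(mul0r, mul1r, sub0r, add0r) !eqxx.
Qed.

Lemma thetat_Vfield (p : T) i : thetat (Vfield p) i = 0.
Proof.
rewrite /thetat /blk !mxE.
by rewrite !ifF//; apply/negbTE; rewrite -val_eqE !val_inord4.
Qed.

Lemma thetau_Vfield (p : T) i : thetau (Vfield p) i = 0.
Proof.
rewrite /thetau /blk !mxE.
by rewrite !ifF//; apply/negbTE; rewrite -val_eqE !val_inord4.
Qed.

Lemma dargz_Vfield (p : T) : zc p ord0 != 0 -> dargz p (Vfield p) = 1.
Proof. by move=> z0; rewrite /dargz zc_Vfield mulfK. Qed.

Section Scalars.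
Variables (Om : latvec n -> int) (m : int) (p : T).
Hypothesis OmP : Om (ddy ord0) = m.
Hypothesis OmN : Om (- ddy ord0) = m.

Lemma eta_inst_sum u : 1 <= zabs p ->
  cRe (\sum_(g <- support_charges) (Om g)%:~R * eta_inst_g g p u) =
  (4 * pi)^-1 * binst m p * dargz p u.
Proof.
move=> s1; rewrite /support_charges big_cons big_seq1 OmP OmN.
rewrite eta_inst_pos (eta_inst_neg s1) !intrC /binst.
have : pi != 0 :> R by rewrite lt0r_neq0// pi_gt0.
move: (@pi R) (rsum _) (dargz p u) => q sinB d q0 /=.
by field.
Qed.

Lemma Y0_Vfield : zc p ord0 != 0 ->
  Ycoord m p (Vfield p) ord0 = (ainst m p)%:C.
Proof.
move=> z0; rewrite /Ycoord eqxx thetat_Vfield thetau_Vfield dargz_Vfield//.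
by apply/eqP; rewrite eq_complex /=; apply/andP; split; apply/eqP => /=; ring.
Qed.

Lemma Yi_Vfield i : i != ord0 -> Ycoord m p (Vfield p) i = 0.
Proof.
by move=> /negPf i0; rewrite /Ycoord i0 thetat_Vfield thetau_Vfield.
Qed.

Hypothesis s1 : 1 <= zabs p.

Let z0 : zc p ord0 != 0.
Proof.
apply: contraTneq s1 => z0; rewrite /zabs z0 /= expr0n/= addr0 sqrtr0.
by rewrite -ltNge.
Qed.

Lemma fhamE c : fham Om c p = 2 * pi * r2 p - c + binst m p.
Proof.
rewrite /fham eta_inst_sum// dargz_Vfield// mulr1 mulVKf//.
by rewrite mulf_neq0// lt0r_neq0// pi_gt0.
Qed.

Hypothesis T0 : 1 + vinst m p != 0.

(** This isolates [g_N - pi_M^* g_M], whose contraction with [V] enters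
    [eta^inst]. *)
Lemma gN_gM u w : gN Om p u w = gM u w
  + vinst m p * cRe (zc u ord0 * (zc w ord0)^*%C)
  + (4 * pi ^+ 2)^-1 *
    ((1 + vinst m p)^-1 * cRe (Ycoord m p u ord0 * (Ycoord m p w ord0)^*%C)
     - \sum_(i < n) cRe (Ycoord m p u (lift ord0 i) * (Ycoord m p w (lift ord0 i))^*%C)).
Proof.
rewrite (gNE OmP OmN s1 T0) (frame_herm_sum _ _ _ _ (@cReZ R) (@cReD R)) gM_recl.
rewrite big_ord_recl /Tw eqxx.
rewrite (eq_bigr (fun i : 'I_n =>
  - cRe (zc u (lift ord0 i) * (zc w (lift ord0 i))^*%C) - (4 * pi ^+ 2)^-1 *
  cRe (Ycoord m p u (lift ord0 i) * (Ycoord m p w (lift ord0 i))^*%C))); last first.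
  by move=> i _; rewrite !lift0F invrN1 mulrN1 mulN1r mulNr.
rewrite big_split/= !sumrN -mulr_sumr.
by ring.
Qed.

End Scalars.
End SliceFormulas.

(** * Restriction to the slice of real positive z^0 *)

Section Slice.
Local Open Scope complex_scope.
Context {R : realType} {n : nat}.
Local Notation C := R[i].
Local Notation T := (cotM R n).
Local Notation CX := (coordX R n).
Implicit Types (x dx : CX) (u w : T).

(** [Eform x dx - i Fform x dx] is [\sum_i conj (X^i) dX^i], and [Eform dx dx']
    is the flat product of two [dX].  The sums over the uncharged directions
    [W_1], ..., [W_n] follow the same pattern: [Wform] is their flat product,
    and [QRform + i QIform] is [\sum_i X^i W_i]. *)
Definition Eform x dx : R :=
  \sum_i (x.1 ord0 i * dx.1 ord0 i + x.2 ord0 i * dx.2 ord0 i).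
Definition Fform x dx : R :=
  \sum_i (x.2 ord0 i * dx.1 ord0 i - x.1 ord0 i * dx.2 ord0 i).
Definition Wform u w : R :=
  \sum_(i < n) (thetat u (lift ord0 i) * thetat w (lift ord0 i)
              + thetau u (lift ord0 i) * thetau w (lift ord0 i)).
Definition QRform x u : R :=
  \sum_(i < n) (x.1 ord0 i * thetat u (lift ord0 i) - x.2 ord0 i * thetau u (lift ord0 i)).
Definition QIform x u : R :=
  \sum_(i < n) (x.1 ord0 i * thetau u (lift ord0 i) + x.2 ord0 i * thetat u (lift ord0 i)).

Lemma cabs_sqr (z : C) : cabs z ^+ 2 = cRe z ^+ 2 + cIm z ^+ 2.
Proof. by case: z => a b /=; rewrite sqr_sqrtr// addr_ge0 ?sqr_ge0. Qed.

Lemma normX2E x : normX2 x = Eform x x.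
Proof. by apply: eq_bigr => i _; rewrite cabs_sqr /= !expr2. Qed.

Section OnSlice.
Variables (p : T) (s : R) (x : CX).
Hypothesis zp0 : zc p ord0 = s%:C.
Hypothesis zpi : forall i, zc p (lift ord0 i) = s%:C * Xcoord x i.
Hypothesis s1 : 1 <= s.

(** Tangent vectors to the slice [Arg z^0 = 0]: [dz^0 = s l] is real. *)
Definition slice_tangent (l : R) dx u : Prop :=
  zc u ord0 = (s * l)%:C /\
  forall i, zc u (lift ord0 i) = (s * l)%:C * Xcoord x i + s%:C * Xcoord dx i.

Lemma zabs_slice : zabs p = s.
Proof.
by rewrite /zabs zp0 /= expr0n/= addr0 sqrtr_sqr ger0_norm// (le_trans ler01 s1).
Qed.

Lemma dargz_slice l dx u : slice_tangent l dx u -> dargz p u = 0.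
Proof.
by move=> [u0 _]; rewrite /dargz u0 zp0 -fmorphV -rmorphM.
Qed.

Lemma gM_slice l dx u l' dx' w : slice_tangent l dx u -> slice_tangent l' dx' w ->
  gM u w = s ^+ 2 * (l * l' * (1 - normX2 x) - l * Eform x dx' - l' * Eform x dx
    - Eform dx dx').
Proof.
move=> [u0 ui] [w0 wi]; rewrite gM_recl u0 w0 normX2E.
rewrite (eq_bigr (fun i : 'I_n =>
    s ^+ 2 * (l * l' * (x.1 ord0 i * x.1 ord0 i + x.2 ord0 i * x.2 ord0 i)
     + l * (x.1 ord0 i * dx'.1 ord0 i + x.2 ord0 i * dx'.2 ord0 i)
     + l' * (x.1 ord0 i * dx.1 ord0 i + x.2 ord0 i * dx.2 ord0 i)
     + (dx.1 ord0 i * dx'.1 ord0 i + dx.2 ord0 i * dx'.2 ord0 i)))); last first.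
  by move=> i _; rewrite ui wi /=; ring.
rewrite -mulr_sumr; do 3 rewrite big_split/=.
rewrite -!mulr_sumr -!/(Eform _ _) /=.
by ring.
Qed.

Lemma r2_slice : r2 p = s ^+ 2 * (1 - normX2 x).
Proof.
rewrite r2E (@gM_slice 1 0 p 1 0 p).
- have E0 y : Eform y 0 = 0 by rewrite /Eform big1// => i _; rewrite !mxE; ring.
  by rewrite !E0; ring.
- split=> [|i]; first by rewrite zp0 mulr1.
  by rewrite zpi mulr1 (_ : Xcoord 0 i = 0) ?mulr0 ?addr0// /Xcoord !mxE.
- split=> [|i]; first by rewrite zp0 mulr1.
  by rewrite zpi mulr1 (_ : Xcoord 0 i = 0) ?mulr0 ?addr0// /Xcoord !mxE.
Qed.

Lemma gM_V_slice l dx u : slice_tangent l dx u ->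
  gM (Vfield p) u = s ^+ 2 * Fform x dx.
Proof.
move=> [u0 ui]; rewrite gM_recl !zc_Vfield u0 zp0.
rewrite (eq_bigr (fun i : 'I_n => - (s ^+ 2 *
  (x.2 ord0 i * dx.1 ord0 i - x.1 ord0 i * dx.2 ord0 i)))); last first.
  by move=> i _; rewrite zc_Vfield zpi ui /=; ring.
by rewrite sumrN -mulr_sumr /= -/(Fform _ _); ring.
Qed.

Lemma gM_VV : gM (Vfield p) (Vfield p) = r2 p.
Proof.
rewrite r2E !gME; apply: eq_bigr => i _; congr (_ * _).
by rewrite zc_Vfield; case: (zc p i) => a b /=; ring.
Qed.

Variables (Om : latvec n -> int) (m : int).
Hypothesis OmP : Om (ddy ord0) = m.
Hypothesis OmN : Om (- ddy ord0) = m.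
Hypothesis T0 : 1 + vinst m p != 0.

Let s1' : 1 <= zabs p.
Proof. by rewrite zabs_slice. Qed.

Let zp0N : zc p ord0 != 0.
Proof. by rewrite zp0 eq_complex /= eqxx andbT; apply/eqP => s0; move: s1; rewrite s0; lra. Qed.

Local Notation v := (vinst m p).
Local Notation a := (ainst m p).

Lemma Y0_slice l dx u : slice_tangent l dx u ->
  Ycoord m p u ord0 = thetat u ord0 +i* (- ((1 + v) * thetau u ord0)).
Proof. by move=> /dargz_slice h; rewrite /Ycoord eqxx h mulr0 addr0. Qed.

Lemma Yi_E u i : Ycoord m p u (lift ord0 i) =
  thetat u (lift ord0 i) +i* thetau u (lift ord0 i).
Proof. by rewrite /Ycoord lift0F. Qed.

Lemma gN_slice l dx u l' dx' w : slice_tangent l dx u -> slice_tangent l' dx' w ->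
  gN Om p u w = s ^+ 2 * (l * l' * (1 - normX2 x + v) - l * Eform x dx'
     - l' * Eform x dx - Eform dx dx')
  + (4 * pi ^+ 2)^-1 * ((1 + v)^-1 * (thetat u ord0 * thetat w ord0)
    + (1 + v) * (thetau u ord0 * thetau w ord0) - Wform u w).
Proof.
move=> hu hw; rewrite (gN_gM OmP OmN s1' T0) (gM_slice hu hw).
rewrite (Y0_slice hu) (Y0_slice hw) hu.1 hw.1.
rewrite (eq_bigr (fun i : 'I_n => thetat u (lift ord0 i) * thetat w (lift ord0 i)
              + thetau u (lift ord0 i) * thetau w (lift ord0 i))); last first.
  by move=> i _; rewrite !Yi_E /=; ring.
rewrite -/(Wform _ _) /=.
have e : (1 + v)^-1 * (thetat u ord0 * thetat w ord0
    - - ((1 + v) * thetau u ord0) * - - ((1 + v) * thetau w ord0)) =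
  (1 + v)^-1 * (thetat u ord0 * thetat w ord0)
    + (1 + v) * (thetau u ord0 * thetau w ord0).
  by field.
by rewrite e; ring.
Qed.

Lemma gN_V_slice l dx u : slice_tangent l dx u ->
  gN Om p (Vfield p) u = s ^+ 2 * Fform x dx
    + (4 * pi ^+ 2)^-1 * (1 + v)^-1 * a * thetat u ord0.
Proof.
move=> hu; rewrite (gN_gM OmP OmN s1' T0) (gM_V_slice hu).
rewrite (Y0_slice hu) Y0_Vfield// zc_Vfield hu.1 zp0 big1; last first.
  by move=> i _; rewrite Yi_Vfield ?lift0F// mul0r.
by rewrite /=; ring.
Qed.

Lemma gN_VV : gN Om p (Vfield p) (Vfield p) =
  s ^+ 2 * (1 - normX2 x + v) + (4 * pi ^+ 2)^-1 * (1 + v)^-1 * a ^+ 2.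
Proof.
rewrite (gN_gM OmP OmN s1' T0) gM_VV r2_slice Y0_Vfield// zc_Vfield zp0 big1; last first.
  by move=> i _; rewrite Yi_Vfield ?lift0F// mul0r.
by rewrite /=; ring.
Qed.

Lemma XfieldE : Xfield p = 1 *: Vfield p + Vfield p.
Proof. by rewrite /Xfield scale1r -[2]/(1 + 1) scalerDl scale1r. Qed.

Lemma gN_Xl u : gN Om p (Xfield p) u = 2 * gN Om p (Vfield p) u.
Proof.
rewrite !(gNE OmP OmN s1' T0) XfieldE frame_hermPl cReD cReZ; ring.
Qed.

Lemma gN_XX : gN Om p (Xfield p) (Xfield p) = 4 * gN Om p (Vfield p) (Vfield p).
Proof.
rewrite !(gNE OmP OmN s1' T0) XfieldE frame_hermPl frame_hermPr !(cReD, cReZ); ring.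
Qed.

Lemma frame_wedge_V l dx u : slice_tangent l dx u ->
  frame_wedge m p (Vfield p) u =
  (s * ((1 + v) * thetau u ord0 - QIform x u - l * a))
  +i* (s * (thetat u ord0 + QRform x u)).
Proof.
move=> hu; rewrite /frame_wedge big_ord_recl.
rewrite (Y0_slice hu) Y0_Vfield// zc_Vfield hu.1 zp0.
rewrite (eq_bigr (fun i : 'I_n => 'i%C * s%:C *
   ((x.1 ord0 i * thetat u (lift ord0 i) - x.2 ord0 i * thetau u (lift ord0 i)) +i*
    (x.1 ord0 i * thetau u (lift ord0 i) + x.2 ord0 i * thetat u (lift ord0 i)))));
  last first.
  move=> i _; rewrite Yi_Vfield ?lift0F// zc_Vfield zpi Yi_E mulr0 subr0.
  by apply/eqP; rewrite eq_complex /=; apply/andP; split; apply/eqP => /=; ring.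
rewrite -mulr_sumr.
have -> : \sum_(i < n)
   ((x.1 ord0 i * thetat u (lift ord0 i) - x.2 ord0 i * thetau u (lift ord0 i)) +i*
    (x.1 ord0 i * thetau u (lift ord0 i) + x.2 ord0 i * thetat u (lift ord0 i))) =
    QRform x u +i* QIform x u.
  by apply/eqP; rewrite eq_complex (big_morph _ (@cReD R) (erefl (cRe 0)))
    (big_morph _ (@cImD R) (erefl (cIm 0))) /= !eqxx.
by apply/eqP; rewrite eq_complex /=; apply/andP; split; apply/eqP => /=; ring.
Qed.

(** The contractions of [omega_2] and [omega_1] with [X] are the imaginary and
    real parts of one complex form, in which the fibre coordinates appear
    through [\sum_i X^i W_i] with [X^0 = 1]. *)
Lemma omega2_X l dx u : slice_tangent l dx u ->
  2^-1 * (2 * pi * omega2 Om p (Xfield p) u) = s * (thetat u ord0 + QRform x u).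
Proof.
move=> hu; rewrite (omega2E OmP OmN s1') XfieldE frame_wedgePl (frame_wedge_V hu) /=.
have : pi != 0 :> R by rewrite lt0r_neq0// pi_gt0.
by move: (@pi R) => q q0; field.
Qed.

Lemma omega1_X l dx u : slice_tangent l dx u ->
  2^-1 * (2 * pi * omega1 Om p (Xfield p) u) =
  s * ((1 + v) * thetau u ord0 - QIform x u - l * a).
Proof.
move=> hu; rewrite (omega1E OmP OmN s1') XfieldE frame_wedgePl (frame_wedge_V hu) /=.
have : pi != 0 :> R by rewrite lt0r_neq0// pi_gt0.
by move: (@pi R) => q q0; field.
Qed.

Definition epsinst : R := (2 * pi)^-1 * (1 + v)^-1 * a.

Lemma eta_inst_slice l dx u : slice_tangent l dx u ->
  eta_inst Om p u = - ((4 * pi ^+ 2)^-1 * (1 + v)^-1 * a * thetat u ord0).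
Proof.
move=> hu; rewrite /eta_inst (eta_inst_sum OmP OmN _ s1') (dargz_slice hu).
by rewrite (gN_V_slice hu) (gM_V_slice hu); ring.
Qed.

Lemma fham1_slice c : fham1 Om c p = - (2 * pi * (s ^+ 2 * (1 - normX2 x))) - c
  + binst m p - 4 * pi * (v * s ^+ 2) - pi^-1 * (1 + v)^-1 * a ^+ 2.
Proof.
rewrite /fham1 /eta_inst (eta_inst_sum OmP OmN _ s1') dargz_Vfield// gN_VV gM_VV.
rewrite r2_slice; have : pi != 0 :> R by rewrite lt0r_neq0// pi_gt0.
by move: (@pi R) (binst m p) (normX2 x) T0 a => q b N T0' a' q0; field; rewrite T0' q0.
Qed.

Hypothesis Nlt1 : normX2 x < 1.

Lemma etaP_slice l dx (P U : coverP R n) : P.1 = p -> slice_tangent l dx U.1 ->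
  etaP Om P U = U.2 - (4 * pi)^-1 * theta_dtheta p U.1 - pi * s ^+ 2 * Fform x dx
    - epsinst * thetat U.1 ord0.
Proof.
move=> Pp hu; rewrite /etaP Pp (eta_inst_slice hu) /etatilde (gM_V_slice hu).
have r0 : r2 p != 0.
  by rewrite r2_slice mulf_neq0// ?expf_neq0 ?subr_eq0 ?gt_eqF// (lt_le_trans ltr01 s1).
rewrite (mulrA (2^-1 * r2 p)) (mulfK r0) /epsinst.
have : pi != 0 :> R by rewrite lt0r_neq0// pi_gt0.
by move: (@pi R) T0 a => q T0' a' q0; field; rewrite T0' q0.
Qed.

Lemma theta1_slice l dx (P U : coverP R n) c : P.1 = p -> slice_tangent l dx U.1 ->
  thetaP Om c (Ordinal (isT : 1 < 4)%N) P U =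
  U.2 - (4 * pi)^-1 * theta_dtheta p U.1 + pi * s ^+ 2 * Fform x dx.
Proof.
move=> Pp hu; rewrite /thetaP /= (etaP_slice Pp hu) Pp gN_Xl (gN_V_slice hu) /epsinst.
have : pi != 0 :> R by rewrite lt0r_neq0// pi_gt0.
by move: (@pi R) T0 a => q T0' a' q0; field; rewrite T0' q0.
Qed.

Lemma theta0_slice c (P U : coverP R n) : P.1 = p ->
  thetaP Om c ord0 P U = - 2^-1 * 'D_(U.1) (fham Om c) p.
Proof. by move=> <-. Qed.

Lemma theta2_slice l dx (P U : coverP R n) c : P.1 = p -> slice_tangent l dx U.1 ->
  thetaP Om c (Ordinal (isT : 2 < 4)%N) P U = s * (thetat U.1 ord0 + QRform x U.1).
Proof. by move=> Pp hu; rewrite -(omega2_X hu) -Pp. Qed.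

Lemma theta3_slice l dx (P U : coverP R n) c : P.1 = p -> slice_tangent l dx U.1 ->
  thetaP Om c (Ordinal (isT : 3 < 4)%N) P U =
  - (s * ((1 + v) * thetau U.1 ord0 - QIform x U.1 - l * a)).
Proof. by move=> Pp hu; rewrite -(omega1_X hu) -Pp -mulNr. Qed.

(** The connection form of the circle bundle to which both [eta] and [theta_1]
    add horizontal terms. *)
Definition connform (U : coverP R n) : R := U.2 - (4 * pi)^-1 * theta_dtheta p U.1.

(** The contractions above, assembled.  On the slice [d arg z^0] is zero, so
    the instanton series enter only through [v], [a], [f], [f_1] and the
    derivative of [f]. *)
Lemma gtotP_slice c l dx l' dx' (P U W : coverP R n) : P.1 = p ->
  slice_tangent l dx U.1 -> slice_tangent l' dx' W.1 ->
  gtotP Om c P U W = - (fham Om c p)^-1 *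
    (2 / fham1 Om c p *
      ((connform U - pi * s ^+ 2 * Fform x dx - epsinst * thetat U.1 ord0) *
       (connform W - pi * s ^+ 2 * Fform x dx' - epsinst * thetat W.1 ord0))
     + 2 * pi * gN Om p U.1 W.1
     - 2 / fham Om c p *
       (4^-1 * ('D_(U.1) (fham Om c) p * 'D_(W.1) (fham Om c) p)
        + (connform U + pi * s ^+ 2 * Fform x dx)
          * (connform W + pi * s ^+ 2 * Fform x dx')
        + s * (thetat U.1 ord0 + QRform x U.1) * (s * (thetat W.1 ord0 + QRform x W.1))
        + s * ((1 + v) * thetau U.1 ord0 - QIform x U.1 - l * a)
          * (s * ((1 + v) * thetau W.1 ord0 - QIform x W.1 - l' * a)))).
Proof.
move=> Pp hU hW; rewrite /gtotP /gP Pp (etaP_slice Pp hU) (etaP_slice Pp hW).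
rewrite 4!big_ord_recl big_ord0 addr0.
have -> : lift ord0 ord0 = Ordinal (isT : 1 < 4)%N :> 'I_4 by exact: val_inj.
have -> : lift ord0 (lift ord0 ord0) = Ordinal (isT : 2 < 4)%N :> 'I_4
  by exact: val_inj.
have -> : lift ord0 (lift ord0 (lift ord0 ord0)) = Ordinal (isT : 3 < 4)%N :> 'I_4
  by exact: val_inj.
rewrite (theta1_slice _ Pp hU) (theta1_slice _ Pp hW).
rewrite (theta2_slice _ Pp hU) (theta2_slice _ Pp hW).
rewrite (theta3_slice _ Pp hU) (theta3_slice _ Pp hW).
rewrite !(theta0_slice _ _ Pp) -!/(connform _).
congr (_ * (_ + _ - _ * _)).
move: ('D_(U.1) _ p) ('D_(W.1) _ p) (connform U) (connform W) => d1 d2 k1 k2.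
move: (s * (thetat _ _ + _)) (s * (thetat _ _ + _)) => g1 g2.
move: (s * ((1 + v) * _ - _ - _)) (s * ((1 + v) * _ - _ - _)) => g3 g4.
by field.
Qed.

End OnSlice.
End Slice.

(** * Directional derivatives along lines *)

Section LineDerivatives.
Context {R : realType}.

Lemma is_derive_line (V W : normedModType R) (f : V -> W) (x v : V) (df : W) :
  is_derive (0 : R) 1 (fun h : R => f (h *: v + x)) df -> is_derive x v f df.
Proof.
move=> [d e]; have eg : (fun h : R => h^-1 *: (f (h *: v + x) - f x)) =
    (fun h : R => h^-1 *: (f ((h *: (1 : R) + 0) *: v + x) - f (0 *: v + x))).
  by apply/funext => h; rewrite addr0 scale0r add0r [_ *: 1]mulr1.
by apply: DeriveDef; rewrite ?/derivable ?/derive eg.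
Qed.

Lemma is_derive_pair (V W : normedModType R) (f : R -> V) (g : R -> W) (x : R)
    (df : V) (dg : W) :
  is_derive x 1 f df -> is_derive x 1 g dg ->
  is_derive x 1 (fun h => (f h, g h)) (df, dg).
Proof.
move=> [f1 f2] [g1 g2].
have h : h^-1 *: ((f (h *: (1 : R) + x), g (h *: (1 : R) + x)) - (f x, g x))
    @[h --> 0^'] --> (df, dg).
  by apply: cvg_pair => /=; rewrite -?f2 -?g2; [exact: f1|exact: g1].
apply: DeriveDef; last exact: cvg_lim h.
by apply/cvg_ex; exists (df, dg).
Qed.

Lemma is_derive_mx m n (M : R -> 'M[R]_(m, n)) (x : R) (dM : 'M[R]_(m, n)) :
  (forall i j, is_derive x 1 (fun h => M h i j) (dM i j)) -> is_derive x 1 M dM.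
Proof.
move=> h; have dM' : derivable M x 1.
  by apply/derivable_mxP => i j; have [] := h i j.
apply: DeriveDef => //; rewrite derive_mx//.
by apply/matrixP => i j; rewrite mxE derive_val.
Qed.

End LineDerivatives.

(** * The slice in the coordinates rho, X, theta, sigma *)

Section Embedding.
Local Open Scope complex_scope.
Context {R : realType} {n : nat}.
Local Notation C := R[i].
Local Notation T := (cotM R n).
Local Notation CX := (coordX R n).
Local Notation Q := (coordN R n).
Implicit Types (x dx : CX) (q u : Q).

(** [d log z^0], by logarithmic differentiation of
    [(z^0)^2 = (rho + c) / (2 pi (1 - |X|^2))]. *)
Definition dlogz0 c q u : R :=
  rhoC u / (2 * (rhoC q + c)) + Eform (XC q) (XC u) / (1 - normX2 (XC q)).

Definition dXhom dx (i : 'I_n.+1) : C :=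
  if unlift ord0 i is Some j then Xcoord dx j else 0.

Definition dembN c q u : coverP R n :=
  (\matrix_(a, i) match val a with
     | 0%N => z0C c q * (dlogz0 c q u * cRe (Xhom (XC q) i) + cRe (dXhom (XC u) i))
     | 1%N => z0C c q * (dlogz0 c q u * cIm (Xhom (XC q) i) + cIm (dXhom (XC u) i))
     | 2%N => (thC u).1 ord0 i
     | _ => (thC u).2 ord0 i
     end, sigC u).

Lemma EformC x dx : Eform x dx = Eform dx x.
Proof. by apply: eq_bigr => i _; ring. Qed.

Lemma EformPr (a : R) x dx dx' : Eform x (a *: dx + dx') = a * Eform x dx + Eform x dx'.
Proof.
by rewrite /Eform mulr_sumr -big_split; apply: eq_bigr => i _; rewrite !mxE /=; ring.
Qed.

Lemma normX2_line x dx (h : R) :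
  normX2 (h *: dx + x) = normX2 x + 2 * h * Eform x dx + h ^+ 2 * normX2 dx.
Proof.
by rewrite !normX2E EformPr ![Eform (h *: dx + x) _]EformC !EformPr (EformC dx x); ring.
Qed.

Section AtPoint.
Variables (c : R) (q : Q).
Hypothesis Nlt1 : normX2 (XC q) < 1.
Hypothesis rc0 : 0 < rhoC q + c.

Lemma z0C_gt0 : 0 < z0C c q.
Proof.
by rewrite sqrtr_gt0 divr_gt0// mulr_gt0 ?subr_gt0// mulr_gt0// pi_gt0.
Qed.

Lemma z0C_sqr : z0C c q ^+ 2 = (rhoC q + c) / (2 * pi * (1 - normX2 (XC q))).
Proof.
by rewrite sqr_sqrtr//; have := z0C_gt0; rewrite sqrtr_gt0 => /ltW.
Qed.

Lemma is_derive_z0C u : is_derive (0 : R) 1 (fun h : R => z0C c (h *: u + q))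
  (z0C c q * dlogz0 c q u).
Proof.
pose y (h : R) := 1 - (normX2 (XC q) + 2 * h * Eform (XC q) (XC u) + h ^+ 2 * normX2 (XC u)).
pose g (h : R) := (h * rhoC u + rhoC q + c) / (2 * pi * y h).
have -> : (fun h : R => z0C c (h *: u + q)) = Num.sqrt \o g.
  apply/funext => h; rewrite /z0C /g /y /=.
  by rewrite (_ : XC (h *: u + q) = h *: XC u + XC q)// normX2_line.
have y0 : y 0 = 1 - normX2 (XC q) by rewrite /y mulr0 mul0r expr0n/= mul0r !addr0.
have p0 := @pi_gt0 R.
have Y0 : 0 < 1 - normX2 (XC q) by rewrite subr_gt0.
have pyN : 2 * pi * y 0 != 0 by rewrite y0 !mulf_neq0// lt0r_neq0.
have g0 : g 0 = z0C c q ^+ 2 by rewrite z0C_sqr /g y0 mul0r add0r.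
have g0_gt0 : 0 < g 0 by rewrite g0 exprn_gt0// z0C_gt0.
have dg : is_derive (0 : R) 1 g (2 * z0C c q ^+ 2 * dlogz0 c q u).
  have dy : is_derive (0 : R) 1 (fun h => 2 * pi * y h)
      (- (4 * pi * Eform (XC q) (XC u))).
    rewrite /y; apply: is_derive_eq; rewrite /GRing.scale/=; ring.
  have dV := @is_deriveV R (fun h => 2 * pi * y h) 0 _ 1 pyN dy.
  rewrite /g; apply: is_derive_eq; rewrite /GRing.scale/= /dlogz0 z0C_sqr y0.
  have rn : rhoC q + c != 0 by exact: lt0r_neq0.
  have Yn : 1 - normX2 (XC q) != 0 by exact: lt0r_neq0.
  have pn : pi != 0 :> R by exact: lt0r_neq0.
  move: (@pi R) (normX2 _) pn Yn => P N pn Yn.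
  by field; rewrite pn Yn rn.
have ds := is_derive1_sqrt g0_gt0.
apply: (is_derive_eq (is_derive1_comp ds dg)).
rewrite g0 sqrtr_sqr gtr0_norm ?z0C_gt0//.
have zn : z0C c q != 0 by rewrite lt0r_neq0// z0C_gt0.
by field.
Qed.

Lemma Xhom_line u (h : R) i :
  Xhom (h *: XC u + XC q) i = Xhom (XC q) i + h%:C * dXhom (XC u) i.
Proof.
rewrite /Xhom /dXhom; case: (unlift ord0 i) => [j|]; last by rewrite mulr0 addr0.
apply/eqP; rewrite eq_complex /= !mxE /= !mul0r subr0 addr0.
by rewrite ![h * _ + _]addrC !eqxx.
Qed.

Lemma derive_embN u : 'D_u (embN c) q = dembN c q u.
Proof.
suff h : is_derive q u (embN c) (dembN c q u) by rewrite derive_val.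
apply: is_derive_line; apply: is_derive_pair; last first.
  have -> : (fun h : R => sigC (h *: u + q)) = (fun h => h * sigC u + sigC q) by [].
  by apply: is_derive_eq; rewrite /GRing.scale/=; ring.
have dz := is_derive_z0C u.
apply: is_derive_mx => -[[|[|[|[|]]]] ha] i //; rewrite mxE /=;
  (under eq_fun do rewrite mxE /=).
- have dX : is_derive (0 : R) 1 (fun h : R => cRe (Xhom (XC (h *: u + q)) i))
      (cRe (dXhom (XC u) i)).
    have -> : (fun h : R => cRe (Xhom (XC (h *: u + q)) i)) =
        (fun h => cRe (Xhom (XC q) i) + h * cRe (dXhom (XC u) i)).
      by apply/funext => h; rewrite -cReZ -cReD -Xhom_line.
    by apply: is_derive_eq; rewrite /GRing.scale/=; ring.
  apply: is_derive_eq; rewrite scale0r add0r /GRing.scale/=; ring.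
- have dX : is_derive (0 : R) 1 (fun h : R => cIm (Xhom (XC (h *: u + q)) i))
      (cIm (dXhom (XC u) i)).
    have -> : (fun h : R => cIm (Xhom (XC (h *: u + q)) i)) =
        (fun h => cIm (Xhom (XC q) i) + h * cIm (dXhom (XC u) i)).
      by apply/funext => h; rewrite -cImZ -cImD -Xhom_line.
    by apply: is_derive_eq; rewrite /GRing.scale/=; ring.
  apply: is_derive_eq; rewrite scale0r add0r /GRing.scale/=; ring.
- have -> : (fun h : R => (thC (h *: u + q)).1 ord0 i) =
      (fun h => h * (thC u).1 ord0 i + (thC q).1 ord0 i).
    by apply/funext => h; rewrite !mxE.
  by apply: is_derive_eq; rewrite /GRing.scale/=; ring.
- have -> : (fun h : R => (thC (h *: u + q)).2 ord0 i) =
      (fun h => h * (thC u).2 ord0 i + (thC q).2 ord0 i).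
    by apply/funext => h; rewrite !mxE.
  by apply: is_derive_eq; rewrite /GRing.scale/=; ring.
Qed.

Lemma zc_embN0 : zc (embN c q).1 ord0 = (z0C c q)%:C.
Proof.
by rewrite /zc /blk !mxE !val_inord4//= /Xhom unlift_none /= mulr1 mulr0.
Qed.

Lemma zc_embNi i : zc (embN c q).1 (lift ord0 i) = (z0C c q)%:C * Xcoord (XC q) i.
Proof.
rewrite /zc /blk !mxE !val_inord4//= /Xhom liftK.
by apply/eqP; rewrite eq_complex /= !mul0r subr0 addr0 !eqxx.
Qed.

Lemma slice_tangent_dembN u :
  slice_tangent (z0C c q) (XC q) (dlogz0 c q u) (XC u) (dembN c q u).1.
Proof.
split=> [|i]; rewrite /zc /blk !mxE !val_inord4//= /Xhom /dXhom ?liftK ?unlift_none /=.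
  by rewrite mulr1 mulr0 !addr0 mulr0.
by apply/eqP; rewrite eq_complex /=; apply/andP; split; apply/eqP => /=; ring.
Qed.

Lemma thetat_embN i : thetat (embN c q).1 i = (thC q).1 ord0 i.
Proof. by rewrite /thetat /blk !mxE !val_inord4. Qed.

Lemma thetau_embN i : thetau (embN c q).1 i = (thC q).2 ord0 i.
Proof. by rewrite /thetau /blk !mxE !val_inord4. Qed.

Lemma thetat_dembN u i : thetat (dembN c q u).1 i = (thC u).1 ord0 i.
Proof. by rewrite /thetat /blk !mxE !val_inord4. Qed.

Lemma thetau_dembN u i : thetau (dembN c q u).1 i = (thC u).2 ord0 i.
Proof. by rewrite /thetau /blk !mxE !val_inord4. Qed.

Lemma gMPl (a : R) (u v w : T) : gM (a *: u + v) w = a * gM u w + gM v w.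
Proof.
rewrite !gME mulr_sumr -big_split; apply: eq_bigr => i _.
by rewrite zcP mulrDl -mulrA cReD cReZ /=; ring.
Qed.

Lemma gM_sym (u v : T) : gM u v = gM v u.
Proof.
rewrite !gME; apply: eq_bigr => i _; congr (_ * _).
by case: (zc u i) (zc v i) => a b [a' b'] /=; ring.
Qed.

Variables (Om : latvec n -> int) (m : int).
Hypothesis OmP : Om (ddy ord0) = m.
Hypothesis OmN : Om (- ddy ord0) = m.
Hypothesis s2 : 2 <= z0C c q.

Lemma r2_embN : 2 * pi * r2 (embN c q).1 = rhoC q + c.
Proof.
rewrite (r2_slice zc_embN0 zc_embNi) z0C_sqr.
have Yn : 1 - normX2 (XC q) != 0 by rewrite lt0r_neq0// subr_gt0.
have : pi != 0 :> R by rewrite lt0r_neq0// pi_gt0.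
by move: (@pi R) (normX2 _) Yn => P N Yn P0; field; rewrite P0 Yn.
Qed.

(** On the slice and along its tangent vectors [z^0] stays real.  Near the point
    [|z^0|] is therefore affine on the line, and [r^2] is a quadratic
    polynomial, so that only [instB] needs to be differentiated. *)
Lemma derive_fham u : 'D_((dembN c q u).1) (fham Om c) (embN c q).1 =
  rhoC u - 2 * m%:~R / pi *
    (z0C c q * dlogz0 c q u * instBs (z0C c q) ((thC q).2 ord0 ord0)
     - (thC u).2 ord0 ord0 * instS (z0C c q) ((thC q).2 ord0 ord0)).
Proof.
set p := (embN c q).1; set w := (dembN c q u).1; set s := z0C c q.
set l := dlogz0 c q u; set t := (thC q).2 ord0 ord0; set dt := (thC u).2 ord0 ord0.
have s0 : 0 < s := z0C_gt0.
have s2s : 2 <= s := s2.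
pose F (h : R) := 2 * pi * (r2 p + 2 * h * gM p w + h ^+ 2 * gM w w) - c
  + - (2 * m%:~R / pi) * instB (s + h * (s * l)) (t + h * dt).
have dgM : 4 * pi * gM p w = rhoC u.
  have hp : slice_tangent s (XC q) 1 0 p.
    split=> [|i]; first by rewrite zc_embN0 mulr1.
    by rewrite zc_embNi mulr1 (_ : Xcoord 0 i = 0) ?mulr0 ?addr0// /Xcoord !mxE.
  rewrite (gM_slice hp (slice_tangent_dembN u)).
  have E0 y : Eform y 0 = 0 by rewrite /Eform big1// => i _; rewrite !mxE; ring.
  rewrite E0 (EformC 0) E0 z0C_sqr /dlogz0.
  have Yn : 1 - normX2 (XC q) != 0 by rewrite lt0r_neq0// subr_gt0.
  have rn : rhoC q + c != 0 by exact: lt0r_neq0.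
  have : pi != 0 :> R by rewrite lt0r_neq0// pi_gt0.
  by move: (@pi R) (normX2 _) Yn => P N Yn P0; field; rewrite P0 Yn rn.
have dF : is_derive (0 : R) 1 F (rhoC u - 2 * m%:~R / pi *
    (s * l * instBs s t - dt * instS s t)).
  have dB := is_derive_instB t (s * l) dt s2.
  rewrite /F; apply: is_derive_eq; rewrite /GRing.scale/= -dgM; ring.
have near_eq : {near (0 : R), F =1 (fun h : R => fham Om c (h *: w + p))}.
  near=> h.
  have hs : `|h * (s * l)| <= 1.
    have hd : `|h| <= (`|s * l| + 1)^-1.
      by near: h; apply: (@nbhs0_le R R); rewrite invr_gt0 ltr_wpDl.
    rewrite normrM (le_trans (ler_wpM2r (normr_ge0 _) hd))//.
    by rewrite ler_pdivrMl ?ltr_wpDl// mulr1 lerDl.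
  have hz : zc (h *: w + p) ord0 = (s + h * (s * l))%:C.
    rewrite zcP (slice_tangent_dembN u).1 zc_embN0 -/s -/l.
    by apply/eqP; rewrite eq_complex /=; apply/andP; split; apply/eqP => /=; ring.
  have sh : 1 <= s + h * (s * l) by move: hs; rewrite ler_norml => /andP[]; lra.
  have zh : zabs (h *: w + p) = s + h * (s * l).
    by rewrite /zabs hz /= expr0n/= addr0 sqrtr_sqr ger0_norm//; lra.
  rewrite (fhamE OmP OmN); last by rewrite zh.
  rewrite /binst zh thetauP thetau_dembN thetau_embN -/t -/dt [h * dt + t]addrC.
  rewrite !r2E gMPl ![gM _ (h *: w + p)]gM_sym !gMPl (gM_sym w p) /F r2E.
  by ring.
suff h : is_derive p w (fham Om c) (rhoC u - 2 * m%:~R / pi *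
    (s * l * instBs s t - dt * instS s t)) by rewrite derive_val.
apply: is_derive_line.
apply: near_eq_is_derive near_eq dF.
Unshelve. all: by end_near. Qed.

End AtPoint.
End Embedding.

(** * The explicit metric *)

Section ExplicitMetric.
Local Open Scope complex_scope.
Context {R : realType} {n : nat}.
Local Notation C := R[i].
Local Notation T := (cotM R n).
Local Notation CX := (coordX R n).
Local Notation Q := (coordN R n).
Implicit Types (x dx : CX) (q u w : Q).

(** The metric in terms of the values that finitely many linear forms take on
    two tangent vectors (first and second group of nine arguments) and of the
    two products [G], [W].  This makes its comparison with other metrics, its
    symmetries and its positivity questions about real numbers. *)
Definition qkform (P f f1 y s v a e : R)
    (l1 r1 E1 F1 D1 t1 u1 A1 B1 l2 r2 E2 F2 D2 t2 u2 A2 B2 G W : R) : R :=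
  - f^-1 *
    (2 / f1 * ((D1 - P * s ^+ 2 * F1 - e * t1) * (D2 - P * s ^+ 2 * F2 - e * t2))
     + 2 * P * (s ^+ 2 * (l1 * l2 * (y + v) - l1 * E2 - l2 * E1 - G)
        + (4 * P ^+ 2)^-1 * ((1 + v)^-1 * (t1 * t2) + (1 + v) * (u1 * u2) - W))
     - 2 / f * (4^-1 * (r1 * r2)
        + (D1 + P * s ^+ 2 * F1) * (D2 + P * s ^+ 2 * F2)
        + s * (t1 + A1) * (s * (t2 + A2))
        + s * ((1 + v) * u1 - B1 - l1 * a) * (s * ((1 + v) * u2 - B2 - l2 * a)))).

Definition Wsum (u w : Q) : R := \sum_(i < n)
  ((thC u).1 ord0 (lift ord0 i) * (thC w).1 ord0 (lift ord0 i)
   + (thC u).2 ord0 (lift ord0 i) * (thC w).2 ord0 (lift ord0 i)).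
Definition QRsum x (u : Q) : R := \sum_(i < n)
  (x.1 ord0 i * (thC u).1 ord0 (lift ord0 i) - x.2 ord0 i * (thC u).2 ord0 (lift ord0 i)).
Definition QIsum x (u : Q) : R := \sum_(i < n)
  (x.1 ord0 i * (thC u).2 ord0 (lift ord0 i) + x.2 ord0 i * (thC u).1 ord0 (lift ord0 i)).

Definition dsigform q u : R := sigC u - (4 * pi)^-1 * pair_theta (thC q) (thC u).

Section Coefficients.
Variables (m : int) (c : R) (q : Q).
Let s := z0C c q.
Let t := (thC q).2 ord0 ord0.

Definition vinstq : R := m%:~R / pi * instV s t.
Definition ainstq : R := 2 * m%:~R * instS s t.
Definition binstq : R := - (2 * m%:~R / pi) * instB s t.
Definition dbinstq : R := - (2 * m%:~R / pi) * instBs s t.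
Definition epsinstq : R := (2 * pi)^-1 * (1 + vinstq)^-1 * ainstq.
Definition fhamq : R := rhoC q + binstq.
Definition fham1q : R :=
  - (rhoC q + 2 * c) + binstq - 4 * pi * (vinstq * s ^+ 2) - pi^-1 * (1 + vinstq)^-1 * ainstq ^+ 2.
Definition dfhamq (u : Q) : R :=
  rhoC u + pi^-1 * ainstq * (thC u).2 ord0 ord0 + dbinstq * (s * dlogz0 c q u).

Definition slice_metric (u w : Q) : R :=
  qkform pi fhamq fham1q (1 - normX2 (XC q)) s vinstq ainstq epsinstq
   (dlogz0 c q u) (dfhamq u) (Eform (XC q) (XC u)) (Fform (XC q) (XC u)) (dsigform q u)
   ((thC u).1 ord0 ord0) ((thC u).2 ord0 ord0) (QRsum (XC q) u) (QIsum (XC q) u)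
   (dlogz0 c q w) (dfhamq w) (Eform (XC q) (XC w)) (Fform (XC q) (XC w)) (dsigform q w)
   ((thC w).1 ord0 ord0) ((thC w).2 ord0 ord0) (QRsum (XC q) w) (QIsum (XC q) w)
   (Eform (XC u) (XC w)) (Wsum u w).

End Coefficients.

Section Explicit.
Variables (Om : latvec n -> int) (m : int) (c : R) (q : Q).
Hypothesis OmP : Om (ddy ord0) = m.
Hypothesis OmN : Om (- ddy ord0) = m.
Hypothesis Nlt1 : normX2 (XC q) < 1.
Hypothesis rc0 : 0 < rhoC q + c.
Hypothesis s2 : 2 <= z0C c q.
Hypothesis T0 : 1 + vinstq m c q != 0.

Let p := (embN c q).1.
Let zp0 := zc_embN0 c q.
Let zpi := zc_embNi c q.
Let s1 : 1 <= z0C c q. Proof. by rewrite (le_trans _ s2)// ler1n. Qed.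

Let zabsp : zabs p = z0C c q.
Proof. exact: zabs_slice zp0 s1. Qed.

Lemma vinst_embN : vinst m p = vinstq m c q.
Proof. by rewrite /vinst zabsp thetau_embN. Qed.

Lemma ainst_embN : ainst m p = ainstq m c q.
Proof. by rewrite /ainst zabsp thetau_embN. Qed.

Lemma binst_embN : binst m p = binstq m c q.
Proof. by rewrite /binst zabsp thetau_embN. Qed.

Let T0p : 1 + vinst m p != 0.
Proof. by rewrite vinst_embN. Qed.

Lemma fham_embN : fham Om c p = fhamq m c q.
Proof.
have s1p : 1 <= zabs p by rewrite zabsp.
have r2p : 2 * pi * r2 p = rhoC q + c := r2_embN Nlt1 rc0.
by rewrite (fhamE OmP OmN s1p) r2p binst_embN /fhamq; ring.
Qed.

Lemma fham1_embN : fham1 Om c p = fham1q m c q.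
Proof.
rewrite (fham1_slice zp0 zpi s1 OmP OmN T0p) vinst_embN ainst_embN binst_embN.
have r2p : 2 * pi * r2 p = rhoC q + c := r2_embN Nlt1 rc0.
by rewrite -(r2_slice zp0 zpi) r2p /fham1q; ring.
Qed.

Lemma gN_XX_embN : gN Om p (Xfield p) (Xfield p) =
  4 * (z0C c q ^+ 2 * (1 - normX2 (XC q) + vinstq m c q)
       + (4 * pi ^+ 2)^-1 * (1 + vinstq m c q)^-1 * ainstq m c q ^+ 2).
Proof.
rewrite (gN_XX zp0 s1 OmP OmN T0p) (gN_VV zp0 zpi s1 OmP OmN T0p).
by rewrite vinst_embN ainst_embN.
Qed.

Lemma gNbarE u w : gNbar Om c q u w = slice_metric m c q u w.
Proof.
rewrite /gNbar !derive_embN//.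
have hu := slice_tangent_dembN c q u; have hw := slice_tangent_dembN c q w.
rewrite (gtotP_slice zp0 zpi s1 OmP OmN T0p Nlt1 c erefl hu hw).
rewrite fham_embN fham1_embN (gN_slice zp0 s1 OmP OmN T0p hu hw).
rewrite !(derive_fham Nlt1 rc0 OmP OmN s2).
rewrite /epsinst vinst_embN ainst_embN.
have th (U : Q) : connform p (dembN c q U) = dsigform q U.
  rewrite /connform /dsigform /theta_dtheta /pair_theta; congr (_ - _ * _).
  by apply: eq_bigr => i _; rewrite thetat_embN thetau_embN thetat_dembN thetau_dembN.
have hW : Wform (dembN c q u).1 (dembN c q w).1 = Wsum u w.
  by apply: eq_bigr => i _; rewrite !thetat_dembN !thetau_dembN.
have hQR (U : Q) : QRform (XC q) (dembN c q U).1 = QRsum (XC q) U.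
  by apply: eq_bigr => i _; rewrite !thetat_dembN !thetau_dembN.
have hQI (U : Q) : QIform (XC q) (dembN c q U).1 = QIsum (XC q) U.
  by apply: eq_bigr => i _; rewrite !thetat_dembN !thetau_dembN.
have hr (U : Q) : rhoC U - 2 * m%:~R / pi *
    (z0C c q * dlogz0 c q U * instBs (z0C c q) ((thC q).2 ord0 ord0)
     - (thC U).2 ord0 ord0 * instS (z0C c q) ((thC q).2 ord0 ord0)) = dfhamq m c q U.
  by rewrite /dfhamq /dbinstq /ainstq; ring.
by rewrite !hr !th hW !hQR !hQI !thetat_dembN !thetau_dembN.
Qed.

End Explicit.

Section Algebra.
Variables (m : int) (c : R) (q : Q).

Lemma FformPr (b : R) x dx dx' : Fform x (b *: dx + dx') = b * Fform x dx + Fform x dx'.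
Proof.
by rewrite /Fform mulr_sumr -big_split; apply: eq_bigr => i _; rewrite !mxE /=; ring.
Qed.

Lemma WsumC u w : Wsum u w = Wsum w u.
Proof. by apply: eq_bigr => i _; ring. Qed.

Lemma slice_metric_sym u w : slice_metric m c q u w = slice_metric m c q w u.
Proof. rewrite /slice_metric WsumC (EformC (XC u)) /qkform; ring. Qed.

Lemma slice_metricPl (b : R) u u' w :
  slice_metric m c q (b *: u + u') w = b * slice_metric m c q u w + slice_metric m c q u' w.
Proof.
have hE (y : CX) : Eform y (XC (b *: u + u')) = b * Eform y (XC u) + Eform y (XC u').
  exact: EformPr.
have hl : dlogz0 c q (b *: u + u') = b * dlogz0 c q u + dlogz0 c q u'.
  by rewrite /dlogz0 hE (_ : rhoC (b *: u + u') = b * rhoC u + rhoC u')//; ring.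
have h1 i : (thC (b *: u + u')).1 ord0 i = b * (thC u).1 ord0 i + (thC u').1 ord0 i.
  by rewrite !mxE.
have h2 i : (thC (b *: u + u')).2 ord0 i = b * (thC u).2 ord0 i + (thC u').2 ord0 i.
  by rewrite !mxE.
have hr : dfhamq m c q (b *: u + u') = b * dfhamq m c q u + dfhamq m c q u'.
  rewrite /dfhamq hl h2 (_ : rhoC (b *: u + u') = b * rhoC u + rhoC u')//; ring.
have hF : Fform (XC q) (XC (b *: u + u')) =
  b * Fform (XC q) (XC u) + Fform (XC q) (XC u') by exact: FformPr.
have hD : dsigform q (b *: u + u') = b * dsigform q u + dsigform q u'.
  rewrite /dsigform.
  have -> : pair_theta (thC q) (thC (b *: u + u')) =
      b * pair_theta (thC q) (thC u) + pair_theta (thC q) (thC u').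
    rewrite /pair_theta mulr_sumr -big_split; apply: eq_bigr => i _.
    by rewrite h1 h2 /=; ring.
  by rewrite (_ : sigC (b *: u + u') = b * sigC u + sigC u')//; ring.
have hA : QRsum (XC q) (b *: u + u') = b * QRsum (XC q) u + QRsum (XC q) u'.
  rewrite /QRsum mulr_sumr -big_split; apply: eq_bigr => i _.
  by rewrite h1 h2 /=; ring.
have hB : QIsum (XC q) (b *: u + u') = b * QIsum (XC q) u + QIsum (XC q) u'.
  rewrite /QIsum mulr_sumr -big_split; apply: eq_bigr => i _.
  by rewrite h1 h2 /=; ring.
have hW : Wsum (b *: u + u') w = b * Wsum u w + Wsum u' w.
  rewrite /Wsum mulr_sumr -big_split; apply: eq_bigr => i _.
  by rewrite h1 h2 /=; ring.
have hG : Eform (XC (b *: u + u')) (XC w) = b * Eform (XC u) (XC w) + Eform (XC u') (XC w).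
  by rewrite !(EformC _ (XC w)) hE.
rewrite /slice_metric hE hl h1 h2 hr hF hD hA hB hW hG /qkform; ring.
Qed.

End Algebra.
End ExplicitMetric.

(** * Deck transformations *)

Section DeckInvariance.
Context {R : realType} {n : nat}.
Local Notation Q := (coordN R n).

Lemma periodic_intmul (f : R -> R) (T x : R) (z : int) :
  periodic f T -> f (x + T * z%:~R) = f x.
Proof.
move=> fT; case: z => j.
  by rewrite -[LHS]/(f (x + T * j%:R)) mulr_natr (periodicn fT).
rewrite NegzE rmorphN mulrN /= -[LHS](periodicn fT j.+1) -mulr_natr.
by rewrite subrK.
Qed.

Lemma cos_shift (t : R) (k : nat) (z : int) :
  cos (k%:R * (t + 2 * pi * z%:~R)) = cos (k%:R * t).
Proof.
rewrite -(periodic_intmul (k%:R * t) (k%:Z * z) (@cosD2pi R)) rmorphM /=.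
by congr (cos _); rewrite -mulr_natl; ring.
Qed.

Lemma sin_shift (t : R) (k : nat) (z : int) :
  sin (k%:R * (t + 2 * pi * z%:~R)) = sin (k%:R * t).
Proof.
rewrite -(periodic_intmul (k%:R * t) (k%:Z * z) (@sinD2pi R)) rmorphM /=.
by congr (sin _); rewrite -mulr_natl; ring.
Qed.

(** A deck transformation moves [theta^0] by a multiple of [2 pi]. *)
Lemma inst_shift (s t : R) (z : int) : let t' := t + 2 * pi * z%:~R in
  [/\ instV s t' = instV s t, instS s t' = instS s t,
      instB s t' = instB s t & instBs s t' = instBs s t].
Proof. by split; apply: eq_rsum => k _; rewrite ?cos_shift ?sin_shift. Qed.

(** The forms built from [d theta] have constant coefficients in [theta]; in
    [dsigform] the shift of [theta] is compensated by that of [d sigma]. *)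
Lemma slice_metric_deck m c d k (q u w : Q) :
  slice_metric m c (deck d k q) (ddeck d u) (ddeck d w) = slice_metric m c q u w.
Proof.
have ht : (thC (deck d k q)).2 ord0 ord0 =
    (thC q).2 ord0 ord0 + 2 * pi * (d.2 ord0 ord0)%:~R by rewrite !mxE.
have [eV eS eB eBs] := inst_shift (z0C c q) ((thC q).2 ord0 ord0) (d.2 ord0 ord0).
have hv : vinstq m c (deck d k q) = vinstq m c q by rewrite /vinstq ht eV.
have ha : ainstq m c (deck d k q) = ainstq m c q by rewrite /ainstq ht eS.
have hb : binstq m c (deck d k q) = binstq m c q by rewrite /binstq ht eB.
have hbs : dbinstq m c (deck d k q) = dbinstq m c q by rewrite /dbinstq ht eBs.
have hf : fhamq m c (deck d k q) = fhamq m c q by rewrite /fhamq hb.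
have hf1 : fham1q m c (deck d k q) = fham1q m c q by rewrite /fham1q hb hv ha.
have he : epsinstq m c (deck d k q) = epsinstq m c q by rewrite /epsinstq hv ha.
have hr (U : Q) : dfhamq m c (deck d k q) (ddeck d U) = dfhamq m c q U.
  by rewrite /dfhamq ha hbs.
have hD (U : Q) : dsigform (deck d k q) (ddeck d U) = dsigform q U.
  rewrite /dsigform.
  have -> : pair_theta (thC (deck d k q)) (thC (ddeck d U)) =
      pair_theta (thC q) (thC U) + 2 * pi * pair_theta (dualR d) (thC U).
    rewrite /pair_theta mulr_sumr -big_split; apply: eq_bigr => i _.
    by rewrite !mxE /=; ring.
  rewrite -[sigC (ddeck d U)]/(sigC U + 2^-1 * pair_theta (dualR d) (thC U)).
  have : pi != 0 :> R by rewrite lt0r_neq0// pi_gt0.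
  move: (@pi R) (pair_theta _ _) (pair_theta _ _) => P a b P0.
  by field.
by rewrite /slice_metric !hr !hD hv ha hf hf1 he.
Qed.

End DeckInvariance.

(** * The Kaehler potential of complex hyperbolic space *)

Section HyperbolicPotential.
Local Open Scope complex_scope.
Context {R : realType} {n : nat}.
Local Notation C := R[i].
Local Notation CX := (coordX R n).
Implicit Types (x v u w : CX).

Lemma derive_kahler x v : normX2 x < 1 ->
  'D_v kahler x = 2 * Eform x v / (1 - normX2 x).
Proof.
move=> x1; suff h : is_derive x v kahler (2 * Eform x v / (1 - normX2 x)).
  by rewrite derive_val.
apply: is_derive_line.
pose y (h : R) := 1 - (normX2 x + 2 * h * Eform x v + h ^+ 2 * normX2 v).
have -> : (fun h : R => kahler (h *: v + x)) = (fun h => - (@ln R \o y) h).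
  by apply/funext => h; rewrite /kahler normX2_line.
have y0 : y 0 = 1 - normX2 x by rewrite /y mulr0 mul0r expr0n/= mul0r !addr0.
have Y0 : 0 < y 0 by rewrite y0 subr_gt0.
have dy : is_derive (0 : R) 1 y (- (2 * Eform x v)).
  by rewrite /y; apply: is_derive_eq; rewrite /GRing.scale/=; ring.
have dl := is_derive1_ln Y0.
have dc := is_derive1_comp dl dy.
apply: is_derive_eq; rewrite y0; ring.
Qed.

Lemma continuous_normX2 : continuous (@normX2 R n).
Proof.
move=> x; rewrite (_ : @normX2 R n = (fun y : CX =>
    \sum_i (y.1 ord0 i * y.1 ord0 i + y.2 ord0 i * y.2 ord0 i))); last first.
  by apply/funext => y; rewrite normX2E.
apply: cvg_big => [|i _]; first exact: add_continuous.
have c1 : {for x, continuous (fun y : CX => y.1 ord0 i)}.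
  by apply: (@continuous_comp _ _ _ fst (fun M : 'rV[R]_n => M ord0 i));
    [exact: cvg_fst|exact: coord_continuous].
have c2 : {for x, continuous (fun y : CX => y.2 ord0 i)}.
  by apply: (@continuous_comp _ _ _ snd (fun M : 'rV[R]_n => M ord0 i));
    [exact: cvg_snd|exact: coord_continuous].
by apply: (@cvgD R R); apply: continuousM.
Qed.

Lemma near_normX2_lt1 x : normX2 x < 1 -> \forall y \near x, normX2 y < 1.
Proof. exact: (cvgr_lt (normX2 x) (@continuous_normX2 x)). Qed.

Lemma Eform_delta1 x (i : 'I_n) : Eform x (delta_mx ord0 i, 0) = x.1 ord0 i.
Proof.
rewrite /Eform (bigD1 i)//= big1 ?addr0; last first.
  by move=> j /negPf ji; rewrite !mxE ji andbF !mulr0 addr0.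
by rewrite !mxE !eqxx mulr1 mulr0 addr0.
Qed.

Lemma Eform_delta2 x (i : 'I_n) : Eform x (0, delta_mx ord0 i) = x.2 ord0 i.
Proof.
rewrite /Eform (bigD1 i)//= big1 ?addr0; last first.
  by move=> j /negPf ji; rewrite !mxE ji andbF !mulr0 addr0.
by rewrite !mxE !eqxx mulr1 mulr0 add0r.
Qed.

Lemma dXbar_kahler j x : normX2 x < 1 ->
  dXbar j kahlerC x = Xcoord x j / (1 - normX2 x)%:C.
Proof.
move=> x1; rewrite /dXbar /cderive /kahlerC /=.
rewrite !(derive_kahler _ x1) Eform_delta1 Eform_delta2 !derive_cst.
have yn : 1 - normX2 x != 0 by rewrite subr_eq0 gt_eqF.
have -> : ((1 - normX2 x)%:C)^-1 = ((1 - normX2 x)^-1)%:C by rewrite fmorphV.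
have -> : (2^-1 : C) = (2^-1 : R)%:C by rewrite fmorphV rmorph_nat.
move: (1 - normX2 x) yn => y yn.
by apply/eqP; rewrite eq_complex /=; apply/andP; split; apply/eqP => /=; field.
Qed.

Lemma dX_kahler i x : normX2 x < 1 ->
  dX i kahlerC x = (Xcoord x i)^*%C / (1 - normX2 x)%:C.
Proof.
move=> x1; rewrite /dX /cderive /kahlerC /=.
rewrite !(derive_kahler _ x1) Eform_delta1 Eform_delta2 !derive_cst.
have yn : 1 - normX2 x != 0 by rewrite subr_eq0 gt_eqF.
have -> : ((1 - normX2 x)%:C)^-1 = ((1 - normX2 x)^-1)%:C by rewrite fmorphV.
have -> : (2^-1 : C) = (2^-1 : R)%:C by rewrite fmorphV rmorph_nat.
move: (1 - normX2 x) yn => y yn.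
by apply/eqP; rewrite eq_complex /=; apply/andP; split; apply/eqP => /=; field.
Qed.

(** Both parts of the first derivatives [X^j / (1 - |X|^2)] of the potential
    have this form, with a linear numerator. *)
Lemma derive_ratio (l : CX -> R) x v : normX2 x < 1 ->
  (forall h : R, l (h *: v + x) = h * l v + l x) ->
  'D_v (fun y => l y / (1 - normX2 y)) x =
  l v / (1 - normX2 x) + 2 * l x * Eform x v / (1 - normX2 x) ^+ 2.
Proof.
move=> x1 ll.
suff h : is_derive x v (fun y => l y / (1 - normX2 y))
  (l v / (1 - normX2 x) + 2 * l x * Eform x v / (1 - normX2 x) ^+ 2).
  by rewrite derive_val.
apply: is_derive_line.
pose y (h : R) := 1 - (normX2 x + 2 * h * Eform x v + h ^+ 2 * normX2 v).
have -> : (fun h : R => l (h *: v + x) / (1 - normX2 (h *: v + x))) =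
    (fun h => (h * l v + l x) / y h).
  by apply/funext => h; rewrite ll normX2_line.
have y0 : y 0 = 1 - normX2 x by rewrite /y mulr0 mul0r expr0n/= mul0r !addr0.
have yn : 1 - normX2 x != 0 by rewrite subr_eq0 gt_eqF.
have y0n : y 0 != 0 by rewrite y0.
have dy : is_derive (0 : R) 1 y (- (2 * Eform x v)).
  by rewrite /y; apply: is_derive_eq; rewrite /GRing.scale/=; ring.
have dV := @is_deriveV R y 0 _ 1 y0n dy.
apply: is_derive_eq; rewrite /GRing.scale/= y0.
by move: (1 - normX2 x) yn => z zn; field.
Qed.

(** The formula for [dXbar] holds in the unit ball only, but the ball is open,
    and that suffices to differentiate it once more. *)
Lemma dX_dXbar_kahler i j x : normX2 x < 1 ->
  dX i (dXbar j kahlerC) x = (i == j)%:R / (1 - normX2 x)%:C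
    + Xcoord x j * (Xcoord x i)^*%C / ((1 - normX2 x) ^+ 2)%:C.
Proof.
move=> x1.
have cd v : cderive (dXbar j kahlerC) v x =
    (v.1 ord0 j / (1 - normX2 x) + 2 * x.1 ord0 j * Eform x v / (1 - normX2 x) ^+ 2) +i*
    (v.2 ord0 j / (1 - normX2 x) + 2 * x.2 ord0 j * Eform x v / (1 - normX2 x) ^+ 2).
  have near_x := near_normX2_lt1 x1.
  have near_eq : \forall y \near x,
      dXbar j kahlerC y = (y.1 ord0 j / (1 - normX2 y)) +i* (y.2 ord0 j / (1 - normX2 y)).
    near=> y; rewrite dXbar_kahler; last by near: y.
    rewrite -fmorphV; apply/eqP; rewrite eq_complex /=.
    by apply/andP; split; apply/eqP => /=; ring.
  congr (_ +i* _).
    rewrite -(derive_ratio (l := fun y => y.1 ord0 j))//; last by move=> h; rewrite !mxE.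
    by apply: near_eq_derive; apply: filterS near_eq => y ->.
  rewrite -(derive_ratio (l := fun y => y.2 ord0 j))//; last by move=> h; rewrite !mxE.
  by apply: near_eq_derive; apply: filterS near_eq => y ->.
rewrite /dX !cd Eform_delta1 Eform_delta2 !mxE eqxx /=.
have yn : 1 - normX2 x != 0 by rewrite subr_eq0 gt_eqF.
rewrite -!fmorphV.
have -> : (2^-1 : C) = (2^-1 : R)%:C by rewrite fmorphV rmorph_nat.
have -> : ((i == j)%:R : C) = ((i == j)%:R : R)%:C by rewrite rmorph_nat.
rewrite (eq_sym j i).
move: (1 - normX2 x) yn ((i == j)%:R : R) => y yn k.
by apply/eqP; rewrite eq_complex /=; apply/andP; split; apply/eqP => /=; field.
Unshelve. all: by end_near. Qed.

Definition cX (x u : CX) : C := \sum_i (Xcoord x i)^*%C * Xcoord u i.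

Lemma cXE x u : cX x u = Eform x u +i* - Fform x u.
Proof.
apply/eqP; rewrite eq_complex /cX (big_morph _ (@cReD R) (erefl (cRe 0)))
  (big_morph _ (@cImD R) (erefl (cIm 0))) /= -sumrN.
by apply/andP; split; apply/eqP; apply: eq_bigr => i _ /=; ring.
Qed.

Lemma gMbarE x u w : normX2 x < 1 -> gMbar x u w =
  Eform u w / (1 - normX2 x)
  + (Eform x u * Eform x w + Fform x u * Fform x w) / (1 - normX2 x) ^+ 2.
Proof.
move=> x1; rewrite /gMbar.
have yn : (1 - normX2 x)%:C != 0 :> C.
  by rewrite eq_complex /= eqxx andbT subr_eq0 gt_eqF.
have cj : (cX x w)^*%C = \sum_j Xcoord x j * (Xcoord w j)^*%C.
  rewrite /cX rmorph_sum; apply: eq_bigr => j _.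
  by case: (Xcoord x j) (Xcoord w j) => a b [a' b'];
    apply/eqP; rewrite eq_complex /=; apply/andP; split; apply/eqP => /=; ring.
set y1 : C := ((1 - normX2 x)^-1)%:C; set y2 : C := (((1 - normX2 x) ^+ 2)^-1)%:C.
have hd i j : dX i (dXbar j kahlerC) x =
    (i == j)%:R * y1 + Xcoord x j * (Xcoord x i)^*%C * y2.
  by rewrite dX_dXbar_kahler// -!fmorphV.
have -> : \sum_i \sum_j dX i (dXbar j kahlerC) x * Xcoord u i * (Xcoord w j)^*%C =
   y1 * (\sum_i Xcoord u i * (Xcoord w i)^*%C) + y2 * (cX x u * (cX x w)^*%C).
  have e1 i : y1 * (Xcoord u i * (Xcoord w i)^*%C) =
      \sum_j ((i == j)%:R * y1) * Xcoord u i * (Xcoord w j)^*%C.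
    rewrite (bigD1 i) //= big1 ?addr0 ?eqxx ?mul1r ?mulrA// => j /negPf ji.
    by rewrite eq_sym ji !mul0r.
  have e2 : y2 * (cX x u * (cX x w)^*%C) = \sum_i \sum_j
      Xcoord x j * (Xcoord x i)^*%C * y2 * Xcoord u i * (Xcoord w j)^*%C.
    rewrite cj /cX mulr_suml mulr_sumr; apply: eq_bigr => i _.
    rewrite !mulr_sumr; apply: eq_bigr => j _.
    by move: (conjc _) (conjc _) => *; ring.
  rewrite e2 mulr_sumr (eq_bigr _ (fun i _ => e1 i)) -big_split.
  apply: eq_bigr => i _; rewrite -big_split; apply: eq_bigr => j _.
  by rewrite hd !mulrDl.
have -> : cX x u * (cX x w)^*%C =
   (Eform x u * Eform x w + Fform x u * Fform x w) +i*
   (Eform x u * Fform x w - Fform x u * Eform x w).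
  rewrite !cXE; apply/eqP; rewrite eq_complex /=.
  by apply/andP; split; apply/eqP => /=; ring.
have -> : \sum_i Xcoord u i * (Xcoord w i)^*%C = Eform u w +i* Fform u w.
  apply/eqP; rewrite eq_complex (big_morph _ (@cReD R) (erefl (cRe 0)))
    (big_morph _ (@cImD R) (erefl (cIm 0))) /=.
  by apply/andP; split; apply/eqP; apply: eq_bigr => i _ /=; ring.
by rewrite /y1 /y2 /=; ring.
Qed.

Lemma dcKE x u : normX2 x < 1 -> dcK x u = - 2 * Fform x u / (1 - normX2 x).
Proof.
move=> x1; rewrite /dcK.
have -> : \sum_i dXbar i kahlerC x * (Xcoord u i)^*%C =
    (cX x u)^*%C * ((1 - normX2 x)^-1)%:C.
  rewrite /cX rmorph_sum mulr_suml; apply: eq_bigr => i _.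
  rewrite dXbar_kahler// -fmorphV.
  case: (Xcoord x i) (Xcoord u i) => a b [a' b'].
  by apply/eqP; rewrite eq_complex /=; apply/andP; split; apply/eqP => /=; ring.
have -> : \sum_i dX i kahlerC x * Xcoord u i = cX x u * ((1 - normX2 x)^-1)%:C.
  rewrite /cX mulr_suml; apply: eq_bigr => i _.
  by rewrite dX_kahler// -fmorphV mulrAC.
by rewrite cXE /=; ring.
Qed.

End HyperbolicPotential.

(** * The Ferrara-Sabharwal metric *)

Section FerraraSabharwal.
Local Open Scope complex_scope.
Context {R : realType} {n : nat}.
Local Notation C := R[i].
Local Notation Q := (coordN R n).

Lemma invmx_Nmx : invmx (@Nmx R n) = Nmx.
Proof.
have NN : @Nmx R n *m Nmx = 1%:M.
  apply/matrixP => i j; rewrite !mxE (bigD1 i)//= big1 ?addr0; last first.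
    by move=> k /negPf ki; rewrite NmxE eq_sym ki mul0r.
  rewrite !NmxE eqxx; case: (eqVneq i j) => [->|_]; last by rewrite mulr0.
  by rewrite /Nsign; case: ifP => _; rewrite ?mulr1 ?mulrNN ?mulr1.
have [uN _] := mulmx1_unit NN.
by rewrite -[LHS]mulmx1 -NN mulKmx.
Qed.

Lemma Wc0 (u : Q) : Wc u ord0 = (thC u).1 ord0 ord0 +i* - (thC u).2 ord0 ord0.
Proof.
rewrite /Wc tau_row eqxx.
by apply/eqP; rewrite eq_complex /=; apply/andP; split; apply/eqP => /=; ring.
Qed.

Lemma Wci (u : Q) i : Wc u (lift ord0 i) =
  (thC u).1 ord0 (lift ord0 i) +i* (thC u).2 ord0 (lift ord0 i).
Proof.
rewrite /Wc tau_row lift0F.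
by apply/eqP; rewrite eq_complex /=; apply/andP; split; apply/eqP => /=; ring.
Qed.

Definition XW (q u : Q) : C := \sum_i Xhom (XC q) i * Wc u i.

Lemma XWE q u : XW q u = ((thC u).1 ord0 ord0 + QRsum (XC q) u)
  +i* (- (thC u).2 ord0 ord0 + QIsum (XC q) u).
Proof.
rewrite /XW big_ord_recl Wc0 /Xhom unlift_none mul1r.
rewrite (eq_bigr (fun i : 'I_n =>
  ((XC q).1 ord0 i * (thC u).1 ord0 (lift ord0 i)
   - (XC q).2 ord0 i * (thC u).2 ord0 (lift ord0 i)) +i*
  ((XC q).1 ord0 i * (thC u).2 ord0 (lift ord0 i)
   + (XC q).2 ord0 i * (thC u).1 ord0 (lift ord0 i)))); last first.
  by move=> i _; rewrite liftK Wci.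
apply/eqP; rewrite eq_complex !cReD !cImD (big_morph _ (@cReD R) (erefl (cRe 0)))
  (big_morph _ (@cImD R) (erefl (cIm 0))) /=.
by rewrite !eqxx.
Qed.

(** The rank one part of the fibre metric is a multiple of
    [|\sum_i X^i W_i|^2], which is also the sum of the squares of [theta_2] and
    [theta_3] up to a factor and instanton terms. *)
Lemma fibre_form (k : R) (q u w : Q) :
  cRe (\sum_i \sum_j Wc u i * ((invmx (@Nmx R n) i j)%:C
     - k%:C * Xhom (XC q) i * (Xhom (XC q) j)^*%C) * (Wc w j)^*%C) =
  (thC u).1 ord0 ord0 * (thC w).1 ord0 ord0
  + (thC u).2 ord0 ord0 * (thC w).2 ord0 ord0 - Wsum u w
  - k * (((thC u).1 ord0 ord0 + QRsum (XC q) u) * ((thC w).1 ord0 ord0 + QRsum (XC q) w)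
    + ((thC u).2 ord0 ord0 - QIsum (XC q) u) * ((thC w).2 ord0 ord0 - QIsum (XC q) w)).
Proof.
rewrite invmx_Nmx.
have -> : \sum_i \sum_j Wc u i * ((@Nmx R n i j)%:C
     - k%:C * Xhom (XC q) i * (Xhom (XC q) j)^*%C) * (Wc w j)^*%C =
   \sum_i (Nsign i)%:C * (Wc u i * (Wc w i)^*%C) + (- k)%:C * (XW q u * (XW q w)^*%C).
  have e1 i : (Nsign i)%:C * (Wc u i * (Wc w i)^*%C) =
      \sum_j Wc u i * (@Nmx R n i j)%:C * (Wc w j)^*%C.
    rewrite (bigD1 i) //= big1 ?addr0.
      by rewrite NmxE eqxx mulrCA mulrA.
    by move=> j /negPf ji; rewrite NmxE eq_sym ji mulr0 mul0r.
  have cj : (XW q w)^*%C = \sum_j (Xhom (XC q) j)^*%C * (Wc w j)^*%C.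
    rewrite /XW rmorph_sum; apply: eq_bigr => j _.
    by case: (Xhom _ j) (Wc w j) => a b [a' b'];
      apply/eqP; rewrite eq_complex /=; apply/andP; split; apply/eqP => /=; ring.
  have e2 : (- k)%:C * (XW q u * (XW q w)^*%C) = \sum_i \sum_j
      - (Wc u i * (k%:C * Xhom (XC q) i * (Xhom (XC q) j)^*%C) * (Wc w j)^*%C).
    rewrite cj /XW mulr_suml mulr_sumr; apply: eq_bigr => i _.
    rewrite !mulr_sumr; apply: eq_bigr => j _.
    have -> : (- k)%:C = - k%:C :> C by rewrite rmorphN.
    have alg (a b d e f : C) : - d * (e * f * (a * b)) = - (f * (d * e * a) * b) by ring.
    exact: alg.
  rewrite e2 (eq_bigr _ (fun i _ => e1 i)) -big_split.
  apply: eq_bigr => i _; rewrite -big_split; apply: eq_bigr => j _.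
  by rewrite mulrBr mulrBl.
rewrite cReD cReZ !XWE (big_morph _ (@cReD R) (erefl (cRe 0))).
rewrite big_ord_recl (eq_bigr (fun i : 'I_n => -
  ((thC u).1 ord0 (lift ord0 i) * (thC w).1 ord0 (lift ord0 i)
   + (thC u).2 ord0 (lift ord0 i) * (thC w).2 ord0 (lift ord0 i)))); last first.
  by move=> i _; rewrite cReZ /Nsign lift0F !Wci /=; ring.
by rewrite sumrN -/(Wsum u w) cReZ /Nsign eqxx !Wc0 /=; ring.
Qed.

Lemma expR_kahler (x : coordX R n) : normX2 x < 1 -> expR (kahler x) = (1 - normX2 x)^-1.
Proof. by move=> x1; rewrite /kahler expRN lnK// posrE subr_gt0. Qed.

(** With the instanton series multiplied by zero, [f = rho] and
    [f_1 = - (rho + 2 c)], and the two metrics agree by a rational identity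
    once [s^2] is replaced by [(rho + c) / (2 pi (1 - |X|^2))]. *)
Lemma slice_metric0_gFS c (q u w : Q) : 0 < rhoC q + c -> gFS_defined c q ->
  slice_metric 0 c q u w = gFS c q u w.
Proof.
move=> rc0 [x1 r0 rc rcc].
have v0 : vinstq 0 c q = 0 by rewrite /vinstq mul0r mul0r.
have a0 : ainstq 0 c q = 0 by rewrite /ainstq mulr0 mul0r.
have b0 : binstq 0 c q = 0 by rewrite /binstq mulr0 mul0r oppr0 mul0r.
have bs0 : dbinstq 0 c q = 0 by rewrite /dbinstq mulr0 mul0r oppr0 mul0r.
have e0 : epsinstq 0 c q = 0 by rewrite /epsinstq a0 mulr0.
have dr0 (U : Q) : dfhamq 0 c q U = rhoC U.
  by rewrite /dfhamq a0 bs0 mulr0 !mul0r !addr0.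
have f0 : fhamq 0 c q = rhoC q by rewrite /fhamq b0 addr0.
have f10 : fham1q 0 c q = - (rhoC q + 2 * c).
  by rewrite /fham1q b0 v0 a0 expr0n/= mul0r !mulr0 !subr0 addr0.
rewrite /gFS gMbarE// fibre_form expR_kahler// /etaFS !dcKE//.
rewrite /slice_metric v0 a0 e0 !dr0 f0 f10 -!/(dsigform q _).
have ss := z0C_sqr x1 rc0.
have yn : 1 - normX2 (XC q) != 0 by rewrite subr_eq0 gt_eqF.
have pn : pi != 0 :> R by rewrite lt0r_neq0// pi_gt0.
rewrite /qkform ![z0C c q * _ * (z0C c q * _)]mulrACA -!expr2 ss /dlogz0.
move: (rhoC q) (1 - normX2 (XC q)) (@pi R) r0 rc rcc yn pn {x1 rc0 ss v0 a0 b0 bs0 e0 dr0 f0 f10}.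
move: (Eform _ _) (Eform _ _) (Eform _ _) (Fform _ _) (Fform _ _) (Wsum _ _).
move: (dsigform _ _) (dsigform _ _) (QRsum _ _) (QRsum _ _) (QIsum _ _) (QIsum _ _).
move: (rhoC u) (rhoC w).
move: ((thC u).1 _ _) ((thC w).1 _ _) ((thC u).2 _ _) ((thC w).2 _ _).
move=> t1 t2 u1 u2 r1 r2 D1 D2 A1 A2 B1 B2 E1 E2 G F1 F2 W r y P r0 rc rcc yn pn.
by field; rewrite r0 rc rcc yn pn.
Qed.

End FerraraSabharwal.

(** * Inequalities between real numbers *)

Section Positivity.
Context {R : realType}.

(** The inverses [3 y / 4] and [(4 - 3 y) / 4] of the two weights add up to 1.
    In [fibre_bound] the second weight meets the factor [1 - y] of the
    Cauchy-Schwarz inequality, and [4 (1 - y) / (4 - 3 y) <= 1 - y / 4] leaves a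
    margin. *)
Lemma young_weighted (y x z : R) : 0 < y -> y <= 1 ->
  (x - z) ^+ 2 <= 4 / (3 * y) * x ^+ 2 + 4 / (4 - 3 * y) * z ^+ 2.
Proof.
move=> y0 y1; have k0 : 0 < 4 - 3 * y by lra.
have yn : y != 0 by exact: lt0r_neq0.
have kn : 4 - 3 * y != 0 by exact: lt0r_neq0.
rewrite -subr_ge0.
have -> : 4 / (3 * y) * x ^+ 2 + 4 / (4 - 3 * y) * z ^+ 2 - (x - z) ^+ 2 =
  3 * y / (4 - 3 * y) * ((4 - 3 * y) / (3 * y) * x + z) ^+ 2.
  by field; rewrite yn kn.
by rewrite mulr_ge0 ?sqr_ge0// divr_ge0//; lra.
Qed.

(** [|W_0|^2] is controlled by [W_0 = (W_0 + Q) - Q], where [Q] is the sum of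
    [X^i W_i] over [i > 0].  Half of the margin of [young_weighted] is given
    to the left-hand side. *)
Lemma fibre_bound (y t U A B W : R) : 0 < y -> y <= 1 ->
  A ^+ 2 + B ^+ 2 <= (1 - y) * W -> 0 <= W ->
  (1 + y / 8) * (t ^+ 2 + U ^+ 2) <=
  3 / 2 * ((t + A) ^+ 2 + (U - B) ^+ 2) / y + (1 - y / 8) * W.
Proof.
move=> y0 y1 hQ W0; have k0 : 0 < 4 - 3 * y by lra.
have h1 := young_weighted (t + A) A y0 y1.
have h2 := young_weighted (U - B) (- B) y0 y1.
rewrite addrK in h1; rewrite opprK subrK sqrrN in h2.
have yn : y != 0 by exact: lt0r_neq0.
have h3 : 4 / (4 - 3 * y) * (A ^+ 2 + B ^+ 2) <= (1 - y / 4) * W.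
  apply: (@le_trans _ _ (4 / (4 - 3 * y) * ((1 - y) * W))).
    by rewrite ler_wpM2l// divr_ge0// ltW.
  rewrite mulrA ler_wpM2r// mulrAC ler_pdivrMr//; nra.
have h4 : t ^+ 2 + U ^+ 2 <=
    4 / (3 * y) * ((t + A) ^+ 2 + (U - B) ^+ 2) + (1 - y / 4) * W by lra.
apply: (@le_trans _ _ ((1 + y / 8) *
    (4 / (3 * y) * ((t + A) ^+ 2 + (U - B) ^+ 2) + (1 - y / 4) * W))).
  by rewrite ler_wpM2l//; lra.
rewrite mulrDr; apply: lerD.
  have p0 : 0 <= ((t + A) ^+ 2 + (U - B) ^+ 2) / y.
    by rewrite divr_ge0 ?addr_ge0 ?sqr_ge0// ltW.
  have -> : (1 + y / 8) * (4 / (3 * y) * ((t + A) ^+ 2 + (U - B) ^+ 2)) =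
    (4 / 3 * (1 + y / 8)) * (((t + A) ^+ 2 + (U - B) ^+ 2) / y) by field.
  by rewrite -[leRHS]mulrA ler_wpM2r//; lra.
rewrite mulrA ler_wpM2r//; nra.
Qed.

(** Completing the square [2 P s^2 y (l - E / y)^2]; its root [l - E / y] is
    [d rho / (2 (rho + c))], so that the mixed terms of [l] and [E] disappear. *)
Lemma qkform_diag (P f F1 y s v a e r r0 E F D t u A B G W : R) :
  0 < P -> 0 < f -> 0 < F1 -> 0 < y -> 0 < s -> 0 < 1 + v ->
  let sg := 2 * P * s ^+ 2 * y in let l := r0 / (2 * sg) + E / y in
  qkform P f (- F1) y s v a e l r E F D t u A B l r E F D t u A B G W =
  f^-1 * (2 / F1 * (D - P * s ^+ 2 * F - e * t) ^+ 2
    + 2 / f * (D + P * s ^+ 2 * F) ^+ 2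
    + (2 * P * s ^+ 2 * (G + E ^+ 2 / y) + r ^+ 2 / (2 * f) - r0 ^+ 2 / (4 * sg)
       - 2 * P * s ^+ 2 * v * l ^+ 2
       + (2 * P)^-1 * (W - (t ^+ 2 + ((1 + v) * u) ^+ 2) / (1 + v))
       + 2 / f * s ^+ 2 * ((t + A) ^+ 2 + ((1 + v) * u - B - l * a) ^+ 2))).
Proof.
move=> P0 f0 F0 y0 s0 T0 /=.
have Pn := lt0r_neq0 P0; have fn := lt0r_neq0 f0; have Fn := lt0r_neq0 F0.
have yn := lt0r_neq0 y0; have sn := lt0r_neq0 s0; have Tn := lt0r_neq0 T0.
by rewrite /qkform; field; rewrite Tn Pn fn Fn yn sn.
Qed.

Lemma sqr_sum_le (x z : R) : (x + z) ^+ 2 <= 2 * x ^+ 2 + 2 * z ^+ 2.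
Proof. by have := sqr_ge0 (x - z); nra. Qed.

Lemma sqr_sum3_ge (x z w : R) :
  3 / 4 * x ^+ 2 - 6 * z ^+ 2 - 6 * w ^+ 2 <= (x + z + w) ^+ 2.
Proof.
have := sqr_ge0 (x / 2 + 2 * (z + w)); have := sqr_sum_le z w; nra.
Qed.

(** With [f = sg] and no instanton terms, the radial terms add up to
    [r0^2 / (4 sg)] and the fibre terms have the margin of [fibre_bound].  The
    condition [f <= 5/4 sg] costs part of both margins.  The instanton terms
    are at most small multiples of [l^2] or of [y (t^2 + U^2)], and [l^2] is
    controlled by the radial margin and the term in [E^2]. *)
Lemma rest_bound (P f y s v a r r0 bt bs E t u A B G W : R) :
  2 <= P -> P <= 4 -> 1 <= f -> 0 < y -> y <= 1 -> 1 <= s ->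
  let sg := 2 * P * s ^+ 2 * y in let l := r0 / (2 * sg) + E / y in
  let d := y / 100 in
  f <= 5 / 4 * sg -> 24 <= sg ->
  `|v| * s ^+ 2 <= d -> `|a| * s ^+ 2 <= d ->
  `|bt| * s ^+ 2 <= d -> `|bs| * s ^+ 2 <= d ->
  r = r0 + bt * u + bs * (s * l) ->
  0 <= G -> 0 <= W -> A ^+ 2 + B ^+ 2 <= (1 - y) * W ->
  2 * P * s ^+ 2 * G + r0 ^+ 2 / (48 * sg)
    + (2 * P)^-1 * (y / 32 * (t ^+ 2 + ((1 + v) * u) ^+ 2) + y / 8 * W) <=
  2 * P * s ^+ 2 * (G + E ^+ 2 / y) + r ^+ 2 / (2 * f) - r0 ^+ 2 / (4 * sg)
       - 2 * P * s ^+ 2 * v * l ^+ 2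
       + (2 * P)^-1 * (W - (t ^+ 2 + ((1 + v) * u) ^+ 2) / (1 + v))
       + 2 / f * s ^+ 2 * ((t + A) ^+ 2 + ((1 + v) * u - B - l * a) ^+ 2).
Proof.
move=> P2 P4 f1 y0 y1 s1 sg l d fsg sg24 hv ha hbt hbs hr G0 W0 hQ.
have s21 : 1 <= s ^+ 2 by rewrite exprn_ege1.
have small (z : R) : `|z| * s ^+ 2 <= d -> `|z| <= d.
  by move=> h; apply: le_trans h; rewrite ler_peMr.
have v1 := small _ hv; have a1 := small _ ha; have bt1 := small _ hbt.
have bs1 := small _ hbs.
have d0 : 0 <= d by rewrite divr_ge0// ltW.
have d1 : d <= 1 / 100 by rewrite /d; lra.
move: v1; rewrite ler_norml => /andP[vl vu].
have T0 : 1 / 2 <= 1 + v by lra.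
have Tpos : 0 < 1 + v by lra.
set U := (1 + v) * u.
(* The instanton shift [z = l a] of [x = U - B] costs only a multiple of [z^2]:
   [8/5 (x - z)^2 - 3/2 x^2 + 24 z^2] is a tenth of [(x - 16 z)^2]. *)
have hT : (1 + v)^-1 <= 1 + y / 16.
  rewrite -[leLHS]mul1r ler_pdivrMr//; rewrite /d in vl; nra.
have w0 : 0 <= t ^+ 2 + U ^+ 2 by rewrite addr_ge0 ?sqr_ge0.
have P0 : 0 < (2 * P)^-1 by rewrite invr_gt0; lra.
have fpos : 0 < f by lra.
have sgpos : 0 < sg by lra.
have yn : y != 0 by exact: lt0r_neq0.
have fn : f != 0 by exact: lt0r_neq0.
have Pn : P != 0 by apply: lt0r_neq0; lra.
have sgn : sg != 0 by exact: lt0r_neq0.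
have hfib : (2 * P)^-1 * (y / 16 * (t ^+ 2 + U ^+ 2) + y / 8 * W - 24 * (l * a) ^+ 2 / y)
   <= (2 * P)^-1 * (W - (t ^+ 2 + U ^+ 2) / (1 + v))
       + 2 / f * s ^+ 2 * ((t + A) ^+ 2 + (U - B - l * a) ^+ 2).
  have e2 : 2 / f * s ^+ 2 = (2 * P)^-1 * ((2 * sg / f) / y).
    by rewrite /sg; field; rewrite Pn fn yn.
  rewrite e2 -[X in _ <= _ + X]mulrA -mulrDr (ler_wpM2l (ltW P0))//.
  have h85 : 8 / 5 <= 2 * sg / f by rewrite ler_pdivlMr//; lra.
  have hP : 3 / 2 * ((t + A) ^+ 2 + (U - B) ^+ 2) - 24 * (l * a) ^+ 2 <=
      2 * sg / f * ((t + A) ^+ 2 + (U - B - l * a) ^+ 2).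
    apply: (@le_trans _ _ (8 / 5 * ((t + A) ^+ 2 + (U - B - l * a) ^+ 2))).
      have := sqr_ge0 (U - B - 16 * (l * a)); have := sqr_ge0 (t + A); nra.
    by rewrite ler_wpM2r// addr_ge0 ?sqr_ge0.
  have hF := fibre_bound t U y0 y1 hQ W0.
  have hw : (t ^+ 2 + U ^+ 2) / (1 + v) <= (1 + y / 16) * (t ^+ 2 + U ^+ 2).
    by rewrite mulrC ler_wpM2r.
  have hPy : (3 / 2 * ((t + A) ^+ 2 + (U - B) ^+ 2) - 24 * (l * a) ^+ 2) / y <=
      2 * sg / f / y * ((t + A) ^+ 2 + (U - B - l * a) ^+ 2).
    rewrite [leRHS]mulrAC ler_pM2r ?invr_gt0//.
  rewrite mulrBl in hPy.
  lra.
(* [r] is [r0] up to instanton terms, which are paid for by a quarter of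
   [r0^2]. *)
have hr2 : 3 / 4 * r0 ^+ 2 - 6 * (bt * u) ^+ 2 - 6 * (bs * (s * l)) ^+ 2 <= r ^+ 2.
  by rewrite hr; exact: sqr_sum3_ge.
have l2 : l ^+ 2 <= r0 ^+ 2 / (2 * sg ^+ 2) + 2 * (E ^+ 2 / y ^+ 2).
  apply: le_trans (sqr_sum_le _ _) _.
  by rewrite le_eqVlt; apply/orP; left; apply/eqP; field; rewrite sgn yn.
have l20 := sqr_ge0 l.
(* A product of two instanton factors is at most [d^2 = y^2 / 10^4], and
   [y^2 <= y] leaves [y / 4000] as a convenient bound. *)
have sq (z : R) : `|z| <= d -> z ^+ 2 <= y / 4000.
  move=> h; apply: (@le_trans _ _ (d ^+ 2)).
    by rewrite -[leLHS]ger0_norm ?sqr_ge0// normrX lerXn2r ?nnegrE.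
  by rewrite /d; clear -y0 y1; nra.
have hu : (bt * u) ^+ 2 <= y / 1000 * U ^+ 2.
  have u2 : u ^+ 2 <= 4 * U ^+ 2.
    by rewrite /U exprMn mulrA ler_peMl ?sqr_ge0//; clear -T0; nra.
  have -> : y / 1000 * U ^+ 2 = y / 4000 * (4 * U ^+ 2) by clear; field.
  by rewrite exprMn ler_pM ?sqr_ge0// sq.
have hs : (bs * (s * l)) ^+ 2 <= 1 / 100 * l ^+ 2.
  have -> : (bs * (s * l)) ^+ 2 = (bs * s) ^+ 2 * l ^+ 2 by ring.
  rewrite ler_wpM2r//.
  have h : `|bs * s| <= d.
    have s0 : 0 <= s by rewrite (le_trans _ s1).
    by rewrite normrM (ger0_norm s0) (le_trans _ hbs)// ler_wpM2l// expr2 ler_peMr.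
  by have := sq _ h; clear -y1; lra.
have hla : (l * a) ^+ 2 / y <= 1 / 100 * l ^+ 2.
  have -> : (l * a) ^+ 2 / y = a ^+ 2 / y * l ^+ 2 by clear -yn; field.
  rewrite ler_wpM2r// ler_pdivrMr//.
  by have := sq _ a1; clear -y0; lra.
have hvl : 2 * P * s ^+ 2 * v * l ^+ 2 <= 8 / 100 * l ^+ 2.
  rewrite ler_wpM2r//.
  have : v * s ^+ 2 <= d.
    by apply: le_trans hv; rewrite ler_wpM2r ?ler_norm// sqr_ge0.
  rewrite /d; move: (s ^+ 2) => s2 h; clear -h P2 P4 y0 y1; nra.
have e1 : 2 * P * s ^+ 2 * (E ^+ 2 / y) = sg * (E ^+ 2 / y ^+ 2).
  by rewrite /sg; clear -yn; field.
rewrite (mulrDr (2 * P * s ^+ 2)) e1.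
have Uw : U ^+ 2 <= t ^+ 2 + U ^+ 2 by rewrite lerDr sqr_ge0.
have K1 : 1 / 8 <= (2 * P)^-1.
  by rewrite -[leRHS]mul1r ler_pdivlMr ?mulr_gt0//; clear -P2 P4; lra.
have K2 : (2 * P)^-1 <= 1 / 4.
  by rewrite -[leLHS]mul1r ler_pdivrMr ?mulr_gt0//; clear -P2 P4; lra.
have i1 : f^-1 <= 1 by rewrite invf_le1.
have i2 : 4 / 5 * sg^-1 <= f^-1.
  by rewrite -[leRHS]mul1r ler_pdivlMr// mulrAC ler_pdivrMr//; clear -fsg; lra.
have i3 : sg^-1 <= 1 / 24.
  by rewrite -[leLHS]mul1r ler_pdivrMr//; clear -sg24; lra.
have i0 : 0 < sg^-1 by rewrite invr_gt0.
have j0 : 0 < f^-1 by rewrite invr_gt0.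
have X0 : 0 <= E ^+ 2 / y ^+ 2 by rewrite divr_ge0 ?sqr_ge0.
have R0 := sqr_ge0 r0.
have q1 : r ^+ 2 / (2 * f) = r ^+ 2 * f^-1 / 2 by clear -fn; field.
have q2 : r0 ^+ 2 / (48 * sg) = r0 ^+ 2 * sg^-1 / 48 by clear -sgn; field.
have q3 : r0 ^+ 2 / (4 * sg) = r0 ^+ 2 * sg^-1 / 4 by clear -sgn; field.
have q4 : r0 ^+ 2 / (2 * sg ^+ 2) = r0 ^+ 2 * sg^-1 * sg^-1 / 2 by clear -sgn; field.
rewrite q1 q2 q3; rewrite q4 in l2.
clear q1 q2 q3 q4 e1.
move: hfib; set Z1 := _ + 2 / f * s ^+ 2 * _ => hfib.
rewrite -[leRHS]addrA -/Z1.
set w := t ^+ 2 + U ^+ 2 in w0 Uw hfib *.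
have hKl : (2 * P)^-1 * (24 * (l * a) ^+ 2 / y) <= 6 / 100 * l ^+ 2.
  have -> : 24 * (l * a) ^+ 2 / y = 24 * ((l * a) ^+ 2 / y) by rewrite mulrA.
  have c0 : 0 <= (l * a) ^+ 2 / y by rewrite divr_ge0 ?sqr_ge0// ltW.
  move: ((l * a) ^+ 2 / y) ((2 * P)^-1) hla K2 P0 c0 => c K.
  by clear -l20; nra.
have hr3 : 3 / 10 * (r0 ^+ 2 * sg^-1) - 3 / 1000 * (y * w) - 3 / 100 * l ^+ 2 <=
    r ^+ 2 * f^-1 / 2.
  have a1' : (3 / 4 * r0 ^+ 2 - 6 * (y / 1000 * w) - 6 / 100 * l ^+ 2) * f^-1 <=
      r ^+ 2 * f^-1.
    rewrite (ler_wpM2r (ltW j0))//.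
    have : y * U ^+ 2 <= y * w by rewrite ler_wpM2l// ltW.
    by clear -hr2 hu hs; lra.
  have a2 : r0 ^+ 2 * (4 / 5 * sg^-1) <= r0 ^+ 2 * f^-1 by rewrite ler_wpM2l.
  have a3 : y * w * f^-1 <= y * w by rewrite ler_piMr// mulr_ge0// ltW.
  have a4 : l ^+ 2 * f^-1 <= l ^+ 2 by rewrite ler_piMr.
  by clear -a1' a2 a3 a4; lra.
have hyw : y * w / 256 <= (2 * P)^-1 * (y / 32 * w).
  have : 0 <= y * w by rewrite mulr_ge0// ltW.
  by move: ((2 * P)^-1) K1 => K; clear; nra.
have hl : l ^+ 2 <= r0 ^+ 2 * sg^-1 / 48 + 2 * (E ^+ 2 / y ^+ 2).
  apply: le_trans l2 _; rewrite lerD2r.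
  have : 0 <= r0 ^+ 2 * sg^-1 by rewrite mulr_ge0// ltW.
  by move: (r0 ^+ 2 * sg^-1) => z; clear -i3; nra.
have hX : 24 * (E ^+ 2 / y ^+ 2) <= sg * (E ^+ 2 / y ^+ 2) by rewrite ler_wpM2r.
have R1 : 0 <= r0 ^+ 2 * sg^-1 by rewrite mulr_ge0// ltW.
have yw0 : 0 <= y * w by rewrite mulr_ge0// ltW.
clear -hfib hKl hr3 hyw hl hX R1 yw0 hvl X0 l20.
by clearbody Z1 w l sg; lra.
Qed.

End Positivity.

(** * Positivity at points with large rho *)

Section FarRegion.
Local Open Scope complex_scope.
Context {R : realType} {n : nat}.
Local Notation Q := (coordN R n).

(** The margins of [rest_bound] absorb instanton quantities up to a hundredth
    of [y / s^2].  The second and third bounds keep [f] within a quarter of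
    [rho + c] and [rho + 2 c] positive; [s >= 2] leaves room for differentiating
    the series, which are controlled for [s >= 1]. *)
Definition far (m : int) (c : R) (q : Q) : Prop :=
  let s := z0C c q in let d := (1 - normX2 (XC q)) / 100 in
  [/\ normX2 (XC q) < 1, 24 <= rhoC q + c, 8 * (`|c| + 1) <= rhoC q + c, 2 <= s &
  [/\ `|vinstq m c q| * s ^+ 2 <= d, `|ainstq m c q| * s ^+ 2 <= d,
      `|binstq m c q| * s ^+ 2 <= d & `|dbinstq m c q| * s ^+ 2 <= d]].

Lemma normX2_ge0 (x : coordX R n) : 0 <= normX2 x.
Proof. by apply: sumr_ge0 => i _; rewrite sqr_ge0. Qed.

Lemma pi_le4 : pi <= 4 :> R.
Proof. by have := @pihalf_lt2 R; lra. Qed.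

Lemma Eform_ge0 (x : coordX R n) : 0 <= Eform x x.
Proof. by rewrite -normX2E normX2_ge0. Qed.

Lemma Wsum_ge0 (u : Q) : 0 <= Wsum u u.
Proof. by apply: sumr_ge0 => i _; rewrite addr_ge0// -expr2 sqr_ge0. Qed.

Lemma Eform_eq0 (x : coordX R n) : Eform x x = 0 -> x = 0.
Proof.
move=> /eqP; rewrite psumr_eq0; last by move=> i _; rewrite addr_ge0// -expr2 sqr_ge0.
move=> /allP h; have hi i : x.1 ord0 i = 0 /\ x.2 ord0 i = 0.
  have := h i (mem_index_enum _); rewrite -!expr2 paddr_eq0 ?sqr_ge0//.
  by rewrite !sqrf_eq0 => /andP[/eqP -> /eqP ->].
case: x {h} hi => x1 x2 hi; congr (_, _); apply/rowP => i; rewrite mxE;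
  by have [] := hi i.
Qed.

Lemma sums_eq0 (z1 z2 z3 z4 z5 Z : R) : 0 <= z1 -> 0 <= z2 -> 0 <= z3 ->
  0 <= z4 -> 0 <= z5 -> z3 + z4 + z5 <= Z -> z1 + z2 + Z <= 0 ->
  [/\ z2 = 0, z3 = 0, z4 = 0 & z5 = 0].
Proof. by move=> *; split; apply/le_anti; apply/andP; split; lra. Qed.

(** Cauchy-Schwarz for [Q = \sum_i X^i W_i], from the sum of the
    [|conj (X^i) Q - N W_i|^2] with [N = |X|^2]. *)
Lemma XW_le (x : coordX R n) (u : Q) :
  QRsum x u ^+ 2 + QIsum x u ^+ 2 <= normX2 x * Wsum u u.
Proof.
set A := QRsum x u; set B := QIsum x u; set N := normX2 x.
pose a i := (thC u).1 ord0 (lift ord0 i); pose b i := (thC u).2 ord0 (lift ord0 i).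
have N0 : 0 <= N := normX2_ge0 x.
have sq : 0 <= \sum_(i < n) ((x.1 ord0 i * A + x.2 ord0 i * B - N * a i) ^+ 2
    + (x.1 ord0 i * B - x.2 ord0 i * A - N * b i) ^+ 2).
  by apply: sumr_ge0 => i _; rewrite addr_ge0 ?sqr_ge0.
have e : \sum_(i < n) ((x.1 ord0 i * A + x.2 ord0 i * B - N * a i) ^+ 2
    + (x.1 ord0 i * B - x.2 ord0 i * A - N * b i) ^+ 2) =
    N * (N * Wsum u u - (A ^+ 2 + B ^+ 2)).
  rewrite (eq_bigr (fun i : 'I_n =>
    (A ^+ 2 + B ^+ 2) * (x.1 ord0 i * x.1 ord0 i + x.2 ord0 i * x.2 ord0 i)
    + - (2 * N * A) * (x.1 ord0 i * a i - x.2 ord0 i * b i)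
    + - (2 * N * B) * (x.1 ord0 i * b i + x.2 ord0 i * a i)
    + N ^+ 2 * (a i * a i + b i * b i))); last by move=> i _; ring.
  do 3 rewrite big_split/=; rewrite -!mulr_sumr -/(Eform x x) -normX2E -/N.
  rewrite -/(QRsum x u) -/(QIsum x u) -/(Wsum u u) -/A -/B; ring.
have [N0'|Npos] := leP N 0.
  have x0 i : x.1 ord0 i = 0 /\ x.2 ord0 i = 0.
    have xx0 : x = 0 by apply: Eform_eq0; rewrite -normX2E; apply/le_anti; rewrite N0' N0.
    by rewrite xx0 !mxE.
  have -> : A = 0 by rewrite /A /QRsum big1// => i _; have [-> ->] := x0 i; ring.
  have -> : B = 0 by rewrite /B /QIsum big1// => i _; have [-> ->] := x0 i; ring.
  by rewrite expr0n/= addr0 mulr_ge0// Wsum_ge0.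
by move: sq; rewrite e pmulr_rge0// subr_ge0.
Qed.

Lemma Wsum_eq0 (u : Q) : (thC u).1 ord0 ord0 = 0 -> (thC u).2 ord0 ord0 = 0 ->
  Wsum u u = 0 -> thC u = 0.
Proof.
move=> t0 v0 /eqP; rewrite psumr_eq0; last first.
  by move=> i _; rewrite addr_ge0// -expr2 sqr_ge0.
move=> /allP h; have hi i : (thC u).1 ord0 i = 0 /\ (thC u).2 ord0 i = 0.
  case: (unliftP ord0 i) => [j ->|-> //].
  have := h j (mem_index_enum _); rewrite -!expr2 paddr_eq0 ?sqr_ge0//.
  by rewrite !sqrf_eq0 => /andP[/eqP -> /eqP ->].
case: (thC u) {h t0 v0} hi => a b hi; congr (_, _); apply/rowP => i; rewrite mxE;
  by have [] := hi i.
Qed.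

Section AtPoint.
Variables (m : int) (c : R) (q : Q).
Hypothesis qfar : far m c q.

Let s := z0C c q.
Let y := 1 - normX2 (XC q).

Lemma far_rc : 0 < rhoC q + c.
Proof. by have [_ h _ _ _] := qfar; lra. Qed.

Lemma far_T0 : 0 < 1 + vinstq m c q.
Proof.
have [x1 _ _ s2 [hv _ _ _]] := qfar.
have y1 : y <= 1 by rewrite /y lerBlDr lerDl normX2_ge0.
have : `|vinstq m c q| <= y / 100.
  by apply: le_trans hv; rewrite ler_peMr// exprn_ege1// (le_trans _ s2)// ler1n.
by rewrite ler_norml => /andP[h _]; clear -h y1; lra.
Qed.

Lemma far_fham : 1 <= fhamq m c q /\ fhamq m c q <= 5 / 4 * (rhoC q + c).
Proof.
have [x1 h24 hc s2 [_ _ hb _]] := qfar.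
have y1 : y <= 1 by rewrite /y lerBlDr lerDl normX2_ge0.
have : `|binstq m c q| <= y / 100.
  by apply: le_trans hb; rewrite ler_peMr// exprn_ege1// (le_trans _ s2)// ler1n.
rewrite ler_norml => /andP[b1 b2]; have := ler_norm c; have := ler_norm (- c).
by rewrite normrN /fhamq => c1 c2; clear -b1 b2 c1 c2 y1 h24 hc; split; lra.
Qed.

(** [f_1] contains [v] multiplied by [s^2]; this is why [far] bounds [v s^2]
    and not only [v]. *)
Lemma far_fham1 : fham1q m c q < 0.
Proof.
have [x1 h24 hc s2 [hv ha hb _]] := qfar.
have y1 : y <= 1 by rewrite /y lerBlDr lerDl normX2_ge0.
have s21 : 1 <= s ^+ 2 by rewrite exprn_ege1// (le_trans _ s2)// ler1n.
have : `|binstq m c q| <= y / 100 by apply: le_trans hb; rewrite ler_peMr.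
rewrite ler_norml => /andP[b1 b2].
have : `|vinstq m c q * s ^+ 2| <= y / 100 by rewrite normrM (ger0_norm (sqr_ge0 s)).
rewrite ler_norml => /andP[v1 v2].
have p0 := @pi_gt0 R; have p4 := pi_le4.
have a2 : 0 <= pi^-1 * (1 + vinstq m c q)^-1 * ainstq m c q ^+ 2.
  have T0 := far_T0.
  by rewrite mulr_ge0 ?sqr_ge0// mulr_ge0 ?invr_ge0 ?(ltW T0) ?(ltW p0).
have pv : - (4 * pi * (vinstq m c q * s ^+ 2)) <= 16 / 100.
  by clear -v1 v2 p0 p4 y1; nra.
have := ler_norm c; have := ler_norm (- c); rewrite normrN => c1 c2.
by rewrite /fham1q -/s; clear -a2 pv b1 b2 c1 c2 h24 hc y1; lra.
Qed.

Lemma far_z0C_gt0 : 0 < s.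
Proof. by have [x1 _ _ _ _] := qfar; apply: z0C_gt0 => //; exact: far_rc. Qed.

Lemma far_y : 0 < y /\ y <= 1.
Proof.
by have [x1 _ _ _ _] := qfar; rewrite /y subr_gt0 lerBlDr lerDl normX2_ge0.
Qed.

Lemma far_sg : 2 * pi * s ^+ 2 * y = rhoC q + c.
Proof.
have [x1 _ _ _ _] := qfar; have [y0 _] := far_y.
have p0 := @pi_gt0 R.
rewrite z0C_sqr// ?far_rc// -/y; have yn := lt0r_neq0 y0; have pn := lt0r_neq0 p0.
by move: (@pi R) pn {p0} => P Pn; field; rewrite Pn yn.
Qed.

(** If the sum of non-negative terms vanishes, then so do [dX], [d rho] and
    [d theta]; the square of [theta_1] has then become that of [d sigma]. *)
Lemma slice_metric_gt0 (u : Q) : u != 0 -> 0 < slice_metric m c q u u.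
Proof.
move=> /negP u0; rewrite ltNge; apply/negP => gle; apply: u0; apply/eqP.
have [x1 h24 hc s2 [hv ha hb hbs]] := qfar.
have [f1 f2] := far_fham; have T0 := far_T0; have F0 := far_fham1.
have [y0 y1] := far_y; have s0 := far_z0C_gt0; have p0 := @pi_gt0 R.
have s1 : 1 <= s by rewrite (le_trans _ s2)// ler1n.
have fpos : 0 < fhamq m c q by lra.
have F1 : 0 < - fham1q m c q by rewrite oppr_gt0.
move: gle; rewrite /slice_metric -(opprK (fham1q m c q)) /dlogz0 -far_sg -/y -/s.
rewrite qkform_diag// pmulr_rle0 ?invr_gt0//.
set r := dfhamq m c q u; set D := dsigform q u; set A := QRsum _ u; set B := QIsum _ u.
set E := Eform (XC q) (XC u); set F := Fform _ _; set t := (thC u).1 _ _.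
set v := (thC u).2 _ _; set G := Eform (XC u) _; set W := Wsum u u.
have G0 : 0 <= G := Eform_ge0 _; have W0 : 0 <= W := Wsum_ge0 u.
have hQ : A ^+ 2 + B ^+ 2 <= (1 - y) * W by rewrite /y subKr; exact: XW_le.
have hbt : `|pi^-1 * ainstq m c q| * s ^+ 2 <= y / 100.
  have p1 : pi^-1 <= 1 :> R by rewrite invf_le1//; have := @pi_ge2 R; lra.
  apply: le_trans ha; rewrite ler_wpM2r ?sqr_ge0// normrM ler_piMl//.
  by rewrite ger0_norm// invr_ge0 ltW.
have := @rest_bound R pi (fhamq m c q) y s (vinstq m c q) (ainstq m c q) r (rhoC u)
  (pi^-1 * ainstq m c q) (dbinstq m c q) E t v A B G W (@pi_ge2 R) pi_le4 f1 y0 y1 s1.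
rewrite /= far_sg => /(_ f2 h24 hv ha hbt hbs erefl G0 W0 hQ) hrest gle.
have yn := lt0r_neq0 y0.
set e1 := _ - epsinstq m c q * t in gle; set e2 := D + _ in gle.
have q1 : 0 <= 2 / - fham1q m c q * e1 ^+ 2.
  by rewrite mulr_ge0 ?sqr_ge0// divr_ge0// ltW.
have q2 : 0 <= 2 / fhamq m c q * e2 ^+ 2.
  by rewrite mulr_ge0 ?sqr_ge0// divr_ge0// ltW.
have q3 : 0 <= 2 * pi * s ^+ 2 * G by rewrite !mulr_ge0 ?sqr_ge0// ltW.
have q4 : 0 <= rhoC u ^+ 2 / (48 * (rhoC q + c)).
  by rewrite divr_ge0 ?sqr_ge0// mulr_ge0// ltW// far_rc.
have q5 : 0 <= (2 * pi)^-1 *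
    (y / 32 * (t ^+ 2 + ((1 + vinstq m c q) * v) ^+ 2) + y / 8 * W).
  rewrite mulr_ge0 ?invr_ge0 ?mulr_ge0 ?(ltW p0)// addr_ge0// mulr_ge0//.
  - by rewrite divr_ge0// ltW.
  - by rewrite addr_ge0 ?sqr_ge0.
  - by rewrite divr_ge0// ltW.
have [r2 r3 r4 r5] := sums_eq0 q1 q2 q3 q4 q5 hrest gle.
have X0 : XC u = 0.
  apply: Eform_eq0; have c0 : 0 < 2 * pi * s ^+ 2 by rewrite !mulr_gt0// exprn_gt0.
  by move/eqP: r3; rewrite mulf_eq0 (negPf (lt0r_neq0 c0)) => /eqP.
have rho0 : rhoC u = 0.
  move/eqP: r4; rewrite mulf_eq0 sqrf_eq0 invr_eq0 mulf_eq0 pnatr_eq0.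
  by rewrite (negPf (lt0r_neq0 far_rc)) !orbF => /eqP.
have [tv0 WW0] : t ^+ 2 + ((1 + vinstq m c q) * v) ^+ 2 = 0 /\ W = 0.
  have w0 : 0 <= t ^+ 2 + ((1 + vinstq m c q) * v) ^+ 2 by rewrite addr_ge0 ?sqr_ge0.
  have P1 : 0 < (2 * pi)^-1 :> R by rewrite invr_gt0 mulr_gt0.
  have y32 : 0 < y / 32 by rewrite divr_gt0.
  have y8 : 0 < y / 8 by rewrite divr_gt0.
  move/eqP: r5; rewrite mulf_eq0 (negPf (lt0r_neq0 P1)) orFb.
  have h1 := mulr_ge0 (ltW y32) w0; have h2 := mulr_ge0 (ltW y8) W0.
  rewrite (paddr_eq0 h1 h2).
  rewrite mulf_eq0 (negPf (lt0r_neq0 y32)) mulf_eq0 (negPf (lt0r_neq0 y8)) !orFb.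
  by move=> /andP[/eqP -> /eqP ->].
have [t0 v0] : t = 0 /\ v = 0.
  move/eqP: tv0; rewrite paddr_eq0 ?sqr_ge0// !sqrf_eq0 mulf_eq0.
  by rewrite (negPf (lt0r_neq0 T0)) /= => /andP[/eqP -> /eqP ->].
have th0 : thC u = 0 by apply: Wsum_eq0.
have sg0 : sigC u = 0.
  have F00 : F = 0 by rewrite /F X0 /Fform big1// => i _; rewrite !mxE !mulr0 subr0.
  have c2 : 0 < 2 / fhamq m c q by rewrite divr_gt0.
  move/eqP: r2; rewrite mulf_eq0 (negPf (lt0r_neq0 c2)) sqrf_eq0 orFb /e2 F00 mulr0 addr0 /D /dsigform th0.
  rewrite /pair_theta big1 ?mulr0 ?subr0; first by move=> /eqP.
  by move=> i _; rewrite !mxE !mulr0 subr0.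
move: X0 rho0 th0 sg0; rewrite /XC /rhoC /thC /sigC.
by case: u {gle hrest r A B t v W G D E F q1 q2 q3 q4 q5 e1 e2 r2 r3 r4 r5 tv0 WW0 t0 v0 G0 W0 hQ} => [[[rho X] th] sg] /= -> -> -> ->.
Qed.

End AtPoint.
End FarRegion.

(** * A uniform threshold for rho *)

Section Threshold.
Context {R : realType} {n : nat}.
Local Notation Q := (coordN R n).

(** Exponential decay in [s] beats any power, and on the slice
    [1 / s^2 <= 8 y / (rho + c)]; so one bound on [rho] serves all points. *)
Lemma far_threshold (m : int) (c K : R) : 0 < K -> exists A : R, forall q : Q,
  normX2 (XC q) < 1 -> A < rhoC q -> far m c q /\ K < z0C c q.
Proof.
move=> K0; have [C C0 hC] := @inst_decay R.
pose D : R := 2 * `|m%:~R| * C.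
have D0 : 0 <= D by rewrite !mulr_ge0.
have [B [B0 hB]] : exists B : R, 0 <= B /\ D * 24 = B / 100.
  exists (D * 24 * 100); split; first by rewrite !mulr_ge0.
  by rewrite mulfK// pnatr_eq0.
exists (`|c| + 32 + 8 * (`|c| + 1) + 8 * B + 8 * K ^+ 2) => q x1 hA.
have c1 : - `|c| <= c by rewrite lerNl -normrN ler_norm.
have cn := normr_ge0 c; have K20 := sqr_ge0 K.
have sg1 : 32 + 8 * (`|c| + 1) + 8 * B + 8 * K ^+ 2 <= rhoC q + c by lra.
have sg0 : 0 < rhoC q + c by lra.
set s := z0C c q; set y := 1 - normX2 (XC q).
have y0 : 0 < y by rewrite subr_gt0.
have y1 : y <= 1 by rewrite /y lerBlDr lerDl normX2_ge0.
have s0 : 0 < s by exact: z0C_gt0.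
have p0 := @pi_gt0 R; have p4 := @pi_le4 R.
have sy : rhoC q + c <= 8 * (s ^+ 2 * y).
  have yn := lt0r_neq0 y0; have pn := lt0r_neq0 p0.
  have <- : 2 * pi * (s ^+ 2 * y) = rhoC q + c.
    rewrite z0C_sqr// -/y.
    by move: (@pi R) pn {p0 p4} => P pn; field; rewrite pn yn.
  have p8 : 2 * pi <= 8 :> R by clear -p4; lra.
  by rewrite ler_wpM2r// mulr_ge0 ?sqr_ge0// ltW.
have s28 : rhoC q + c <= 8 * s ^+ 2.
  by apply: le_trans sy _; rewrite ler_pM2l// ler_piMr// sqr_ge0.
have s2 : 2 <= s by rewrite -(ler_pXn2r (n := 2)) ?nnegrE ?(ltW s0)//; lra.
have sK : K < s.
  by rewrite -(ltr_pXn2r (n := 2)) ?nnegrE ?(ltW s0) ?(ltW K0)//; lra.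
have s1 : 1 <= s by rewrite (le_trans _ s2)// ler1n.
have small (z : R) : `|z| <= D * expR (- s) -> `|z| * s ^+ 2 <= y / 100.
  move=> hz; apply: (@le_trans _ _ (D * expR (- s) * s ^+ 2)).
    by rewrite ler_wpM2r ?sqr_ge0.
  have s4 : s ^+ 4 * expR (- s) <= 24.
    rewrite expRN ler_pdivrMr ?expR_gt0//.
    by have := exprn_le_expR 4 (ltW s0).
  have es : D * expR (- s) * s ^+ 2 * s ^+ 2 <= D * 24.
    have -> : D * expR (- s) * s ^+ 2 * s ^+ 2 = D * (s ^+ 4 * expR (- s)) by ring.
    by rewrite ler_wpM2l.
  have h2 : D * 24 <= y / 100 * s ^+ 2.
    have : 8 * B <= 8 * (s ^+ 2 * y) by apply: le_trans sy; lra.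
    by rewrite hB; clear; lra.
  have s20 : 0 < s ^+ 2 by rewrite exprn_gt0.
  by rewrite -(ler_pM2r s20); apply: le_trans es h2.
have [hV hS hBb hBs] := hC s ((thC q).2 ord0 ord0) s1.
have pi1 : `|pi^-1| <= 1 :> R.
  rewrite ger0_norm ?invr_ge0 ?(ltW p0)// invf_le1//; have := @pi_ge2 R; lra.
have mul_le (k z : R) : `|k| <= 2 * `|m%:~R| -> `|z| <= C * expR (- s) ->
    `|k * z| <= D * expR (- s).
  by move=> hk hz; rewrite normrM /D -[leRHS]mulrA ler_pM.
have m0 : 0 <= `|m%:~R| :> R by [].
have k1 : `|m%:~R / pi| <= 2 * `|m%:~R| :> R.
  have m2 : `|m%:~R| <= 2 * `|m%:~R| :> R by clear -m0; lra.
  by rewrite normrM; apply: le_trans (ler_piMr m0 pi1) m2.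
have k2 : `|2 * m%:~R| <= 2 * `|m%:~R| :> R by rewrite normrM ger0_norm.
have k3 : `|- (2 * m%:~R / pi)| <= 2 * `|m%:~R| :> R.
  by rewrite normrN normrM (le_trans (ler_piMr _ pi1)).
split=> //; split=> //; first (by clear -sg1 cn B0 K20; lra);
  first by clear -sg1 cn B0 K20; lra.
by split; apply: small; rewrite /vinstq /ainstq /binstq /dbinstq; apply: mul_le.
Qed.

End Threshold.

(** * Points beyond the threshold *)

Section FarPoints.
Context {R : realType} {n : nat}.
Local Notation Q := (coordN R n).
Variables (Om : latvec n -> int) (m : int) (c K : R).
Hypothesis OmP : Om (ddy ord0) = m.
Hypothesis OmN : Om (- ddy ord0) = m.

Lemma sum_lift (F : 'I_n.+1 -> R) :
  \sum_(i | i != ord0) F i = \sum_(i < n) F (lift ord0 i).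
Proof. by rewrite big_mkcond big_ord_recl /= add0r; apply: eq_bigr. Qed.

Lemma inM_embN (q : Q) : 0 < rhoC q + c -> normX2 (XC q) < 1 -> inM (embN c q).1.
Proof.
move=> rc x1; have s0 := z0C_gt0 x1 rc.
rewrite /inM sum_lift zc_embN0.
rewrite (eq_bigr (fun i : 'I_n => z0C c q ^+ 2 * cabs (Xcoord (XC q) i) ^+ 2)); last first.
  by move=> i _; rewrite zc_embNi !cabs_sqr /=; ring.
rewrite -mulr_sumr cabs_sqr /= expr0n/= addr0.
by rewrite -[ltRHS]mulr1 ltr_pM2l// exprn_gt0.
Qed.

Section AtPoint.
Variable q : Q.
Hypothesis qfar : far m c q.
Hypothesis qK : K < z0C c q.

Let x1 : normX2 (XC q) < 1. Proof. by have [] := qfar. Qed.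
Let s2 : 2 <= z0C c q. Proof. by have [] := qfar. Qed.
Let rc : 0 < rhoC q + c := far_rc qfar.
Let T0 : 1 + vinstq m c q != 0. Proof. exact: lt0r_neq0 (far_T0 qfar). Qed.

Lemma far_inNbar_plus : inNbar_plus Om K c q.
Proof.
have [f1 _] := far_fham qfar; have F0 := far_fham1 qfar.
have fpos : 0 < fhamq m c q by lra.
split; rewrite ?(fham_embN OmP OmN)// ?(fham1_embN OmP OmN)//.
split=> //; first split; first exact: inM_embN.
  by rewrite -[cabs _]/(zabs _) (zabs_slice (zc_embN0 c q))// (le_trans _ s2)// ler1n.
rewrite /inN' (fham_embN OmP OmN)// (fham1_embN OmP OmN)// (gN_XX_embN OmP OmN)//.
split; [exact: lt0r_neq0|exact: ltr0_neq0|apply: lt0r_neq0].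
have [y0 y1] := far_y qfar; have s0 := far_z0C_gt0 qfar; have Tp := far_T0 qfar.
have [_ _ _ _ [hv _ _ _]] := qfar.
have hv1 : `|vinstq m c q| <= (1 - normX2 (XC q)) / 100.
  by apply: le_trans hv; rewrite ler_peMr// exprn_ege1// (le_trans _ s2)// ler1n.
have yv : 0 < 1 - normX2 (XC q) + vinstq m c q.
  by move: hv1; rewrite ler_norml => /andP[h _]; lra.
have p0 := @pi_gt0 R.
rewrite mulr_gt0// ltr_pwDl// ?mulr_gt0// ?exprn_gt0//.
apply: mulr_ge0; last exact: sqr_ge0.
by rewrite mulr_ge0 ?invr_ge0 ?(ltW Tp)// mulr_ge0 ?sqr_ge0.
Qed.

Lemma far_gFS_defined : gFS_defined c q.
Proof.
have [_ h24 hc _ _] := qfar; have := ler_norm c; have := ler_norm (- c).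
rewrite normrN => c1 c2.
by split=> //; apply: lt0r_neq0; lra.
Qed.

Lemma far_gNbar u w : gNbar Om c q u w = slice_metric m c q u w.
Proof. exact: gNbarE. Qed.

End AtPoint.
End FarPoints.

(** * The neighborhood of infinity *)

Section Neighborhood.
Context {R : realType} {n : nat}.
Local Notation Q := (coordN R n).
Variable A : R.

Definition rho_region : set Q := [set q | normX2 (XC q) < 1 /\ A < rhoC q].

Lemma nbhd_rho_region : nbhd_rho_infty rho_region.
Proof.
split.
- have cX : continuous (fun q : Q => normX2 (XC q)).
    move=> q; apply: (@continuous_comp _ _ _ (@XC R n) (@normX2 R n)).
      apply: (@continuous_comp _ _ _ (fun q : Q => q.1.1) snd); last exact: cvg_snd.
      by apply: (@continuous_comp _ _ _ (fun q : Q => q.1) fst); exact: cvg_fst.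
    exact: continuous_normX2.
  have cr : continuous (@rhoC R n).
    move=> q; apply: (@continuous_comp _ _ _ (fun q : Q => q.1.1) fst); last exact: cvg_fst.
    by apply: (@continuous_comp _ _ _ (fun q : Q => q.1) fst); exact: cvg_fst.
  apply: openI.
    by apply: (@open_comp _ _ (fun q : Q => normX2 (XC q)) [set z | z < 1]) => //;
      exact: open_lt.
  by apply: (@open_comp _ _ (@rhoC R n) [set z | A < z]) => //; exact: open_gt.
- by move=> d k q.
- by move=> x th s x1; exists A => r hr; split.
Qed.

Lemma pos_def_metric_slice_metric (m : int) (c : R) (g : Q -> Q -> Q -> R) :
  (forall q, rho_region q -> far m c q) ->
  (forall q, rho_region q -> forall u w, g q u w = slice_metric m c q u w) ->
  pos_def_metric_on rho_region g.
Proof.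
move=> hfar hg; split=> [q Uq|d k q u w Uq]; last first.
  by rewrite !hg//; exact: slice_metric_deck.
split=> [a u v w|u v|u u0]; rewrite !hg//.
- exact: slice_metricPl.
- exact: slice_metric_sym.
- by apply: slice_metric_gt0 => //; exact: hfar.
Qed.

End Neighborhood.

Theorem corollary5p10 (R : realType) (n : nat) (m : int) (Om : latvec n -> int)
    (K c : R) :
  m != 0 ->
  (forall g : latvec n, (Om g != 0) = (g \in support_charges)) ->
  (forall g : latvec n, g \in support_charges -> Om g = m) ->
  0 < K -> compatible Om K ->
  exists U : set (coordN R n),
    [/\ nbhd_rho_infty U,
        (forall q, U q -> inNbar_plus Om K c q /\ gFS_defined c q),
        pos_def_metric_on U (gFS c),
        pos_def_metric_on U (gNbar Om c)
      & forall q, U q ->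
          inNbar (fun=> 0) K c q /\
          forall u v, gNbar (fun=> 0) c q u v = gFS c q u v].
Proof.
move=> _ _ Om_m K0 _.
have OmP : Om (ddy ord0) = m by apply: Om_m; rewrite mem_head.
have OmN : Om (- ddy ord0) = m by apply: Om_m; rewrite !inE eqxx orbT.
(* The second threshold makes the same estimates available for [Omega = 0],
   that is, for the Ferrara-Sabharwal metric. *)
have [A hA] := @far_threshold R n m c K K0.
have [B hB] := @far_threshold R n 0 c K K0.
exists (rho_region (Num.max A B)).
have hm (q : coordN R n) : rho_region (Num.max A B) q -> far m c q /\ K < z0C c q.
  by move=> [x1]; rewrite gt_max => /andP[Aq _]; exact: hA.
have h0 (q : coordN R n) : rho_region (Num.max A B) q -> far 0 c q /\ K < z0C c q.
  by move=> [x1]; rewrite gt_max => /andP[_ Bq]; exact: hB.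
have eFS (q : coordN R n) : rho_region (Num.max A B) q -> forall u w, gFS c q u w = slice_metric 0 c q u w.
  move=> /h0[q0 _] u w; rewrite slice_metric0_gFS//; first exact: far_rc q0.
  exact: far_gFS_defined q0.
split.
- exact: nbhd_rho_region.
- move=> q /hm[qf qK]; split; first exact: far_inNbar_plus qf qK.
  exact: far_gFS_defined qf.
- by apply: (@pos_def_metric_slice_metric _ _ _ 0 c) => // q /h0[].
- apply: (@pos_def_metric_slice_metric _ _ _ m c) => q /hm[qf qK] // u w.
  exact: far_gNbar.
- move=> q Uq; have [qf qK] := h0 q Uq; split.
    by have [] := @far_inNbar_plus _ _ (fun=> 0) 0 c K erefl erefl q qf qK.
  by move=> u v; rewrite eFS//; exact: far_gNbar.
Qed.
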